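(* Let $N\ge1$, $\rho>0$, $p\in(2,2^* )$ and $V\in L^r(\mathbb R^N)$ for some $r\in[\max(1,\frac N2),+\infty]$, with $r>1$ if $N=2$. If $u\in S_\rho\cap W^{2,2}(\mathbb R^N)$ is a critical point of $F$ constrained on $S_\rho$, then $$\int_{\mathbb R^N}V(x)\,u\,\frac{\partial u}{\partial\nu}\,dx=0$$ for every direction $\nu\in\mathbb R^N\setminus\{0\}$.
   Context: $2^*=\frac{2N}{N-2}$ if $N\ge3$ and $2^*=+\infty$ if $N=1,2$. $S_\rho=\{u\in H^1(\mathbb R^N):\int_{\mathbb R^N}u^2dx=\rho^2\}$ and $$F(u)=\frac12\int_{\mathbb R^N}(|\nabla u|^2-V(x)u^2)\,dx-\frac1p\int_{\mathbb R^N}|u|^p\,dx,\qquad u\in H^1(\mathbb R^N).$$ *)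

(* Defs.v *)
From HB Require Import structures.
From mathcomp Require Import all_boot all_order all_algebra.
From mathcomp Require Import all_classical all_reals all_analysis.
Set Implicit Arguments.
Unset Strict Implicit.
Unset Printing Implicit Defensive.
Import Order.TTheory GRing.Theory Num.Theory.
Import numFieldNormedType.Exports.
Local Open Scope classical_set_scope.
Local Open Scope ring_scope.

Definition measure_rV_display : measure_display -> measure_display.
Proof. exact. Qed.

(* The product sigma-algebra on R^n, i.e. the Borel one: the smallest
   sigma-algebra making the coordinates measurable, as in the library for
   [n.-tuple T]. *)
Section measurable_rV.
Context {R : realType} (n : nat).

Let coors : 'I_n -> 'rV[R]_n -> measurableTypeR R := fun i x => x ord0 i.

Let rV_set0 : g_sigma_preimage coors set0.
Proof. exact: sigma_algebra0. Qed.

Let rV_setC A : g_sigma_preimage coors A -> g_sigma_preimage coors (~` A).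
Proof. exact: sigma_algebraC. Qed.

Let rV_bigcup (F : _^nat) : (forall i, g_sigma_preimage coors (F i)) ->
  g_sigma_preimage coors (\bigcup_i (F i)).
Proof. exact: sigma_algebra_bigcup. Qed.

HB.instance Definition _ :=
  @isMeasurable.Build (measure_rV_display default_measure_display)
    'rV[R]_n (g_sigma_preimage coors) rV_set0 rV_setC rV_bigcup.

Lemma measurable_coord (i : 'I_n) :
  measurable_fun [set: 'rV[R]_n]
    (fun x : 'rV[R]_n => x ord0 i : measurableTypeR R).
Proof.
move=> _ Y mY; rewrite setTI; apply: sub_sigma_algebra => /=.
rewrite -bigcup_seq/=; exists i => /=; first by rewrite mem_index_enum.
by exists Y => //; rewrite setTI.
Qed.

Lemma measurable_fun_coordP d (T : measurableType d) (f : T -> 'rV[R]_n) :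
  (forall i, measurable_fun [set: T]
    (fun t => f t ord0 i : measurableTypeR R)) ->
  measurable_fun [set: T] f.
Proof.
move=> mf.
have : g_sigma_preimage (fun i => coors i \o f) `<=` measurable.
  apply: smallest_sub; first exact: sigma_algebra_measurable.
  move=> A; rewrite -bigcup_seq => -[i _ [B mB <-]].
  exact: mf.
rewrite g_sigma_preimage_comp => sub _ A mA.
by apply: sub; exists A.
Qed.

End measurable_rV.

Section lebesgue_rV.
Context {R : realType}.

Section cons.
Variable n : nat.

Definition cons_rV (p : measurableTypeR R * 'rV[R]_n) : 'rV[R]_n.+1 :=
  \row_i if unlift ord0 i is Some j then p.2 ord0 j else p.1.

Definition uncons_rV (x : 'rV[R]_n.+1) : measurableTypeR R * 'rV[R]_n :=
  (x ord0 ord0, \row_j x ord0 (lift ord0 j)).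

Lemma cons_rV0 p : cons_rV p ord0 ord0 = p.1.
Proof. by rewrite mxE unlift_none. Qed.

Lemma cons_rVS p (j : 'I_n) : cons_rV p ord0 (lift ord0 j) = p.2 ord0 j.
Proof. by rewrite mxE liftK. Qed.

Lemma cons_rVK : cancel cons_rV uncons_rV.
Proof.
move=> [a y]; rewrite /uncons_rV cons_rV0; congr pair.
by apply/rowP => j; rewrite mxE cons_rVS.
Qed.

Lemma uncons_rVK : cancel uncons_rV cons_rV.
Proof.
move=> x; apply/rowP => i; case: (unliftP ord0 i) => [j ->|->].
  by rewrite cons_rVS mxE.
by rewrite cons_rV0.
Qed.

Lemma measurable_cons_rV : measurable_fun setT cons_rV.
Proof.
apply: measurable_fun_coordP => i; case: (unliftP ord0 i) => [j ->|->].
  under eq_fun do rewrite cons_rVS.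
  exact: (measurableT_comp (measurable_coord (n := n) j) measurable_snd).
by under eq_fun do rewrite cons_rV0; exact: measurable_fst.
Qed.

Lemma measurable_uncons_rV : measurable_fun setT uncons_rV.
Proof.
apply/measurable_fun_pairP; split; first exact: measurable_coord.
apply: measurable_fun_coordP => i.
under eq_fun do rewrite /= mxE.
exact: measurable_coord.
Qed.

Variable m : {sigma_finite_measure set 'rV[R]_n -> \bar R}.

Definition cons_measure : set 'rV[R]_n.+1 -> \bar R :=
  pushforward (@lebesgue_measure R \x m)%E cons_rV.

Let cons_measure0 : cons_measure set0 = 0%E.
Proof. by rewrite /cons_measure /pushforward preimage_set0 measure0. Qed.

Let cons_measure_ge0 A : (0 <= cons_measure A)%E.
Proof. exact: (measure_ge0 (@lebesgue_measure R \x m)%E). Qed.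

Let cons_measure_sigma_additive : semi_sigma_additive cons_measure.
Proof.
move=> F mF tF mUF; rewrite /cons_measure /pushforward preimage_bigcup.
apply: measure_semi_sigma_additive.
- by move=> i; rewrite -[X in measurable X]setTI; exact: measurable_cons_rV.
- apply/trivIsetP => /= i j _ _ ij; rewrite -preimage_setI.
  by move/trivIsetP : tF => /(_ _ _ _ _ ij) ->//; rewrite preimage_set0.
- rewrite -preimage_bigcup -[X in measurable X]setTI.
  exact: measurable_cons_rV.
Qed.

HB.instance Definition _ := isMeasure.Build _ _ _ cons_measure
  cons_measure0 cons_measure_ge0 cons_measure_sigma_additive.

Let cons_measure_sigma_finite : sigma_finite setT cons_measure.
Proof.
have /sigma_finiteP[F [FT ndF Foo]] := sigma_finiteT (@lebesgue_measure R).
have /sigma_finiteP[G [GT ndG Goo]] := sigma_finiteT m.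
exists (fun i => uncons_rV @^-1` (F i `*` G i)).
  rewrite -preimage_bigcup (_ : \bigcup_i (F i `*` G i) = setT)//.
  apply/seteqP; split => // -[x y] _.
  have [i _ Fix] : (\bigcup_i F i) x by rewrite -FT.
  have [j _ Gjy] : (\bigcup_i G i) y by rewrite -GT.
  exists (maxn i j) => //; split => /=.
  - by move: x Fix; exact/subsetPset/ndF/leq_maxl.
  - by move: y Gjy; exact/subsetPset/ndG/leq_maxr.
move=> i; have [mF Fioo] := Foo i; have [mG Gioo] := Goo i; split.
  rewrite -[X in measurable X]setTI; apply: measurable_uncons_rV => //.
  exact: measurableX.
rewrite /cons_measure /pushforward -comp_preimage.
rewrite (_ : uncons_rV \o cons_rV = id); last by apply/funext; exact: cons_rVK.
by rewrite preimage_id product_measure1E// lte_mul_pinfty// ge0_fin_numE.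
Qed.

HB.instance Definition _ := Measure_isSigmaFinite.Build _ _ _ cons_measure
  cons_measure_sigma_finite.

End cons.

Fixpoint lebesgue_rV n : {sigma_finite_measure set 'rV[R]_n -> \bar R} :=
  if n is n'.+1 then cons_measure (lebesgue_rV n') else \d_(0 : 'rV[R]_0).

Lemma lebesgue_rV_box n (A : 'I_n -> set (measurableTypeR R)) :
  (forall i, measurable (A i)) ->
  lebesgue_rV n [set x : 'rV[R]_n | forall i, A i (x ord0 i)] =
  (\prod_(i < n) @lebesgue_measure R (A i))%E.
Proof.
elim: n A => [|n IH] A mA.
  by rewrite big_ord0 /= diracE mem_set// => -[].
rewrite big_ord_recl -IH; last by move=> i; exact: mA.
rewrite -product_measure1E//; last first.
  rewrite (_ : [set x | _] =
      \bigcap_(i in [set: 'I_n])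
        ((fun x : 'rV[R]_n => x ord0 i) @^-1` A (lift ord0 i))).
    apply: fin_bigcap_measurable => // i _.
    by rewrite -[X in measurable X]setTI; exact: measurable_coord.
  by apply/seteqP; split => x /= Ax i; [move=> _; exact: Ax|exact: (Ax i I)].
rewrite /= /cons_measure /pushforward; congr product_measure1.
apply/seteqP; split => -[a y] /= Ay.
  split => [|i]; first by have := Ay ord0; rewrite cons_rV0.
  by have := Ay (lift ord0 i); rewrite cons_rVS.
move=> i; case: (unliftP ord0 i) => [j ->|->]; rewrite ?cons_rVS ?cons_rV0.
  exact: Ay.2.
exact: Ay.1.
Qed.

End lebesgue_rV.

Section sobolev.
Context {R : realType} {N : nat}.
Local Notation leb := (@lebesgue_rV R N).
Implicit Types (u v g phi : 'rV[R]_N -> R) (i : 'I_N).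

Definition basis_vec i : 'rV[R]_N := delta_mx ord0 i.

(* C^oo: every iterated partial derivative is everywhere differentiable. *)
Definition smooth phi : Prop := forall (s : seq 'I_N) (x : 'rV[R]_N),
  differentiable (foldr (fun i f => 'D_(basis_vec i) f) phi s) x.

Definition test_function phi : Prop :=
  smooth phi /\ compact (closure [set x | phi x != 0]).

(* Only used with [u] and [g] in L^2, so that both integrals converge. *)
Definition is_weak_partial i u g : Prop := forall phi, test_function phi ->
  (\int[leb]_x (u x * 'D_(basis_vec i) phi x) =
   - \int[leb]_x (g x * phi x))%R.

(* W^{k,2}(R^N) = H^k(R^N), for Borel representatives of the classes. *)
Fixpoint sobolev (k : nat) u : Prop :=
  u \in Lfun leb 2%:E /\
  if k is k'.+1
  then forall i, exists2 g, is_weak_partial i u g & sobolev k' g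
  else True.

(* A representative of the i-th weak partial derivative of [u], chosen in L^2
   (it is unique almost everywhere); 0 if there is none. *)
Definition weak_partial i u : 'rV[R]_N -> R :=
  xget (cst 0) [set g | g \in Lfun leb 2%:E /\ is_weak_partial i u g].

Definition weak_dir_derive (nu : 'rV[R]_N) u : 'rV[R]_N -> R :=
  fun x => \sum_(i < N) nu ord0 i * weak_partial i u x.

Definition sq_norm_grad u : 'rV[R]_N -> R :=
  fun x => \sum_(i < N) weak_partial i u x ^+ 2.

Definition energy (V : 'rV[R]_N -> R) (p : R) u : R :=
  2^-1 * \int[leb]_x (sq_norm_grad u x - V x * u x ^+ 2)
  - p^-1 * \int[leb]_x (`|u x| `^ p).

Definition mass_sphere (rho : R) u : Prop :=
  sobolev 1 u /\ \int[leb]_x (u x ^+ 2) = rho ^+ 2.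

(* [F] has derivative 0 at [u] in every direction of the tangent space
   {phi in H^1 | \int u phi = 0} of the sphere at [u]; for F of class C^1 on H^1
   this says that the differential of F at [u] vanishes on that space. *)
Definition constrained_critical (F : ('rV[R]_N -> R) -> R) (rho : R) u : Prop :=
  mass_sphere rho u /\
  forall phi, sobolev 1 phi -> \int[leb]_x (u x * phi x) = 0 ->
    is_derive (0 : R) (1 : R) (fun t : R => F (fun x => u x + t * phi x)) 0.

End sobolev.

(* 2^* *)
Definition critical_exponent (R : realType) (N : nat) : \bar R :=
  if (3 <= N)%N then (2 * N%:R / (N%:R - 2))%:E else +oo%E.

(* Main.v *)
(* Translating along [nu] preserves the integral of |u|^p and that of |grad u|^2,
   so the tangent vector [phi] = du/dnu kills both terms of the differential of
   the energy, and is tangent to the sphere; what is left is the integral of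
   V u phi. Since [phi] is only known to be in H^1, the power integral is not
   differentiated; its invariance is used in the form of an inequality: the
   integral of |u + t phi|^q is at least that of |u|^q for all [t] and q >= 2.
   By convexity this follows for mollified functions from the vanishing of the
   integral of |u|^(q-2) u du/dnu, and passes to the limit by Fatou. Hence
   J(t) = (integral of |u + t phi|^p) / p, which is finite by the Sobolev
   embedding and is a quadratic polynomial minus an energy with derivative 0 at
   0, is minimal at 0, so that the linear coefficient of that polynomial
   vanishes. With q = 2, applied to [u] and to its partial derivatives, the same
   inequality gives the orthogonality of [u] and [phi] and of their gradients. *)
Require Import Defs.
From HB Require Import structures.
From mathcomp Require Import all_boot all_order all_algebra.
From mathcomp Require Import all_classical all_reals all_analysis.
From mathcomp Require Import measurable_realfun measurable_fun_approximation ess_sup_inf.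
From mathcomp Require Import ring lra.
Set Implicit Arguments.
Unset Strict Implicit.
Unset Printing Implicit Defensive.
Import Order.TTheory GRing.Theory Num.Theory.
Import numFieldNormedType.Exports.
Local Open Scope classical_set_scope.
Local Open Scope ring_scope.

(** * Lebesgue measure on R^n *)

(** Weak derivatives admit no direct chain rule for |u|^q, and [u] itself has no values on lines. A
    mollified function has true derivatives along coordinate lines, equal to the mollified weak
    derivatives; it is bounded, and mollification does not increase the integral of |.|^q. An
    inequality proved for every mollification therefore returns to [u] by Fatou on one side and by
    this contraction on the other. The Sobolev embedding follows the same scheme, with bounds
    independent of the mollification. The second derivatives are used twice: they place [phi] in
    H^1, hence among the admissible variations, and their symmetry gives the orthogonality of the
    gradients, since differentiating [phi] and applying the inequality to a partial derivative of
    [u] produce the mixed derivatives in opposite orders. Finiteness of J cannot be skipped: the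
    real-valued integral of a nonnegative function with infinite integral is 0, which would destroy
    the minimality. The conditions on [r] are those under which V u^2 is integrable for every [u] in
    H^1, through 2 r' <= 2^* for the conjugate exponent r', or through boundedness of [u] when r =
    1. *)

Section translation_R.
Context {R : realType}.
Local Notation RR := (measurableTypeR R).
Local Notation mu := (@lebesgue_measure R).
Local Open Scope ereal_scope.

Lemma measurable_addr (a : R) :
  measurable_fun [set: RR] (fun x : RR => (x + a)%R : RR).
Proof. by apply: measurable_funD. Qed.

Lemma lebesgue_measureD (a : R) (A : set RR) : measurable A ->
  pushforward mu (fun x : RR => (x + a)%R : RR) A = mu A.
Proof.
move=> mA; apply/esym.
apply: lebesgue_measure_unique => //=; first exact: measurable_addr.
move=> _ _ [[b c]] _ <-; rewrite /pushforward.
have -> : (fun x : RR => (x + a)%R : RR) @^-1` `]b, c]%classic =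
    `](b - a)%R, (c - a)%R]%classic.
  by apply/seteqP; split => x /=; rewrite !in_itv/= lerBrDr ltrBlDr.
rewrite !lebesgue_measure_itv/= !lte_fin ltrD2r; case: ifP => // _.
by rewrite -!EFinB; congr EFin; lra.
Qed.

Lemma ge0_integralD_shift (a : R) (f : R -> \bar R) :
  measurable_fun [set: RR] f -> (forall r, 0 <= f r) ->
  \int[mu]_x f (x + a)%R = \int[mu]_x f x.
Proof.
move=> mf f0.
transitivity (\int[pushforward mu (fun x : RR => (x + a)%R : RR)]_x f x).
  by rewrite ge0_integral_pushforward//; exact: measurable_addr.
apply: eq_measure_integral => //=; first exact: measurable_addr.
by move=> ? A mA _; exact: lebesgue_measureD.
Qed.

End translation_R.

Section lebesgue_rV_integral.
Context {R : realType}.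
Local Notation RR := (measurableTypeR R).
Local Notation mu := (@lebesgue_measure R).
Local Open Scope ereal_scope.

Lemma measurable_fun_addrV d (T : measurableType d) n (f g : T -> 'rV[R]_n) :
  measurable_fun setT f -> measurable_fun setT g ->
  measurable_fun setT (fun x => (f x + g x)%R).
Proof.
move=> mf mg; apply: measurable_fun_coordP => i.
under eq_fun do rewrite mxE.
by apply: measurable_funD; exact: (measurableT_comp (measurable_coord i)).
Qed.

Lemma measurable_fun_scalerV d (T : measurableType d) n (f : T -> R)
    (e : 'rV[R]_n) :
  measurable_fun setT f -> measurable_fun setT (fun x => (f x *: e)%R).
Proof.
move=> mf; apply: measurable_fun_coordP => i.
under eq_fun do rewrite mxE.
by apply: measurable_funM.
Qed.

Lemma ge0_integral_cons n (f : 'rV[R]_n.+1 -> \bar R) :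
  measurable_fun setT f -> (forall x, 0 <= f x) ->
  \int[lebesgue_rV n.+1]_x f x =
  \int[mu]_t \int[lebesgue_rV n]_y f (cons_rV (t, y)).
Proof.
move=> mf f0.
transitivity (\int[mu \x lebesgue_rV n]_z f (cons_rV z)).
  by rewrite [LHS]ge0_integral_pushforward//; exact: measurable_cons_rV.
rewrite (fubini_tonelli1 (fun z => f (cons_rV z)))//.
by apply: measurableT_comp => //; exact: measurable_cons_rV.
Qed.

Lemma cons_rVD n (t s : R) (y z : 'rV[R]_n) :
  (cons_rV (t, y) + cons_rV (s, z) = cons_rV ((t + s)%R : RR, y + z))%R.
Proof.
apply/rowP => i; rewrite !mxE; case: unliftP => [j _|_] //=.
by rewrite mxE.
Qed.

Lemma ge0_integral_shift n (a : 'rV[R]_n) (f : 'rV[R]_n -> \bar R) :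
  measurable_fun setT f -> (forall x, 0 <= f x) ->
  \int[lebesgue_rV n]_x f (x + a)%R = \int[lebesgue_rV n]_x f x.
Proof.
elim: n a f => [|n IH] a f mf f0.
  by apply: eq_integral => x _; congr f; apply/rowP => -[].
have mfa : measurable_fun setT (fun x : 'rV[R]_n.+1 => f (x + a)%R).
  by apply: (measurableT_comp mf); exact: measurable_fun_addrV.
rewrite !ge0_integral_cons//.
have mt t : measurable_fun setT (fun y => f (cons_rV (t, y))).
  apply: (measurableT_comp mf); apply: (measurableT_comp (@measurable_cons_rV _ _)).
  exact: measurable_fun_pair.
rewrite -[a]uncons_rVK/= /uncons_rV.
set s := a _ _; set b := (\row_j _)%R.
rewrite -[RHS](ge0_integralD_shift s); last 2 first.
- apply: (measurable_fun_fubini_tonelli_F (fun z => f (cons_rV z))) => //.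
  by apply: (measurableT_comp mf); exact: measurable_cons_rV.
- by move=> t; exact: integral_ge0.
apply: eq_integral => t _; rewrite -[RHS](IH b)//.
by apply: eq_integral => y _; rewrite cons_rVD.
Qed.

Lemma integral_shift n (a : 'rV[R]_n) (f : 'rV[R]_n -> \bar R) :
  measurable_fun setT f ->
  \int[lebesgue_rV n]_x f (x + a)%R = \int[lebesgue_rV n]_x f x.
Proof.
move=> mf; rewrite [LHS]integralE [RHS]integralE.
congr (_ - _).
  rewrite -[RHS](ge0_integral_shift a (measurable_funepos mf))//.
  by apply: eq_integral => x _; rewrite !funeposE.
rewrite -[RHS](ge0_integral_shift a (measurable_funeneg mf))//.
by apply: eq_integral => x _; rewrite !funenegE.
Qed.

Lemma integrable_shift n (a : 'rV[R]_n) (f : 'rV[R]_n -> \bar R) :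
  (lebesgue_rV n).-integrable setT f ->
  (lebesgue_rV n).-integrable setT (fun x => f (x + a)%R).
Proof.
move=> /integrableP[mf fy]; apply/integrableP; split.
  by apply: (measurableT_comp mf); exact: measurable_fun_addrV.
rewrite (ge0_integral_shift a (f := fun x => `|f x|))//.
exact: measurableT_comp.
Qed.

(* Rounding down the coordinates to multiples of [1/(k+1)] takes countably many
   values, and the rounded points converge, whence the measurability. *)
Lemma continuous_measurable_rV n (f : 'rV[R]_n -> R) :
  continuous f -> measurable_fun setT f.
Proof.
move=> cf.
pose g k (x : 'rV[R]_n) : 'rV[int]_n := (\row_i Num.floor (x ord0 i * k.+1%:R))%R.
pose h k (z : 'rV[int]_n) : 'rV[R]_n := (\row_i ((z ord0 i)%:~R / k.+1%:R))%R.
apply: (@measurable_fun_cvg _ _ _ setT (fun k x => f (h k (g k x)))) => //.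
  move=> k _ Y mY; rewrite setTI.
  have -> : (fun x => f (h k (g k x))) @^-1` Y =
      \bigcup_z ([set _ | Y (f (h k z))] `&` \bigcap_(i in [set: 'I_n])
        ((fun x : 'rV[R]_n => (x ord0 i * k.+1%:R)%R : measurableTypeR R)
          @^-1` `[(z ord0 i)%:~R, (z ord0 i + 1)%:~R[%classic)).
    apply/seteqP; split => [x Yx|x [z _ [/= Yz zx]]].
      exists (g k x) => //; split => // i _; rewrite mxE /= in_itv/=.
      exact: floor_itv.
    suff -> : g k x = z by [].
    apply/rowP => i; rewrite mxE; apply/floor_def.
    by have := zx i I; rewrite /= in_itv.
  apply: countable_bigcupT_measurable => // z.
  apply: measurableI.
    have [Yz|nYz] := pselect (Y (f (h k z))).
      by rewrite (_ : [set _ | _] = setT)//; apply/seteqP; split.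
    by rewrite (_ : [set _ | _] = set0)//; apply/seteqP; split.
  apply: fin_bigcap_measurable => // i _.
  rewrite -[X in measurable X]setTI.
  apply: (measurable_funM (measurable_coord i)) => //.
move=> x _; apply: (cvg_comp (fun k => h k (g k x)) f _ (cf x)).
apply/cvg_ballP => e e0; near=> k; split => // i j.
rewrite !mxE (ord1 i) /ball /=.
have /andP[xl xu] := floor_itv (x ord0 j * k.+1%:R).
have k0 : (0 < k.+1%:R :> R)%R by rewrite ltr0n.
rewrite intrD in xu.
apply: (@le_lt_trans _ _ (k.+1%:R^-1)%R); last by near: k; exact: near_infty_natSinv_lt (PosNum e0).
rewrite ger0_norm; last by rewrite subr_ge0 ler_pdivrMr.
by rewrite lerBlDl -[X in (_ + X)%R]mul1r -mulrDl ler_pdivlMr// ltW.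
Unshelve. all: by end_near. Qed.

End lebesgue_rV_integral.

(** * The Loomis-Whitney inequality *)
Section generalized_hoelder.
Context {R : realType}.
Local Open Scope ereal_scope.

Lemma emeasurable_prod d (T : measurableType d) (I : Type) (s : seq I)
    (f : I -> T -> \bar R) : (forall i, measurable_fun setT (f i)) ->
  measurable_fun setT (fun x => \prod_(i <- s) f i x).
Proof.
move=> mf; elim: s => [|i s IH].
  by under eq_fun do rewrite big_nil; exact: measurable_cst.
by under eq_fun do rewrite big_cons; exact: emeasurable_funM.
Qed.

Lemma poweR_prod (I : Type) (s : seq I) (f : I -> \bar R) r :
  (forall i, 0 <= f i) ->
  (\prod_(i <- s) f i) `^ r = \prod_(i <- s) (f i `^ r).
Proof.
move=> f0; elim: s => [|i s IH]; first by rewrite !big_nil poweR1r.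
by rewrite !big_cons poweRM ?IH//; exact: prode_ge0.
Qed.

Lemma prode_poweR_le n (x : 'I_n.+1 -> \bar R) : (forall i, 0 <= x i) ->
  \prod_i (x i `^ n.+1%:R^-1) <= \sum_i (n.+1%:R^-1)%:E * x i.
Proof.
move=> x0; have n0 : (0 < n.+1%:R :> R)%R by rewrite ltr0n.
have [[i xi]|xy] := pselect (exists i, x i = +oo).
  rewrite [X in _ <= X](_ : _ = +oo) ?leey//.
  apply/eqP; rewrite esum_eqy; last first.
    by move=> j _; rewrite gt_eqF// (lt_le_trans _ (mule_ge0 _ (x0 j)))// lee_fin invr_ge0 ltW.
  by apply/existsP; exists i; rewrite xi gt0_muley// lte_fin invr_gt0.
have xE i : x i = (fine (x i))%:E.
  rewrite fineK// ge0_fin_numE// ltey; apply/eqP => xi; apply: xy; by exists i.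
have y0 i : (0 <= fine (x i))%R by exact: fine_ge0.
rewrite -poweR_prod// (eq_bigr _ (fun i _ => xE i)) prodEFin poweR_EFin.
under [X in _ <= X]eq_bigr do rewrite xE -EFinM.
rewrite sumEFin lee_fin.
have := leif_AGM (E := fun i => fine (x i)) (A := 'I_n.+1) (fun i _ => y0 i).
rewrite /= card_ord => -[+ _].
under eq_bigl do rewrite inE.
under [X in (_ <= (X / _) ^+ _)%R -> _]eq_bigl do rewrite inE.
set P := (\prod_i _)%R; set S := (\sum_i fine _)%R => PS.
rewrite -mulr_sumr -/S.
have S0 : (0 <= S)%R by exact: sumr_ge0.
have Sn0 : (0 <= S / n.+1%:R)%R by rewrite divr_ge0// ltW.
have -> : (n.+1%:R^-1 * S = ((S / n.+1%:R) ^+ n.+1) `^ n.+1%:R^-1)%R.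
  by rewrite -powR_mulrn// -powRrM mulfV ?gt_eqF// powRr1// mulrC.
by apply: ge0_ler_powR => //; rewrite ?nnegrE ?exprn_ge0// prodr_ge0.
Qed.

(** Each function is divided by its integral, the arithmetic-geometric mean inequality is applied
    pointwise and integrated: the right side becomes the mean of [n.+1] ones. Integrals equal to 0
    or +oo cannot be divided by and are treated apart. *)
Lemma hoelder_prod d (T : measurableType d) (mu : {measure set T -> \bar R}) n
    (f : 'I_n.+1 -> T -> \bar R) :
  (forall i, measurable_fun setT (f i)) -> (forall i x, 0 <= f i x) ->
  \int[mu]_x \prod_i (f i x `^ n.+1%:R^-1) <=
  \prod_i ((\int[mu]_x f i x) `^ n.+1%:R^-1).
Proof.
move=> mf f0; set r := (n.+1%:R^-1)%R.
have n0 : (0 < n.+1%:R :> R)%R by rewrite ltr0n.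
have r0 : (0 < r)%R by rewrite invr_gt0.
pose a i := \int[mu]_x f i x.
have a0 i : 0 <= a i by exact: integral_ge0.
have mP : measurable_fun setT (fun x => \prod_i (f i x `^ r)).
  by apply: emeasurable_prod => i; exact: (measurableT_comp (measurable_poweR _)).
have [[i ai]|an0] := pselect (exists i, a i = 0).
  rewrite [X in X <= _](_ : _ = 0).
    by apply: prode_ge0 => j _; exact: poweR_ge0.
  transitivity (\int[mu]_(x in setT) (0 : \bar R)); last exact: integral0.
  apply: ae_eq_integral => //.
  have : ae_eq mu setT (f i) (cst 0).
    apply/ae_eq_integral_abs => //.
    by rewrite -[RHS]ai; apply: eq_integral => x _; rewrite gee0_abs.
  apply: filterS => x /(_ I) fix0 _.
  by rewrite (bigD1 i)//= fix0 poweR0r ?mul0e// gt_eqF.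
have {}an0 i : a i != 0 by apply/eqP => ai; apply: an0; exists i.
have agt i : 0 < a i by rewrite lt0e an0 a0.
(* No integral vanishes any more, so an infinite one makes the whole product infinite; before that,
   0 * +oo = 0 could occur. *)
have [[i ai]|any] := pselect (exists i, a i = +oo).
  rewrite [X in _ <= X](_ : _ = +oo) ?leey//.
  rewrite (bigD1 i)//= -/(a i) ai poweRyr ?gt_eqF// gt0_mulye//.
  elim/big_ind : _ => [|x y|j _]; [exact: lte01|exact: mule_gt0|].
  exact/poweR_gt0/agt.
pose b i := fine (a i).
have aE i : a i = (b i)%:E.
  by rewrite fineK// ge0_fin_numE// ltey; apply/eqP => ai; apply: any; exists i.
have b0 i : (0 < b i)%R by rewrite -lte_fin -aE.
pose c := (\prod_i b i `^ r)%R.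
have c0 : (0 <= c)%R by apply: prodr_ge0 => i _; exact: powR_ge0.
have -> : \prod_i ((\int[mu]_x f i x) `^ r) = c%:E.
  by rewrite /c -prodEFin; apply: eq_bigr => i _; rewrite -/(a i) aE poweR_EFin.
rewrite (eq_integral (fun x => c%:E * \prod_i (((b i)^-1%:E * f i x) `^ r))); last first.
  move=> x _; rewrite /c -prodEFin -big_split/=; apply: eq_bigr => i _.
  rewrite -poweR_EFin -poweRM ?lee_fin ?(ltW (b0 i))// ?mule_ge0 ?lee_fin ?invr_ge0 ?(ltW (b0 i))//.
  by rewrite muleA -EFinM mulfV ?gt_eqF// mul1e.
have mbf i : measurable_fun setT (fun x => (b i)^-1%:E * f i x) by exact: measurable_funeM.
have bf0 i x : 0 <= (b i)^-1%:E * f i x by rewrite mule_ge0// lee_fin invr_ge0 ltW.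
rewrite ge0_integralZl//; last 2 first.
- by apply: emeasurable_prod => i; exact: (measurableT_comp (measurable_poweR _)).
- by move=> x _; apply: prode_ge0 => i _; exact: poweR_ge0.
rewrite -[leRHS]mule1; apply: lee_wpmul2l; first by rewrite lee_fin.
apply: (@le_trans _ _ (\int[mu]_x \sum_i r%:E * ((b i)^-1%:E * f i x))).
  apply: ge0_le_integral => //.
  - by move=> x _; apply: prode_ge0 => i _; exact: poweR_ge0.
  - by apply: emeasurable_prod => i; exact: (measurableT_comp (measurable_poweR _)).
  - by apply: emeasurable_sum => i; exact: measurable_funeM.
  - by move=> x _; exact: prode_poweR_le.
rewrite ge0_integral_sum//; last 2 first.
- by move=> i; exact: measurable_funeM.
- by move=> i x _; rewrite mule_ge0// lee_fin ltW.
rewrite (eq_bigr (fun=> r%:E)); last first.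
  move=> i _; rewrite ge0_integralZl//; last by rewrite lee_fin ltW.
  rewrite ge0_integralZl//; last by rewrite lee_fin invr_ge0 ltW.
  by rewrite -/(a i) aE -!EFinM mulVf ?gt_eqF// mulr1.
rewrite sumEFin lee_fin sumr_const card_ord -[(r *+ _)%R]mulr_natr mulVf// gt_eqF.
Qed.

End generalized_hoelder.

Section loomis_whitney.
Context {R : realType}.
Local Notation RR := (measurableTypeR R).
Local Notation mu := (@lebesgue_measure R).
Local Open Scope ereal_scope.

Lemma tonelli d1 d2 (T1 : measurableType d1) (T2 : measurableType d2)
    (m1 : {sigma_finite_measure set T1 -> \bar R})
    (m2 : {sigma_finite_measure set T2 -> \bar R}) (f : T1 -> T2 -> \bar R) :
  measurable_fun setT (fun z => f z.1 z.2) -> (forall x y, 0 <= f x y) ->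
  \int[m1]_x \int[m2]_y f x y = \int[m2]_y \int[m1]_x f x y.
Proof.
by move=> mf f0; exact: (fubini_tonelli (fun z => f z.1 z.2)).
Qed.

Lemma prode_const_poweR n (x : \bar R) (r : R) : (0 < r)%R ->
  \prod_(i < n) (x `^ r) = x `^ (r * n%:R).
Proof.
move=> r0; elim: n => [|n IH]; first by rewrite big_ord0 mulr0 poweRe0.
rewrite big_ord_recl IH -poweRD; last first.
  by apply: add_neq0_poweRD_def; rewrite gt_eqF// ltr_pwDl// mulr_ge0// ltW.
by rewrite -[in RHS]addn1 natrD mulrDr mulr1 addrC.
Qed.

(** For measurable nonnegative [g] this is constant along e_i, hence a function of the other
    coordinates only, as Loomis-Whitney requires. Keeping it on the whole space avoids projections
    to hyperplanes. *)
Definition line_int n (i : 'I_n) (g : 'rV[R]_n -> \bar R) (x : 'rV[R]_n) :=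
  \int[mu]_s g (x + s *: basis_vec i)%R.

Lemma measurable_line n (i : 'I_n) :
  measurable_fun setT (fun z : 'rV[R]_n * RR => (z.1 + z.2 *: basis_vec i)%R).
Proof.
apply: measurable_fun_addrV; first exact: measurable_fst.
by apply: measurable_fun_scalerV; exact: measurable_snd.
Qed.

Lemma measurable_line1 n (i : 'I_n) (x : 'rV[R]_n) :
  measurable_fun setT (fun s : RR => (x + s *: basis_vec i)%R).
Proof.
apply: measurable_fun_addrV => //.
by apply: measurable_fun_scalerV.
Qed.

Lemma measurable_line_int n (i : 'I_n) g :
  measurable_fun setT g -> (forall x, 0 <= g x) ->
  measurable_fun setT (line_int i g).
Proof.
move=> mg g0.
apply: (measurable_fun_fubini_tonelli_F
  (fun z : 'rV[R]_n * RR => g (z.1 + z.2 *: basis_vec i)%R)) => //.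
by apply: (measurableT_comp mg); exact: measurable_line.
Qed.

Lemma line_int_ge0 n (i : 'I_n) g x : (forall x, 0 <= g x) -> 0 <= line_int i g x.
Proof. by move=> g0; apply: integral_ge0. Qed.

Lemma scale_basis0 n (s : R) :
  (s *: basis_vec (ord0 : 'I_n.+1) = cons_rV (s : RR, 0 : 'rV[R]_n))%R.
Proof.
apply/rowP => i; rewrite !mxE; case: unliftP => [j ->|->] /=.
  by rewrite mxE mulr0.
by rewrite mulr1.
Qed.

Lemma scale_basisS n (s : R) (j : 'I_n) :
  (s *: basis_vec (lift ord0 j) = cons_rV (0 : RR, s *: basis_vec j))%R.
Proof.
apply/rowP => i; rewrite !mxE; case: unliftP => [k ->|->] /=.
  by rewrite !mxE /=.
by rewrite mulr0.
Qed.

(** Translation along the line removes [t]: what remains depends on [y] alone and can serve as a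
    weight in one dimension less. *)
Lemma line_int_cons0 n g t (y : 'rV[R]_n) : measurable_fun setT g -> (forall x, 0 <= g x) ->
  line_int ord0 g (cons_rV (t, y)) = \int[mu]_s g (cons_rV (s, y)).
Proof.
move=> mg g0; rewrite /line_int.
rewrite -[RHS](ge0_integralD_shift t)//; last first.
  apply: (measurableT_comp mg); apply: (measurableT_comp (@measurable_cons_rV _ _)).
  exact: measurable_fun_pair.
by apply: eq_integral => s _; rewrite scale_basis0 cons_rVD addr0 [(t + s)%R]addrC.
Qed.

Lemma line_int_consS n (j : 'I_n) g t (y : 'rV[R]_n) :
  line_int (lift ord0 j) g (cons_rV (t, y)) =
  line_int j (fun y => g (cons_rV (t, y))) y.
Proof.
by apply: eq_integral => s _; rewrite scale_basisS cons_rVD addr0.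
Qed.

Lemma line_int_dim1 (g : 'rV[R]_1 -> \bar R) x : measurable_fun setT g ->
  (forall y, 0 <= g y)%E -> line_int ord0 g x = (\int[lebesgue_rV 1]_y g y)%E.
Proof.
move=> mg g0; rewrite -[x]uncons_rVK /uncons_rV line_int_cons0// ge0_integral_cons//.
apply: eq_integral => s _ /=.
rewrite integral_dirac//; last first.
  apply: (measurableT_comp mg); apply: (measurableT_comp (@measurable_cons_rV _ _)).
  exact: measurable_fun_pair.
rewrite diracT mul1e; congr (g (cons_rV (_, _))).
by apply/rowP => -[].
Qed.

(* The weight [w] makes the induction on the dimension go through: in the
   inductive step it absorbs the line integral along the first coordinate. *)
Lemma loomis_whitney n (w : 'rV[R]_n.+1 -> \bar R)
    (g : 'I_n.+1 -> 'rV[R]_n.+1 -> \bar R) (r := (n.+1%:R^-1)%R) :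
  measurable_fun setT w -> (forall x, 0 <= w x) ->
  (forall i, measurable_fun setT (g i)) -> (forall i x, 0 <= g i x) ->
  \int[lebesgue_rV n.+1]_x (w x `^ r * \prod_i (line_int i (g i) x `^ r)) <=
  (\int[lebesgue_rV n.+1]_x w x) `^ r *
  \prod_i ((\int[lebesgue_rV n.+1]_x g i x) `^ r).
Proof.
elim: n w g @r => [|n IH] w g r mw w0 mg g0.
  rewrite /r invr1 big_ord1 !poweRe1 ?integral_ge0//.
  rewrite (eq_integral (fun x => w x * \int[lebesgue_rV 1]_x g ord0 x)); last first.
    by move=> x _; rewrite big_ord1 !poweRe1 ?line_int_ge0// line_int_dim1.
  by rewrite ge0_integralZr// ?integral_ge0.
have mcons t : measurable_fun setT (fun y : 'rV[R]_n.+1 => cons_rV (t : RR, y)).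
  apply: (measurableT_comp (@measurable_cons_rV _ _)).
  exact: measurable_fun_pair.
have mpair h : measurable_fun setT h ->
    measurable_fun setT (fun z : RR * 'rV[R]_n.+1 => h (cons_rV z) : \bar R).
  by move=> mh; apply: (measurableT_comp mh); exact: measurable_cons_rV.
set r' := (n.+1%:R^-1)%R in IH.
have n0 : (0 < n.+2%:R :> R)%R by rewrite ltr0n.
have n'0 : (0 < n.+1%:R :> R)%R by rewrite ltr0n.
have r'r : (r' * r * n.+1%:R = r)%R.
  by rewrite mulrAC mulVf ?mul1r// gt_eqF.
have r0 : (0 <= r)%R by rewrite invr_ge0 ltW.
pose H y := \int[mu]_s g ord0 (cons_rV (s, y)).
have mH : measurable_fun setT H.
  by apply: (measurable_fun_fubini_tonelli_G (fun z => g ord0 (cons_rV z))) => //; exact: mpair.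
have H0 y : 0 <= H y by exact: integral_ge0.
have HE : \int[lebesgue_rV n.+1]_y H y = \int[lebesgue_rV n.+2]_x g ord0 x.
  rewrite [RHS]ge0_integral_cons// [RHS]tonelli//.
  exact: (measurableT_comp (mpair _ (mg ord0)) (measurable_fun_pair measurable_fst measurable_snd)).
pose W t := \int[lebesgue_rV n.+1]_y w (cons_rV (t, y)).
pose A j t := \int[lebesgue_rV n.+1]_y g (lift ord0 j) (cons_rV (t, y)).
have mW : measurable_fun setT W.
  by apply: (measurable_fun_fubini_tonelli_F (fun z => w (cons_rV z))) => //; exact: mpair.
have W0 t : 0 <= W t by exact: integral_ge0.
have mA j : measurable_fun setT (A j).
  by apply: (measurable_fun_fubini_tonelli_F (fun z => g (lift ord0 j) (cons_rV z))) => //; exact: mpair.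
have A0 j t : 0 <= A j t by exact: integral_ge0.
have ppos (I : finType) (f : I -> \bar R) s : 0 <= \prod_i f i `^ s.
  by apply: prode_ge0 => i _; exact: poweR_ge0.
have mpow d (T : measurableType d) (h : T -> \bar R) s :
    measurable_fun setT h -> measurable_fun setT (fun x => h x `^ s).
  by move=> mh; exact: (measurableT_comp (measurable_poweR _) mh).
rewrite ge0_integral_cons//; last 2 first.
- apply: emeasurable_funM; first exact: mpow.
  by apply: emeasurable_prod => i; apply: mpow; exact: measurable_line_int.
- by move=> x; rewrite mule_ge0// poweR_ge0.
have inner t : \int[lebesgue_rV n.+1]_y (w (cons_rV (t, y)) `^ r *
      \prod_i line_int i (g i) (cons_rV (t, y)) `^ r) <=
    (\int[lebesgue_rV n.+2]_x g ord0 x) `^ r * (W t `^ r * \prod_j A j t `^ r).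
  pose Q y := H y `^ r' * \prod_j line_int j (fun y => g (lift ord0 j) (cons_rV (t, y))) y `^ r'.
  have mgt j : measurable_fun setT (fun y => g (lift ord0 j) (cons_rV (t, y))).
    exact: (measurableT_comp (mg _) (mcons t)).
  have mQ : measurable_fun setT Q.
    apply: emeasurable_funM; first exact: mpow.
    by apply: emeasurable_prod => i; apply: mpow; exact: measurable_line_int.
  have Q0 y : 0 <= Q y by rewrite mule_ge0 ?poweR_ge0.
  (* Hoelder with [n.+2] equal exponents: [w] is taken once and [Q] the other [n.+1] times. So [Q]
     gets the exponent (n+1)/(n+2), which turns the [r'] of the induction hypothesis into [r] by
     [r'r]. *)
  pose f (i : 'I_n.+2) (y : 'rV[R]_n.+1) :=
    if unlift ord0 i is Some _ then Q y else w (cons_rV (t, y)).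
  have fS j : f (lift ord0 j) = Q by apply/funext => y; rewrite /f liftK.
  have fO : f ord0 = fun y => w (cons_rV (t, y)).
    by apply/funext => y; rewrite /f unlift_none.
  have mf i : measurable_fun setT (f i).
    case: (unliftP ord0 i) => [j ->|->]; rewrite ?fS// fO.
    exact: (measurableT_comp mw (mcons t)).
  have f0 i y : 0 <= f i y.
    by case: (unliftP ord0 i) => [j ->|->]; rewrite ?fS// fO.
  have := @hoelder_prod R _ _ (lebesgue_rV n.+1) n.+1 f mf f0.
  rewrite -/r big_ord_recl fO.
  rewrite [X in _ * X](eq_bigr (fun=> (\int[lebesgue_rV n.+1]_y Q y) `^ r)); last first.
    by move=> j _; rewrite fS.
  have r_gt0 : (0 < r)%R by rewrite invr_gt0.
  rewrite prode_const_poweR//.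
  rewrite (eq_integral (fun y => w (cons_rV (t, y)) `^ r *
      \prod_i line_int i (g i) (cons_rV (t, y)) `^ r)); last first.
    move=> y _; rewrite big_ord_recl fO; congr (_ * _).
    rewrite (eq_bigr (fun=> Q y `^ r)); last by move=> j _; rewrite fS.
    rewrite prode_const_poweR// /Q poweRM// ?poweR_ge0// -poweRrM.
    rewrite (_ : (r' * (r * n.+1%:R) = r)%R); last by rewrite mulrA.
    rewrite [RHS]big_ord_recl line_int_cons0// -/(H y); congr (_ * _).
    rewrite poweR_prod; last by move=> j; exact: poweR_ge0.
    apply: eq_bigr => j _.
    by rewrite line_int_consS -poweRrM mulrA r'r.
  move=> /le_trans; apply.
  rewrite muleCA; apply: lee_wpmul2l; first exact: poweR_ge0.
  have rn0 : (0 <= r * n.+1%:R)%R by rewrite mulr_ge0// ltW.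
  apply: (@le_trans _ _ (((\int[lebesgue_rV n.+1]_y H y) `^ r' *
     \prod_j (A j t `^ r')) `^ (r * n.+1%:R))).
    apply: gt0_ler_poweR => //.
    - by rewrite in_itv/= leey integral_ge0.
    - by rewrite in_itv/= leey mule_ge0 ?poweR_ge0.
    - exact: IH.
  rewrite poweRM ?poweR_ge0// -poweRrM HE mulrA r'r.
  rewrite poweR_prod; last by move=> j; exact: poweR_ge0.
  rewrite (eq_bigr (fun j => A j t `^ r))// => j _.
  by rewrite -poweRrM mulrA r'r.
apply: (@le_trans _ _ (\int[mu]_t
    ((\int[lebesgue_rV n.+2]_x g ord0 x) `^ r * (W t `^ r * \prod_j A j t `^ r)))).
  apply: ge0_le_integral => //.
  - by move=> t _; apply: integral_ge0 => y _; rewrite mule_ge0 ?poweR_ge0.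
  - apply: (measurable_fun_fubini_tonelli_F (fun z => w (cons_rV z) `^ r *
      \prod_i line_int i (g i) (cons_rV z) `^ r)) => //.
      apply: emeasurable_funM; first by apply: mpow; exact: mpair.
      by apply: emeasurable_prod => i; apply: mpow; apply: mpair; exact: measurable_line_int.
    by move=> z; rewrite mule_ge0 ?poweR_ge0.
  - apply: measurable_funeM; apply: emeasurable_funM; first exact: mpow.
    by apply: emeasurable_prod => i; exact: mpow.
rewrite ge0_integralZl//; last 3 first.
- apply: emeasurable_funM; first exact: mpow.
  by apply: emeasurable_prod => i; exact: mpow.
- by move=> t _; rewrite mule_ge0 ?poweR_ge0.
- exact: poweR_ge0.
rewrite [in leRHS]big_ord_recl muleCA.
apply: lee_wpmul2l; first exact: poweR_ge0.
(* Hoelder again, now in the first coordinate: the factors are already integrals over the other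
   coordinates, so that the full integrals are reassembled. *)
pose f (i : 'I_n.+2) (t : RR) :=
    if unlift ord0 i is Some j then A j t else W t.
have fS j : f (lift ord0 j) = A j by apply/funext => y; rewrite /f liftK.
have fO : f ord0 = W by apply/funext => y; rewrite /f unlift_none.
have mf i : measurable_fun setT (f i).
  by case: (unliftP ord0 i) => [j ->|->]; rewrite ?fS// fO.
have f0 i y : 0 <= f i y.
  by case: (unliftP ord0 i) => [j ->|->]; rewrite ?fS// fO.
have := @hoelder_prod R _ _ mu n.+1 f mf f0.
rewrite -/r [X in _ <= X -> _]big_ord_recl fO.
rewrite (eq_integral (fun t => W t `^ r * \prod_j A j t `^ r)); last first.
  move=> t _; rewrite big_ord_recl fO; congr (_ * _).
  by apply: eq_bigr => j _; rewrite fS.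
move=> /le_trans; apply.
rewrite /W -ge0_integral_cons//; apply: lee_wpmul2l; first exact: poweR_ge0.
rewrite (eq_bigr (fun j => (\int[lebesgue_rV n.+2]_x g (lift ord0 j) x) `^ r))//.
by move=> j _; rewrite fS /A -ge0_integral_cons.
Qed.

End loomis_whitney.

(** * Smooth product kernels *)
Section smooth_real.
Context {R : realType}.
Implicit Types (f g : R -> R) (k n : nat) (x : R).

(** The derivative is an existential witness, so that closure under sums, products and affine
    substitutions reduces to the rules for [is_derive]. *)
Fixpoint times_derivable k f : Prop :=
  if k is k'.+1
  then exists2 g, (forall x, is_derive x 1 f (g x)) & times_derivable k' g
  else True.

Definition smooth_R f := forall k, times_derivable k f.

Lemma times_derivableW k f : times_derivable k.+1 f -> times_derivable k f.
Proof.
elim: k f => // k IH f [g fg gk]; exists g => //; exact: IH.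
Qed.

Lemma times_derivable_cst k (c : R) : times_derivable k (cst c).
Proof.
elim: k c => // k IH c; by exists (cst 0) => // x; exact: is_derive_cst.
Qed.

Lemma times_derivableD k f g : times_derivable k f -> times_derivable k g ->
  times_derivable k (f \+ g).
Proof.
elim: k f g => // k IH f g [f' ff' f'k] [g' gg' g'k].
by exists (f' \+ g'); [move=> x; exact: is_deriveD|exact: IH].
Qed.

Lemma times_derivableM k f g : times_derivable k f -> times_derivable k g ->
  times_derivable k (f \* g).
Proof.
elim: k f g => // k IH f g fk gk.
have [f' ff' f'k] := fk; have [g' gg' g'k] := gk.
exists ((f \* g') \+ (g \* f')).
  by move=> x; apply: is_deriveM.
by apply: times_derivableD; apply: IH => //; exact: times_derivableW.
Qed.

Lemma times_derivable_aff k f (a b : R) : times_derivable k f ->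
  times_derivable k (fun x => f (a * x + b)).
Proof.
elim: k f => // k IH f [g fg gk].
exists (fun x => a * g (a * x + b)); last first.
  exact: (times_derivableM (times_derivable_cst k a) (IH _ gk)).
move=> x.
have h : is_derive x 1 (fun x => a * x + b) (a : R).
  by apply: is_derive_eq; rewrite addr0 [_%:A]mulr1.
by rewrite mulrC; exact: (@is_derive1_comp _ f (fun x => a * x + b) _ _ _ (fg _) h).
Qed.

Lemma smooth_RM f g : smooth_R f -> smooth_R g -> smooth_R (f \* g).
Proof. by move=> fs gs k; exact: times_derivableM. Qed.

Lemma smooth_R_cst (c : R) : smooth_R (cst c).
Proof. by move=> k; exact: times_derivable_cst. Qed.

Lemma smooth_R_aff f (a b : R) : smooth_R f -> smooth_R (fun x => f (a * x + b)).
Proof. by move=> fs k; exact: times_derivable_aff. Qed.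

Lemma smooth_R_derivable f x : smooth_R f -> derivable f x 1.
Proof. by move=> /(_ 1%N) [g fg _]; exact: ex_derive. Qed.

Lemma smooth_R_derive1 f : smooth_R f -> smooth_R f^`()%classic.
Proof.
move=> fs k; have [g fg gk] := fs k.+1.
suff -> : f^`()%classic = g by [].
by apply/funext => x; rewrite derive1E derive_val.
Qed.

Lemma smooth_R_continuous f : smooth_R f -> continuous f.
Proof.
by move=> fs x; apply/differentiable_continuous/derivable1_diffP/smooth_R_derivable.
Qed.

(** The flat function exp(-1/x), with negative powers of x attached so that the span of the family
    is closed under differentiation. *)
Definition flat_exp n x := if 0 < x then x^-1 ^+ n.+1 * expR (- x^-1) else 0.

Lemma is_derive0_sq f (C : R) : f 0 = 0 -> (forall x, `|f x| <= C * x ^+ 2) ->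
  is_derive (0 : R) (1 : R) f 0.
Proof.
move=> f0 fC.
have C0 : 0 <= C by have := fC 1; rewrite expr1n mulr1; exact: le_trans.
have H : h^-1 *: ((f \o shift 0) (h *: 1) - f 0) @[h --> 0^'] --> (0 : R).
  apply/cvgrPdist_lt => e e0; near=> h.
  have h0 : h != 0 by near: h; exact: nbhs_dnbhs_neq.
  rewrite sub0r normrN f0 subr0 /= addr0 [h%:A]mulr1 normrZ normfV.
  have hp : 0 < `|h| by rewrite normr_gt0.
  rewrite mulrC ltr_pdivrMr//.
  rewrite (le_lt_trans (fC h))// -real_normK ?num_real// expr2 mulrA ltr_pM2r//.
  rewrite (@le_lt_trans _ _ ((C + 1) * `|h|)) ?ler_wpM2r ?lerDl// mulrC.
  rewrite -ltr_pdivlMr ?ltr_wpDl//.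
  near: h; apply: dnbhs0_lt; rewrite divr_gt0// ltr_wpDl//.
apply: DeriveDef; first by apply/cvg_ex; exists 0.
exact: (cvg_lim _ H).
Unshelve. all: by end_near. Qed.

(** With y = 1/x, the exponential exp(y) dominates the term y^(n+3)/(n+3)! of its series. Two of
    these powers are left over, and the resulting quadratic bound gives the derivative 0 at the
    origin. *)
Lemma flat_exp_le n x : `|flat_exp n x| <= n.+3`!%:R * x ^+ 2.
Proof.
rewrite /flat_exp; case: ifPn => x0; last by rewrite normr0 mulr_ge0 ?sqr_ge0.
have y0 : 0 < x^-1 by rewrite invr_gt0.
rewrite ger0_norm ?mulr_ge0 ?exprn_ge0 ?expR_ge0 ?(ltW y0)//.
rewrite expRN ler_pdivrMr ?expR_gt0//.
have := expR_ge1Dxn n.+2 (ltW y0); set E := expR _ => h.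
have n0 : 0 < n.+3`!%:R :> R by rewrite ltr0n fact_gt0.
have {}h : x^-1 ^+ n.+3 / n.+3`!%:R <= E by apply: le_trans h; rewrite lerDr.
rewrite ler_pdivrMr// in h.
rewrite mulrAC [X in X * _]mulrC (le_trans _ (ler_wpM2r (sqr_ge0 x) h))//.
by rewrite -[in leRHS]addn2 exprD -mulrA -exprMn mulVf ?gt_eqF// expr1n mulr1.
Qed.

Lemma is_derive_flat_exp n x : is_derive x 1 (flat_exp n)
  (flat_exp n.+2 x - n.+1%:R * flat_exp n.+1 x).
Proof.
case: (ltrgt0P x) => x0.
- have : is_derive x 1 (fun x => x^-1 ^+ n.+1 * expR (- x^-1))
      (flat_exp n.+2 x - n.+1%:R * flat_exp n.+1 x).
    have xn0 : x != 0 by rewrite gt_eqF.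
    have iV : is_derive x 1 (fun x => x^-1) (- x^-1 ^+ 2).
      have := @is_deriveV _ id x 1 1 xn0 (is_derive_id _ _).
      by rewrite /= [_%:A]mulr1 exprVn.
    have iX := @is_deriveX _ _ (fun x => x^-1) n.+1 x 1 _ iV.
    have iE := @is_derive1_comp R expR (fun x => - x^-1) x _ _ (is_derive_expR _) (is_deriveN iV).
    have := is_deriveM iX iE.
    rewrite /flat_exp x0.
    set d := (X in is_derive _ _ _ X -> _); set d' := (X in _ -> is_derive _ _ _ X).
    suff -> : d = d'.
      rewrite (_ : _ * _ = (fun x => x^-1 ^+ n.+1 * expR (- x^-1)))//.
      by apply/funext => y; rewrite !fctE.
    rewrite /d /d' /= !fctE /GRing.scale /= opprK !exprS; ring.
  apply: near_eq_is_derive.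
  near=> y; rewrite /flat_exp ifT//; near: y; exact: lt_nbhsr.
- have := @is_derive_cst R R R 0 x 1.
  rewrite {2}/flat_exp {2}/flat_exp lt_gtF// mulr0 subr0.
  apply: near_eq_is_derive.
  near=> y; rewrite /flat_exp ifN// -leNgt ltW//; near: y; exact: lt_nbhsl.
- rewrite x0 {2}/flat_exp {2}/flat_exp ltxx mulr0 subr0.
  apply: is_derive0_sq; last exact: flat_exp_le.
  by rewrite /flat_exp ltxx.
Unshelve. all: by end_near. Qed.

Lemma smooth_flat_exp n : smooth_R (flat_exp n).
Proof.
move=> k; elim: k n => // k IH n.
exists (flat_exp n.+2 \+ (cst (- n.+1%:R) \* flat_exp n.+1)); last first.
  apply: times_derivableD => //; apply: times_derivableM => //.
  exact: times_derivable_cst.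
by move=> x; have := is_derive_flat_exp n x; rewrite /= mulNr.
Qed.

Lemma flat_exp_ge0 n x : 0 <= flat_exp n x.
Proof.
rewrite /flat_exp; case: ifPn => // x0.
by rewrite mulr_ge0 ?expR_ge0// exprn_ge0// invr_ge0 ltW.
Qed.

Lemma flat_exp_gt0 n x : 0 < x -> 0 < flat_exp n x.
Proof.
by move=> x0; rewrite /flat_exp x0 mulr_gt0 ?expR_gt0// exprn_gt0// invr_gt0.
Qed.

Local Notation mu := (@lebesgue_measure R).

Lemma mollifier_exists (e : R) : 0 < e -> exists eta : R -> R,
  [/\ smooth_R eta, forall x, 0 <= eta x, forall x, eta x != 0 -> - e < x < 0 &
      (\int[mu]_x (eta x)%:E = 1)%E].
Proof.
move=> e0.
(* Positive exactly on ]-e, 0[: the first factor vanishes for x <= -e, the second for x >= 0. *)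
pose b := (fun x => flat_exp 0 (1 * x + e)) \* (fun x => flat_exp 0 (-1 * x + 0)).
have sb : smooth_R b.
  by apply: smooth_RM; apply: smooth_R_aff; exact: smooth_flat_exp.
have b0 x : 0 <= b x by rewrite mulr_ge0// flat_exp_ge0.
have bs x : b x != 0 -> - e < x < 0.
  rewrite /b mulf_eq0 negb_or /flat_exp mul1r mulN1r addr0 oppr_gt0 -ltrBlDr sub0r.
  by case: ifPn => [ex|_]; case: ifPn => [x0|_]; rewrite ?eqxx ?andbF// => _; rewrite ex x0.
have cb := smooth_R_continuous sb.
have mb : measurable_fun setT (b : measurableTypeR R -> R).
  exact: continuous_measurable_fun.
pose J := (\int[mu]_x (b x)%:E)%E.
have J0 : (0 <= J)%E by apply: integral_ge0 => x _; rewrite lee_fin.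
(* The 6 is the factorial 3! of [flat_exp_le] at n = 0; on the support both arguments [x + e] and
   [- x] lie in [0, e]. *)
have bM x : b x <= (6 * e ^+ 2) ^+ 2.
  have [->|/bs/andP[ex x0]] := eqVneq (b x) 0; first by rewrite sqr_ge0.
  rewrite /b /= mul1r mulN1r addr0 [leRHS]expr2.
  have h y : 0 <= y <= e -> 0 <= flat_exp 0 y <= 6 * e ^+ 2.
    move=> /andP[y0 ye]; rewrite flat_exp_ge0/= (le_trans (ler_norm _))//.
    rewrite (le_trans (flat_exp_le _ _))//= ler_wpM2l// ?ler0n//.
    by rewrite ler_pXn2r// nnegrE ltW.
  have /andP[h1 h2] := h (x + e) ltac:(lra).
  have /andP[h3 h4] := h (- x) ltac:(lra).
  exact: ler_pM.
have Jy : (J < +oo)%E.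
  have : (J <= \int[mu]_(x in `[(- e)%R, 0%R]) (((6 * e ^+ 2) ^+ 2)%:E))%E.
    rewrite [leRHS]integral_mkcond; apply: ge0_le_integral => //.
    - by move=> x _; rewrite lee_fin.
    - exact/measurable_EFinP.
    - by apply/(measurable_restrictT _ _).1.
    move=> x _; rewrite patchE; case: ifPn => [_|]; first by rewrite lee_fin.
    rewrite notin_setE/= in_itv/= => nx; rewrite lee_fin.
    have [->//|/bs] := eqVneq (b x) 0.
    by move=> /andP[/ltW ex /ltW x0]; exfalso; apply: nx; rewrite ex x0.
  move=> /le_lt_trans; apply.
  rewrite integral_cst//= lebesgue_measure_itv/= lte_fin oppr_lt0 e0.
  by rewrite -EFinD -EFinM ltey.
have Jn0 : J != 0%E.
  apply/eqP => J00.
  have : ae_eq mu setT (EFin \o b) (cst 0%E).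
    apply/ae_eq_integral_abs => //; first exact/measurable_EFinP.
    by rewrite -[RHS]J00; apply: eq_integral => x _; rewrite /= ger0_norm.
  move=> [A [mA A0 sA]].
  have : (mu `](- e)%R, 0%R[%classic <= mu A)%E.
    apply: le_measure; rewrite ?inE//.
    move=> x /=; rewrite in_itv/= => /andP[ex x0]; apply: sA => /= /(_ I) /=.
    move=> [] /eqP; rewrite /b /= mul1r mulN1r addr0 mulf_eq0 !gt_eqF//.
    - by apply: flat_exp_gt0; lra.
    - by apply: flat_exp_gt0; lra.
  by rewrite A0 lebesgue_measure_itv/= lte_fin oppr_lt0 e0 -EFinD lee_fin; lra.
have JE : J = (fine J)%:E by rewrite fineK// ge0_fin_numE.
have fJ0 : 0 < fine J by rewrite -lte_fin -JE lt0e Jn0 J0.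
exists (cst (fine J)^-1 \* b); split.
- by apply: smooth_RM => //; exact: smooth_R_cst.
- by move=> x; rewrite mulr_ge0// invr_ge0 ltW.
- by move=> x; rewrite mulf_eq0 negb_or => /andP[_]; exact: bs.
- under eq_integral do rewrite EFinM.
  rewrite ge0_integralZl_EFin//.
  + by rewrite -/J JE -EFinM mulVf// gt_eqF.
  + by move=> x _; rewrite lee_fin.
  + exact/measurable_EFinP.
  + by rewrite invr_ge0 ltW.
Qed.

End smooth_real.

Section tensor.
Context {R : realType} {N : nat}.
Implicit Types (h : 'I_N -> R -> R) (i : 'I_N) (x : 'rV[R]_N).

(** Kernels are products over the coordinates, so that smoothness, partial derivatives, supports and
    integrals all reduce to one variable. *)
Definition tensor h x : R := \prod_i h i (x ord0 i).

Definition derive_at i h : 'I_N -> R -> R :=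
  fun j => if j == i then (h j)^`()%classic else h j.

Lemma differentiable_prod (V : normedModType R) (I : Type) (s : seq I)
    (f : I -> V -> R) (v : V) : (forall k, differentiable (f k) v) ->
  differentiable (fun w => \prod_(k <- s) f k w) v.
Proof.
move=> df; elim: s => [|k s IH].
  by under eq_fun do rewrite big_nil; exact: differentiable_cst.
by under eq_fun do rewrite big_cons; exact: differentiableM.
Qed.

Lemma differentiable_tensor h x : (forall i y, derivable (h i) y 1) ->
  differentiable (tensor h) x.
Proof.
move=> dh; apply: differentiable_prod => i.
apply: (@differentiable_comp _ _ _ _ (fun x : 'rV[R]_N => x ord0 i) (h i)).
  exact: differentiable_coord.
exact/derivable1_diffP.
Qed.

Lemma tensor_line h i x s : tensor h (x + s *: basis_vec i) =
  h i (x ord0 i + s) * \prod_(j | j != i) h j (x ord0 j).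
Proof.
rewrite /tensor (bigD1 i)//= !mxE !eqxx/= mulr1; congr (_ * _).
by apply: eq_bigr => j ji; rewrite !mxE (negbTE ji) andbF mulr0 addr0.
Qed.

Lemma is_derive_tensor_line h i x s : derivable (h i) (x ord0 i + s) 1 ->
  is_derive s 1 (fun s => tensor h (x + s *: basis_vec i))
    (tensor (derive_at i h) (x + s *: basis_vec i)).
Proof.
move=> dh; under eq_fun do rewrite tensor_line.
rewrite tensor_line /derive_at eqxx.
rewrite [\prod_(j | _) (if _ then _ else _) _](eq_bigr (fun j => h j (x ord0 j))); last first.
  by move=> j ji; rewrite (negbTE ji).
set c := \prod_(_ | _) _.
have is1 : is_derive s 1 (fun s => x ord0 i + s) (1 : R).
  have := @is_deriveD R R R (cst (x ord0 i)) id s 1 _ _ (is_derive_cst _ _ _) (is_derive_id _ _).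
  by rewrite add0r.
have := @is_derive1_comp R (h i) (fun s => x ord0 i + s) s _ _ (derivableP dh) is1.
rewrite mulr1 -derive1E => dc.
rewrite [_ * c]mulrC.
have := is_deriveZ c dc.
rewrite (_ : c \*: _ = (fun s0 => h i (x ord0 i + s0) * c))//.
by apply/funext => t; rewrite /= mulrC.
Qed.

Lemma derive_tensor h i : (forall i y, derivable (h i) y 1) ->
  'D_(basis_vec i) (tensor h) = tensor (derive_at i h).
Proof.
move=> dh; apply/funext => x.
have := @is_derive_tensor_line h i x 0 (dh _ _).
rewrite scale0r addr0 => d; rewrite -[RHS](@derive_val _ _ _ _ _ _ _ d).
rewrite /derive; set F := (X in lim (X @ _)); set G := (X in _ = lim (X @ _)).
suff -> : F = G by [].
apply/funext => t; rewrite /F /G /= scale0r !addr0.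
by rewrite [t%:A]mulr1 [x + _]addrC.
Qed.

Lemma smooth_tensor h : (forall i, smooth_R (h i)) -> smooth (tensor h).
Proof.
move=> sh s.
(* A partial derivative of a tensor is again a tensor, so the induction runs over factors and needs
   no calculus in several variables. *)
suff [k [-> sk]] : exists k, foldr (fun i f => 'D_(basis_vec i) f) (tensor h) s
    = tensor k /\ forall i, smooth_R (k i).
  by move=> x; apply: differentiable_tensor => i y; exact: smooth_R_derivable.
elim: s => [|i s [k [IH sk]]]; first by exists h.
exists (derive_at i k); split.
  by rewrite /= IH derive_tensor// => j y; exact: smooth_R_derivable.
by move=> j; rewrite /derive_at; case: eqP => // _; exact: smooth_R_derive1.
Qed.

Lemma test_function_tensor h (a b : 'I_N -> R) : (forall i, smooth_R (h i)) ->
  (forall i y, h i y != 0 -> a i <= y <= b i) -> test_function (tensor h).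
Proof.
move=> sh hab; split; first exact: smooth_tensor.
pose K := [set x : 'rV[R]_N | forall i, (`[a i, b i]%classic : set R) (x ord0 i)].
have cK : compact K.
  by apply: (@rV_compact R N (fun i => `[a i, b i]%classic)) => i; exact: segment_compact.
apply: (subclosed_compact _ cK); first exact: closed_closure.
have clK : closed K by apply: compact_closed => //; exact: norm_hausdorff.
rewrite [X in _ `<=` X](closure_id _).1//; apply: closure_subset => x /= hx i.
rewrite /= in_itv/=; apply: hab; apply: contra_neq hx => hi.
by rewrite /tensor (bigD1 i)//= hi mul0r.
Qed.

End tensor.

(** * Mollification in L^2 *)
Section square_integrable.
Context d (T : measurableType d) {R : realType}
  (mu : {measure set T -> \bar R}).
Implicit Types u v : T -> R.

Definition L2 u := measurable_fun setT u /\
  (\int[mu]_x (u x ^+ 2)%:E < +oo)%E.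

Lemma integral_powR2 u : (\int[mu]_x (`|u x| `^ 2)%:E)%E = (\int[mu]_x (u x ^+ 2)%:E)%E.
Proof.
by apply: eq_integral => x _; rewrite powR_mulrn// real_normK// num_real.
Qed.

Lemma Lfun_L2 u : u \in Lfun mu 2%:E <-> L2 u.
Proof.
split=> [uL|[mu_ uy]].
  split; first by move: uL; rewrite inE => /andP[/[!inE]].
  have /Lfun2_integrable_sqr/integrableP[_] := uL.
  by under eq_integral do rewrite /= ger0_norm ?sqr_ge0//.
rewrite inE; apply/andP; split; rewrite inE//= /finite_norm unlock.
apply: poweR_lty; rewrite (eq_integral (fun x => (`|u x| `^ 2)%:E)).
  by rewrite integral_powR2.
by [].
Qed.

Lemma L2_measurable u : L2 u -> measurable_fun setT u.
Proof. by case. Qed.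

Lemma L2_integrableM u v : L2 u -> L2 v ->
  mu.-integrable setT (fun x => (u x * v x)%:E).
Proof. by move=> /Lfun_L2 uL /Lfun_L2 vL; apply/Lfun1_integrable/Lfun2_mul_Lfun1. Qed.

Lemma L2_integrable_sqr u : L2 u -> mu.-integrable setT (fun x => (u x ^+ 2)%:E).
Proof. by move=> /Lfun_L2 /Lfun2_integrable_sqr. Qed.

Lemma L2_le u v : measurable_fun setT u -> L2 v -> (forall x, `|u x| <= `|v x|) -> L2 u.
Proof.
move=> mu_ [mv vy] uv; split => //; apply: le_lt_trans vy.
apply: ge0_le_integral => //.
- by move=> x _; rewrite lee_fin sqr_ge0.
- by apply/measurable_EFinP/measurable_funX.
- by apply/measurable_EFinP/measurable_funX.
- move=> x _; rewrite lee_fin -(real_normK (num_real (u x))) -(real_normK (num_real (v x))).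
  by rewrite ler_pXn2r// nnegrE.
Qed.

Lemma L2Z (a : R) u : L2 u -> L2 (fun x => a * u x).
Proof.
move=> [mu_ uy]; split; first exact: measurable_funM.
under eq_integral do rewrite exprMn EFinM.
rewrite ge0_integralZl_EFin ?sqr_ge0//.
- by rewrite lte_mul_pinfty// ?lee_fin ?sqr_ge0.
- by move=> x _; rewrite lee_fin sqr_ge0.
- by apply/measurable_EFinP/measurable_funX.
Qed.

Lemma sqrD_le (a b : R) : (a + b) ^+ 2 <= 2 * a ^+ 2 + 2 * b ^+ 2.
Proof. have := sqr_ge0 (a - b); nra. Qed.

Lemma integral_sqrD_le u v : measurable_fun setT u -> measurable_fun setT v ->
  (\int[mu]_x ((u x + v x) ^+ 2)%:E <=
   2%:E * \int[mu]_x (u x ^+ 2)%:E + 2%:E * \int[mu]_x (v x ^+ 2)%:E)%E.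
Proof.
move=> mu_ mv.
have m2 (w : T -> R) : measurable_fun setT w -> measurable_fun setT (fun x => (w x ^+ 2)%:E).
  by move=> mw; apply/measurable_EFinP/measurable_funX.
have p2 (w : T -> R) x : (0 <= (w x ^+ 2)%:E)%E by rewrite lee_fin sqr_ge0.
rewrite -ge0_integralZl_EFin//; last exact: m2.
rewrite -ge0_integralZl_EFin//; last exact: m2.
rewrite -ge0_integralD//; last 4 first.
- by move=> x _; rewrite mule_ge0.
- exact/measurable_funeM/m2.
- by move=> x _; rewrite mule_ge0.
- exact/measurable_funeM/m2.
apply: ge0_le_integral => //.
- by move=> x _; rewrite lee_fin sqr_ge0.
- exact/m2/measurable_funD.
- by apply: emeasurable_funD; exact/measurable_funeM/m2.
- by move=> x _; rewrite -!EFinM -EFinD lee_fin sqrD_le.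
Qed.

Lemma L2D u v : L2 u -> L2 v -> L2 (fun x => u x + v x).
Proof.
move=> [mu_ uy] [mv vy]; split; first exact: measurable_funD.
apply: le_lt_trans (integral_sqrD_le mu_ mv) _.
by rewrite lte_add_pinfty// lte_mul_pinfty// lee_fin.
Qed.

Lemma L2_sum (I : Type) (s : seq I) (f : I -> T -> R) : (forall i, L2 (f i)) ->
  L2 (fun x => \sum_(i <- s) f i x).
Proof.
move=> fL; elim: s => [|i s IH].
  under eq_fun do rewrite big_nil; split => //.
  by rewrite expr0n/= integral0.
by under eq_fun do rewrite big_cons; exact: L2D.
Qed.

(** Equivalently b^q >= a^q + q a^(q-1) (b - a), the tangent-line inequality for t^q. This one form
    serves Jensen's inequality, the convexity of |.|^q and the estimate of the potential. *)
Lemma young_powR (a b q : R) : 0 <= a -> 0 <= b -> 1 < q ->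
  q * (a `^ (q - 1) * b) <= (q - 1) * a `^ q + b `^ q.
Proof.
move=> a0 b0 q1.
have q0 : 0 < q by lra.
have q10 : 0 < q - 1 by lra.
have := @conjugate_powR _ (a `^ (q - 1)) b (q / (q - 1)) q (powR_ge0 _ _) b0.
rewrite divr_gt0// => /(_ isT q0).
have -> : (q / (q - 1))^-1 + q^-1 = 1 by field; lra.
move=> /(_ erefl); rewrite -powRrM (_ : (q - 1) * (q / (q - 1)) = q); last by field; lra.
move=> h; have := ler_wpM2l (ltW q0) h.
by rewrite (_ : q * (_ + _) = (q - 1) * a `^ q + b `^ q)//; field; lra.
Qed.

End square_integrable.

Section averages.
Context d (T : measurableType d) {R : realType}
  (mu : {measure set T -> \bar R}).

(* No integrability is assumed: when [rho * v] is not integrable, the real-valued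
   integral is 0. *)
Lemma jensen_powR (rho v : T -> R) (q : R) : 1 < q ->
  measurable_fun setT rho -> measurable_fun setT v -> (forall x, 0 <= rho x) ->
  (\int[mu]_x (rho x)%:E = 1)%E ->
  ((`|\int[mu]_x (rho x * v x)| `^ q)%:E <=
   \int[mu]_x (rho x * `|v x| `^ q)%:E)%E.
Proof.
move=> q1 mrho mv rho0 rho1; set a := `|_|.
have a0 : 0 <= a by exact: normr_ge0.
have q0 : 0 < q by lra.
have q10 : 0 < q - 1 by lra.
have mv' : measurable_fun setT (fun x => `|v x|) by exact: measurableT_comp.
have mvq : measurable_fun setT (fun x => `|v x| `^ q).
  exact: (measurableT_comp (measurable_powR q)).
set J := (X in (_ <= X)%E).
have J0 : (0 <= J)%E.
  by apply: integral_ge0 => x _; rewrite lee_fin mulr_ge0// powR_ge0.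
have [Jy|Jy] := eqVneq J +oo%E; first by rewrite Jy leey.
have JE : J = (fine J)%:E by rewrite fineK// ge0_fin_numE// ltey.
have aI : (a%:E <= \int[mu]_x (rho x * `|v x|)%:E)%E.
  apply: (@le_trans _ _ `|\int[mu]_x (rho x * v x)%:E|%E).
    rewrite /a /Rintegral; case: (integral _ _ _) => [t||] /=.
    - by [].
    - by rewrite normr0 leey.
    - by rewrite normr0 leey.
  apply: le_trans (le_abse_integral mu measurableT _) _.
    exact/measurable_EFinP/measurable_funM.
  apply: ge0_le_integral => //.
  - by apply: measurableT_comp => //; exact/measurable_EFinP/measurable_funM.
  - exact/measurable_EFinP/measurable_funM.
  - by move=> x _; rewrite /= normrM ger0_norm.
(* The tangent-line inequality at the mean [a], integrated against the probability density [rho]. *)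
have : ((q * a `^ (q - 1))%:E * \int[mu]_x (rho x * `|v x|)%:E <=
    ((q - 1) * a `^ q)%:E * \int[mu]_x (rho x)%:E + J)%E.
  have c1 : 0 <= q * a `^ (q - 1) by rewrite mulr_ge0 ?powR_ge0 ?ltW.
  have c2 : 0 <= (q - 1) * a `^ q by rewrite mulr_ge0 ?powR_ge0 ?ltW.
  have m1 : measurable_fun setT (fun x => (rho x * `|v x|)%:E).
    exact/measurable_EFinP/measurable_funM.
  have m2 : measurable_fun setT (fun x => (rho x * `|v x| `^ q)%:E).
    exact/measurable_EFinP/measurable_funM.
  have m3 : measurable_fun setT (EFin \o rho) by exact/measurable_EFinP.
  rewrite -ge0_integralZl_EFin//; last by move=> x _; rewrite lee_fin mulr_ge0.
  rewrite -ge0_integralZl_EFin//; last by move=> x _; rewrite lee_fin.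
  rewrite -ge0_integralD//; last 3 first.
  - by move=> x _; rewrite mule_ge0// lee_fin.
  - exact: measurable_funeM.
  - by move=> x _; rewrite lee_fin mulr_ge0// powR_ge0.
  apply: ge0_le_integral => //.
  - by move=> x _; rewrite -EFinM lee_fin mulr_ge0// mulr_ge0.
  - exact: measurable_funeM.
  - by apply: emeasurable_funD => //; exact: measurable_funeM.
  move=> x _; rewrite -!EFinM -EFinD lee_fin.
  have := ler_wpM2l (rho0 x) (young_powR a0 (normr_ge0 (v x)) q1).
  by congr (_ <= _); ring.
rewrite rho1 mule1 => h.
have {}h : ((q * a `^ (q - 1))%:E * a%:E <= ((q - 1) * a `^ q)%:E + J)%E.
  apply: le_trans h; apply: lee_wpmul2l => //.
  by rewrite lee_fin mulr_ge0 ?powR_ge0 ?ltW.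
move: h; rewrite JE -EFinM -EFinD !lee_fin -mulrA [_ * a]mulrC mulr_powRB1//.
by rewrite mulrBl mul1r; lra.
Qed.

Lemma measurable_Rintegral d' (T' : measurableType d')
    (mu' : {sigma_finite_measure set T -> \bar R}) (f : T' * T -> R) :
  measurable_fun setT f ->
  measurable_fun setT (fun x => \int[mu']_y f (x, y)).
Proof.
move=> mf; apply: measurableT_comp => //.
under eq_fun do rewrite integralE.
apply: emeasurable_funB.
- under eq_fun do under eq_integral do rewrite funeposE.
  apply: (measurable_fun_fubini_tonelli_F (fun z => maxe (f z)%:E 0%E)).
    by apply: measurable_maxe => //; exact/measurable_EFinP.
  by move=> z; rewrite le_max lexx orbT.
- under eq_fun do under eq_integral do rewrite funenegE.
  apply: (measurable_fun_fubini_tonelli_F (fun z => maxe (- (f z)%:E)%E 0%E)).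
    by apply: measurable_maxe => //; apply: measurableT_comp => //; exact/measurable_EFinP.
  by move=> z; rewrite le_max lexx orbT.
Qed.

End averages.

Section tensor_integral.
Context {R : realType}.
Local Notation mu := (@lebesgue_measure R).

Lemma measurable_tensor N (h : 'I_N -> R -> R) :
  (forall i, measurable_fun setT (h i : measurableTypeR R -> R)) ->
  measurable_fun setT (tensor h).
Proof.
move=> mh; apply: measurable_prod => i _.
exact: (measurableT_comp (mh i) (measurable_coord i)).
Qed.

Lemma integral_tensor N (h : 'I_N -> R -> R) :
  (forall i, measurable_fun setT (h i : measurableTypeR R -> R)) ->
  (forall i x, 0 <= h i x) ->
  (\int[lebesgue_rV N]_x (tensor h x)%:E = \prod_i \int[mu]_t (h i t)%:E)%E.
Proof.
elim: N h => [|N IH] h mh h0.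
  rewrite /= integral_dirac// ?diracT ?mul1e ?big_ord0 /tensor ?big_ord0//.
  by apply/measurable_EFinP; exact: measurable_tensor.
rewrite ge0_integral_cons; last 2 first.
- by apply/measurable_EFinP; exact: measurable_tensor.
- by move=> x; rewrite lee_fin prodr_ge0.
rewrite big_ord_recl -IH//.
have m0 : (0 <= \int[lebesgue_rV N]_x (tensor (fun i => h (lift ord0 i)) x)%:E)%E.
  by apply: integral_ge0 => x _; rewrite lee_fin prodr_ge0.
rewrite -ge0_integralZr//; last 2 first.
- exact/measurable_EFinP.
- by move=> t _; rewrite lee_fin.
apply: eq_integral => t _.
rewrite -ge0_integralZl//; last 3 first.
- by apply/measurable_EFinP; exact: measurable_tensor.
- by move=> t' _; rewrite lee_fin prodr_ge0.
- by rewrite lee_fin.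
apply: eq_integral => y _.
rewrite /tensor big_ord_recl cons_rV0 -EFinM; congr (_ * _)%:E.
by apply: eq_bigr => i _; rewrite cons_rVS.
Qed.

End tensor_integral.

Section mollification.
Context {R : realType} {N : nat}.
Local Notation leb := (@lebesgue_rV R N).
Local Notation mu := (@lebesgue_measure R).
Implicit Types (u v w : 'rV[R]_N -> R) (x y z : 'rV[R]_N) (n : nat) (i : 'I_N).

(* The kernel is one-sided, so that averaging over [x + z] with [z] small does
   not cross the boundary of a box [prod ]a_i, b_i]]. *)
Definition eta n : R -> R :=
  sval (cid (@mollifier_exists R n.+1%:R^-1 ltac:(by rewrite invr_gt0 ltr0n))).

Lemma smooth_eta n : smooth_R (eta n).
Proof. by rewrite /eta; case: cid => f /= []. Qed.

Lemma eta_ge0 n t : 0 <= eta n t.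
Proof. by rewrite /eta; case: cid => f /= []. Qed.

Lemma eta_supp n t : eta n t != 0 -> - n.+1%:R^-1 < t < 0.
Proof. by rewrite /eta; case: cid => f /= [_ _ h _]; exact: h. Qed.

Lemma integral_eta n : (\int[mu]_t (eta n t)%:E = 1)%E.
Proof. by rewrite /eta; case: cid => f /= []. Qed.

Lemma measurable_eta n : measurable_fun setT (eta n : measurableTypeR R -> R).
Proof. by apply: continuous_measurable_fun; apply/smooth_R_continuous/smooth_eta. Qed.

Definition rho n : 'rV[R]_N -> R := tensor (fun=> eta n).

Lemma rho_ge0 n z : 0 <= rho n z.
Proof. by apply: prodr_ge0 => i _; exact: eta_ge0. Qed.

Lemma measurable_rho n : measurable_fun setT (rho n).
Proof. by apply: measurable_tensor => i; exact: measurable_eta. Qed.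

Lemma integral_rho n : (\int[leb]_z (rho n z)%:E = 1)%E.
Proof.
rewrite integral_tensor; last 2 first.
- by move=> i; exact: measurable_eta.
- by move=> i t; exact: eta_ge0.
by rewrite big1// => i _; exact: integral_eta.
Qed.

Lemma rho_supp n z i : rho n z != 0 -> - n.+1%:R^-1 < z ord0 i < 0.
Proof.
move=> h; apply: eta_supp; apply: contra_neq h => h.
by rewrite /rho /tensor (bigD1 i)//= h mul0r.
Qed.

Lemma smooth_R_bounded f (a b : R) : smooth_R f ->
  (forall t, f t != 0 -> a <= t <= b) -> exists2 M : R, 0 <= M & forall t, `|f t| <= M.
Proof.
move=> sf fab; have cf := smooth_R_continuous sf.
have [ab|ba] := leP a b; last first.
  exists 0 => // t; have [->|/fab/andP[h1 h2]] := eqVneq (f t) 0; first by rewrite normr0.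
  by exfalso; lra.
have cnf : {within `[a, b], continuous (fun t => `|f t|)}.
  apply: continuous_subspaceT => t; apply: cvg_norm; exact: cf.
have [c _ hc] := EVT_max ab cnf.
exists `|f c| => // t; have [->|/fab h] := eqVneq (f t) 0; first by rewrite normr0.
by apply: hc; rewrite in_itv.
Qed.

Lemma tensor_bounded (h : 'I_N -> R -> R) :
  (forall i, exists2 M : R, 0 <= M & forall t, `|h i t| <= M) ->
  exists2 M : R, 0 <= M & forall x, `|tensor h x| <= M.
Proof.
move=> hM; pose M i := s2val (cid2 (hM i)).
have M0 i : 0 <= M i by rewrite /M; case: cid2.
have hMi i t : `|h i t| <= M i by rewrite /M; case: cid2.
exists (\prod_i M i); first by apply: prodr_ge0.
by move=> x; rewrite normr_prod; apply: ler_prod => i _; rewrite normr_ge0/=.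
Qed.

Lemma integral_box_lty (a b : R) :
  (leb [set x | forall i, (`[a, b]%classic : set R) (x ord0 i)] < +oo)%E.
Proof.
rewrite (lebesgue_rV_box (A := fun=> `[a, b]%classic))//.
have [c cE] : exists c : R, mu `[a, b]%classic = c%:E.
  by rewrite lebesgue_measure_itv/= -EFinB; case: ifP => _; eexists.
by rewrite (eq_bigr (fun=> c%:E))// prodEFin ltry.
Qed.

Lemma L2_bounded_box (f : 'rV[R]_N -> R) (a b M : R) :
  measurable_fun setT f -> (forall x, `|f x| <= M) ->
  (forall x i, f x != 0 -> a <= x ord0 i <= b) -> L2 leb f.
Proof.
move=> mf fM fab; split => //.
pose B : set 'rV[R]_N := [set x | forall i, (`[a, b]%classic : set R) (x ord0 i)].
have mB : measurable B.
  rewrite (_ : B = \bigcap_(i in [set: 'I_N])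
    ((fun x : 'rV[R]_N => x ord0 i : measurableTypeR R) @^-1` `[a, b]%classic)).
    apply: fin_bigcap_measurable => // i _.
    by rewrite -[X in measurable X]setTI; exact: measurable_coord.
  by apply/seteqP; split => x /= h i; [move=> _; exact: h|exact: (h i I)].
apply: (@le_lt_trans _ _ (\int[leb]_(x in B) (M ^+ 2)%:E)%E); last first.
  rewrite integral_cst// lte_mul_pinfty// ?lee_fin ?sqr_ge0//.
  exact: integral_box_lty.
rewrite [leRHS]integral_mkcond; apply: ge0_le_integral => //.
- by move=> x _; rewrite lee_fin sqr_ge0.
- exact/measurable_EFinP/measurable_funX.
- by apply/(measurable_restrictT _ _).1.
move=> x _; rewrite patchE; case: ifPn => [_|].
  rewrite lee_fin -real_normK ?num_real// ler_pXn2r ?nnegrE// (le_trans _ (fM x))//.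
rewrite notin_setE => nB; rewrite lee_fin.
have [->|h] := eqVneq (f x) 0; first by rewrite expr0n.
by exfalso; apply: nB => i; rewrite /= in_itv/=; exact: fab.
Qed.

Lemma L2_rho n : L2 leb (rho n).
Proof.
have [M M0 hM] : exists2 M : R, 0 <= M & forall x, `|rho n x| <= M.
  apply: tensor_bounded => i; apply: (@smooth_R_bounded _ (- n.+1%:R^-1) 0 (smooth_eta n)).
  by move=> t /eta_supp /andP[/ltW -> /ltW ->].
apply: (@L2_bounded_box _ (- n.+1%:R^-1) 0 M) => //; first exact: measurable_rho.
by move=> x i /rho_supp => /(_ i) /andP[/ltW -> /ltW ->].
Qed.

Definition moll n u x := \int[leb]_z (rho n z * u (x + z)).

Lemma measurable_shift d (T : measurableType d) (u : 'rV[R]_N -> T) x : measurable_fun setT u ->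
  measurable_fun setT (fun z => u (x + z)).
Proof.
by move=> mu_; apply: (measurableT_comp mu_); exact: measurable_fun_addrV.
Qed.

Lemma measurable_moll n u : measurable_fun setT u -> measurable_fun setT (moll n u).
Proof.
move=> mu_; rewrite /moll.
apply: (@measurable_Rintegral _ _ _ _ _ leb
  (fun p : 'rV[R]_N * 'rV[R]_N => rho n p.2 * u (p.1 + p.2))).
apply: measurable_funM.
  by apply: (measurableT_comp (measurable_rho n)); exact: measurable_snd.
apply: (measurableT_comp mu_); apply: measurable_fun_addrV.
  exact: measurable_fst.
exact: measurable_snd.
Qed.

Lemma L2_shift u x : L2 leb u -> L2 leb (fun z => u (x + z)).
Proof.
move=> [mu_ uy]; split; first exact: measurable_shift.
under eq_integral do rewrite addrC.
rewrite (ge0_integral_shift x (f := fun x => (u x ^+ 2)%:E))//.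
- exact/measurable_EFinP/measurable_funX.
- by move=> y; rewrite lee_fin sqr_ge0.
Qed.

Lemma integrable_moll n u x : L2 leb u ->
  leb.-integrable setT (fun z => (rho n z * u (x + z))%:E).
Proof. by move=> uL; apply: L2_integrableM; [exact: L2_rho|exact: L2_shift]. Qed.

Lemma mollD n u v x : L2 leb u -> L2 leb v ->
  moll n (fun x => u x + v x) x = moll n u x + moll n v x.
Proof.
move=> uL vL; rewrite /moll -RintegralD//; last 2 first.
- exact: integrable_moll.
- exact: integrable_moll.
by apply: eq_Rintegral => z _; rewrite mulrDr.
Qed.

Lemma mollZ n (a : R) u x : L2 leb u ->
  moll n (fun x => a * u x) x = a * moll n u x.
Proof.
move=> uL; rewrite /moll -RintegralZl//; last exact: integrable_moll.
by apply: eq_Rintegral => z _; rewrite mulrCA.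
Qed.

(** Jensen at every point, then Tonelli: for fixed [z] translation invariance gives back the
    integral of |u|^q, and [rho n] has integral 1. Both sides may be infinite. *)
Lemma integral_moll_le n u (q : R) : 1 < q -> measurable_fun setT u ->
  (\int[leb]_x (`|moll n u x| `^ q)%:E <= \int[leb]_x (`|u x| `^ q)%:E)%E.
Proof.
move=> q1 mu_.
have muq : measurable_fun setT (fun x => (`|u x| `^ q)%:E).
  apply/measurable_EFinP; apply: (measurableT_comp (measurable_powR q)).
  exact: measurableT_comp.
have mm : measurable_fun setT (fun p : 'rV[R]_N * 'rV[R]_N =>
    (rho n p.2 * `|u (p.1 + p.2)| `^ q)%:E).
  under eq_fun do rewrite EFinM.
  apply: emeasurable_funM.
    by apply/measurable_EFinP/(measurableT_comp (measurable_rho n)); exact: measurable_snd.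
  apply: (measurableT_comp muq); apply: measurable_fun_addrV.
    exact: measurable_fst.
  exact: measurable_snd.
have p0 x z : (0 <= (rho n z * `|u (x + z)| `^ q)%:E)%E.
  by rewrite lee_fin mulr_ge0 ?rho_ge0 ?powR_ge0.
apply: (@le_trans _ _ (\int[leb]_x \int[leb]_z (rho n z * `|u (x + z)| `^ q)%:E)%E).
  apply: ge0_le_integral => //.
  - apply/measurable_EFinP; apply: (measurableT_comp (measurable_powR q)).
    by apply: measurableT_comp => //; exact: measurable_moll.
  - by apply: (measurable_fun_fubini_tonelli_F _ mm) => -[].
  - move=> x _; apply: jensen_powR => //.
    + exact: measurable_rho.
    + exact: measurable_shift.
    + exact: rho_ge0.
    + exact: integral_rho.
rewrite tonelli//.
rewrite (eq_integral (fun z => (rho n z)%:E * \int[leb]_x (`|u x| `^ q)%:E)%E); last first.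
  move=> z _.
  under eq_integral do rewrite EFinM.
  rewrite ge0_integralZl//; last 2 first.
  - apply/measurable_EFinP; apply: (measurableT_comp (measurable_powR q)).
    apply: measurableT_comp => //; apply: (measurableT_comp mu_).
    exact: measurable_fun_addrV.
  - by rewrite lee_fin rho_ge0.
  by rewrite (ge0_integral_shift z muq)// => x; rewrite lee_fin powR_ge0.
rewrite ge0_integralZr//; last 3 first.
- by apply/measurable_EFinP; exact: measurable_rho.
- by move=> z _; rewrite lee_fin rho_ge0.
- by apply: integral_ge0 => x _; rewrite lee_fin powR_ge0.
by rewrite integral_rho mul1e.
Qed.

End mollification.

(** * Closure properties of L^2 convergence of mollifications *)

Section moll_convergence.
Context {R : realType} {N : nat}.
Local Notation leb := (@lebesgue_rV R N).
Local Notation mu := (@lebesgue_measure R).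
Implicit Types (u v w : 'rV[R]_N -> R) (x y z : 'rV[R]_N) (n : nat) (i : 'I_N).

(** For nonnegative sequences this is convergence to 0, in a form that passes through inequalities
    between extended reals without finiteness side conditions. *)
Definition vanishing (D : nat -> \bar R) := forall e : R, 0 < e ->
  exists n0, forall n, (n0 <= n)%N -> (D n <= e%:E)%E.

Definition moll_err u n := (\int[leb]_x ((moll n u x - u x) ^+ 2)%:E)%E.

(** The class is shown to be all of L^2 by enlarging it: half-open boxes, Borel subsets of a cube,
    truncated simple functions, nonnegative functions, all functions. *)
Definition mollifiable u := L2 leb u /\ vanishing (moll_err u).

Lemma cvg0_vanishing (D : nat -> \bar R) : D @ \oo --> 0%E -> vanishing D.
Proof.
move=> /fine_cvgP[fD D0] e e0.
have h : \forall n \near \oo, (fine (D n) < e)%R by apply: (cvgr_lt _ D0).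
have [n0 _ hn0] : \forall n \near \oo, (D n <= e%:E)%E.
  near=> n; rewrite -[D n]fineK; last by near: n.
  by rewrite lee_fin ltW//; near: n.
by exists n0 => n n0n; exact: hn0.
Unshelve. all: by end_near. Qed.

Lemma vanishing_le (D E : nat -> \bar R) : (forall n, (D n <= E n)%E) ->
  vanishing E -> vanishing D.
Proof.
move=> DE vE e e0; have [n0 h] := vE e e0.
by exists n0 => n /h; exact: le_trans.
Qed.

Lemma vanishingD (a b : R) (D E : nat -> \bar R) : 0 <= a -> 0 <= b ->
  vanishing D -> vanishing E ->
  vanishing (fun n => a%:E * D n + b%:E * E n)%E.
Proof.
move=> a0 b0 vD vE e e0.
have c1 : 0 < a + b + 1 by rewrite ltr_wpDl// addr_ge0.
have c0 : 0 < e / (a + b + 1) by rewrite divr_gt0.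
have [n1 h1] := vD _ c0; have [n2 h2] := vE _ c0.
exists (maxn n1 n2) => n; rewrite geq_max => /andP[/h1 {}h1 /h2 {}h2].
apply: (@le_trans _ _ (a%:E * (e / (a + b + 1))%:E + b%:E * (e / (a + b + 1))%:E)%E).
  by apply: leeD; apply: lee_wpmul2l; rewrite ?lee_fin.
rewrite -!EFinM -EFinD lee_fin -mulrDl mulrCA ler_piMr ?(ltW e0)//.
by rewrite ler_pdivrMr// mul1r lerDl.
Qed.

Lemma mollifiableD u v : mollifiable u -> mollifiable v ->
  mollifiable (fun x => u x + v x).
Proof.
move=> [uL uv] [vL vv]; split; first exact: L2D.
apply: vanishing_le (vanishingD (ler0n _ 2) (ler0n _ 2) uv vv) => n.
have h w : L2 leb w -> measurable_fun setT (fun x => moll n w x - w x).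
  by move=> [mw _]; apply: measurable_funB => //; exact: measurable_moll.
apply: le_trans (integral_sqrD_le leb (h _ uL) (h _ vL)).
rewrite le_eqVlt; apply/orP; left; apply/eqP.
apply: eq_integral => x _; rewrite mollD//; congr ((_ ^+ 2)%:E); ring.
Qed.

Lemma mollifiableZ (a : R) u : mollifiable u -> mollifiable (fun x => a * u x).
Proof.
move=> [uL uv]; split; first exact: L2Z.
apply: vanishing_le (vanishingD (sqr_ge0 a) (lexx _) uv uv) => n.
rewrite mul0e adde0 -ge0_integralZl_EFin ?sqr_ge0//.
- rewrite le_eqVlt; apply/orP; left; apply/eqP.
  apply: eq_integral => x _; rewrite mollZ// -EFinM; congr (_%:E); ring.
- by move=> x _; rewrite lee_fin sqr_ge0.
- apply/measurable_EFinP/measurable_funX/measurable_funB; last by case: uL.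
  by apply: measurable_moll; case: uL.
Qed.

Lemma mollifiable_sum (I : Type) (s : seq I) (f : I -> 'rV[R]_N -> R) :
  (forall k, mollifiable (f k)) -> mollifiable (fun x => \sum_(k <- s) f k x).
Proof.
move=> mf; elim: s => [|k s IH].
  under eq_fun do rewrite big_nil.
  have L0 : L2 leb (fun=> 0) by split => //; rewrite expr0n/= integral0.
  split=> // e e0; exists 0%N => n _; rewrite /moll_err.
  under eq_integral => x _.
    rewrite /moll; under eq_Rintegral do rewrite mulr0.
    rewrite /Rintegral integral0 subr0 expr0n/=; over.
  by rewrite integral0 lee_fin ltW.
by under eq_fun do rewrite big_cons; exact: mollifiableD.
Qed.

(** For w = v - u the error of [u] is the error of [v], plus the mollification of -w, plus w. The
    mollified term is bounded uniformly in [n] because mollification contracts L^2. Two uses of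
    (a+b)^2 <= 2a^2 + 2b^2 account for e/4 and e/16. *)
Lemma mollifiable_lim u (v : nat -> 'rV[R]_N -> R) : L2 leb u ->
  (forall k, mollifiable (v k)) ->
  vanishing (fun k => \int[leb]_x ((v k x - u x) ^+ 2)%:E)%E -> mollifiable u.
Proof.
move=> uL mv vu; split => // e e0.
have [k0 /(_ k0 (leqnn _)) hk] := vu (e / 16%:R) (divr_gt0 e0 (ltr0n _ 16)).
have [vL vv] := mv k0.
have [n0 hn] := vv (e / 4%:R) (divr_gt0 e0 (ltr0n _ 4)).
exists n0 => n /hn {}hn.
pose w x := v k0 x - u x.
have wL : L2 leb w by apply: L2D => //; under eq_fun do rewrite -mulN1r; exact: L2Z.
have mw := L2_measurable wL.
have mN : L2 leb (fun x => -1 * w x) by exact: L2Z.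
have mMw : measurable_fun setT (moll n (fun x => -1 * w x)).
  by apply: measurable_moll; exact: (L2_measurable mN).
have mverr : measurable_fun setT (fun x => moll n (v k0) x - v k0 x).
  apply: measurable_funB; last by case: vL.
  by apply: measurable_moll; case: vL.
apply: (@le_trans _ _ (\int[leb]_x (((moll n (v k0) x - v k0 x) +
   (moll n (fun x => -1 * w x) x + w x)) ^+ 2)%:E)%E).
  rewrite le_eqVlt; apply/orP; left; apply/eqP.
  apply: eq_integral => x _.
  rewrite (_ : moll n u x = moll n (v k0) x + moll n (fun x => -1 * w x) x).
    by rewrite /w; congr ((_ ^+ 2)%:E); ring.
  by rewrite -mollD//; congr (moll n _ x); apply/funext => y; rewrite /w; ring.
apply: le_trans (integral_sqrD_le leb mverr _) _; first exact: measurable_funD.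
have h1 : (\int[leb]_x (w x ^+ 2)%:E <= (e / 16)%:E)%E by [].
have h2 : (\int[leb]_x (moll n (fun x => (-1 * w x)%R) x ^+ 2)%:E <= (e / 16)%:E)%E.
  rewrite -integral_powR2.
  apply: le_trans (integral_moll_le n _ _) _; [lra|exact: (L2_measurable mN)|].
  rewrite integral_powR2; apply: le_trans h1.
  rewrite le_eqVlt; apply/orP; left; apply/eqP.
  by apply: eq_integral => x _; congr (_%:E); ring.
have h3 : (\int[leb]_x ((moll n (fun x => -1 * w x) x + w x) ^+ 2)%:E <= (e / 4)%:E)%E.
  apply: le_trans (integral_sqrD_le leb mMw mw) _.
  apply: (@le_trans _ _ (2%:E * (e / 16)%:E + 2%:E * (e / 16)%:E)%E).
    by apply: leeD; apply: lee_wpmul2l; rewrite ?lee_fin.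
  by rewrite -!EFinM -EFinD lee_fin; lra.
apply: (@le_trans _ _ (2%:E * (e / 4)%:E + 2%:E * (e / 4)%:E)%E).
  by apply: leeD; apply: lee_wpmul2l; rewrite ?lee_fin.
by rewrite -!EFinM -EFinD lee_fin; lra.
Qed.

Lemma vanishing_dct (f : nat -> 'rV[R]_N -> R) (h g : 'rV[R]_N -> R) :
  (forall k, measurable_fun setT (f k)) -> measurable_fun setT h -> L2 leb g ->
  (forall x, f k x @[k --> \oo] --> h x) ->
  (forall k x, `|f k x| <= g x) ->
  vanishing (fun k => \int[leb]_x ((f k x - h x) ^+ 2)%:E)%E.
Proof.
move=> mf mh gL fh fg; apply: cvg0_vanishing.
have hg x : `|h x| <= g x.
  have nf : `|f k x| @[k --> \oo] --> `|h x| by apply: cvg_norm; exact: fh.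
  by rewrite -(cvg_lim _ nf)//; apply: limr_le; [apply/cvg_ex; exists (`|h x|) |apply: nearW].
pose F k x := ((f k x - h x) ^+ 2)%:E.
have mF k : measurable_fun setT (F k).
  by apply/measurable_EFinP/measurable_funX/measurable_funB.
have FF : {ae leb, forall x, setT x -> F ^~ x @ \oo --> 0%E}.
  apply/aeW => x _; apply/cvg_EFin; first exact: nearW.
  rewrite [X in _ --> X](_ : _ = (h x - h x) ^+ 2); last by rewrite subrr expr0n.
  apply: (@cvg_comp _ _ _ (fun k => f k x - h x) (fun t => t ^+ 2)); last exact: exprn_continuous.
  by apply: cvgB => //; exact: cvg_cst.
have ig : leb.-integrable setT (fun x => 4%:E * (g x ^+ 2)%:E)%E.
  by apply: integrableZl => //; exact: L2_integrable_sqr.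
have Fg : {ae leb, forall x k, setT x -> (`|F k x| <= 4%:E * (g x ^+ 2)%:E)%E}.
  apply/aeW => x k _; rewrite -EFinM lee_fin ger0_norm ?sqr_ge0//.
  have := fg k x; have := hg x.
  rewrite !ler_norml => /andP[h1 h2] /andP[h3 h4].
  have : - (2 * g x) <= f k x - h x <= 2 * g x by apply/andP; split; lra.
  move=> /andP[h5 h6]; nra.
have m0 : measurable_fun setT (cst 0%E : 'rV[R]_N -> \bar R) by [].
have [_ _] := dominated_convergence measurableT mF m0 FF ig Fg.
by rewrite integral0.
Qed.

Lemma mollifiable_dct u (f : nat -> 'rV[R]_N -> R) g : measurable_fun setT u ->
  (forall k, mollifiable (f k)) -> L2 leb g ->
  (forall x, f k x @[k --> \oo] --> u x) -> (forall k x, `|f k x| <= g x) ->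
  mollifiable u.
Proof.
move=> mu_ mf gL fu fg.
apply: (mollifiable_lim (v := f)) => //; last first.
  by apply: (vanishing_dct (g := g)) => // k; case: (mf k) => -[].
apply: L2_le mu_ gL _ => x.
have g0 : 0 <= g x by apply: le_trans (fg 0%N x).
rewrite (ger0_norm g0).
have nf : `|f k x| @[k --> \oo] --> `|u x| by apply: cvg_norm; exact: fu.
by rewrite -(cvg_lim _ nf)//; apply: limr_le; [apply/cvg_ex; exists (`|u x|) |apply: nearW].
Qed.

End moll_convergence.

(** * Mollification of indicator functions *)

Section moll_density.
Context {R : realType} {N : nat}.
Local Notation leb := (@lebesgue_rV R N).
Local Notation mu := (@lebesgue_measure R).
Implicit Types (u v w : 'rV[R]_N -> R) (x y z : 'rV[R]_N) (n m : nat) (i : 'I_N)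
  (a b : 'I_N -> R) (A : set 'rV[R]_N).

(** Half-open boxes are stable under intersection, as Dynkin's lemma requires, and generate the
    Borel sets. *)
Definition obox a b : set 'rV[R]_N := [set x | forall i, a i < x ord0 i <= b i].

Lemma measurable_coord_preimage i (Y : set R) : measurable (Y : set (measurableTypeR R)) ->
  measurable [set x : 'rV[R]_N | Y (x ord0 i)].
Proof.
by move=> mY; rewrite -[X in measurable X]setTI; exact: measurable_coord.
Qed.

Lemma measurable_obox a b : measurable (obox a b).
Proof.
rewrite (_ : obox a b = \bigcap_(i in [set: 'I_N]) [set x | (`]a i, b i]%classic : set R) (x ord0 i)]).
  by apply: fin_bigcap_measurable => // i _; exact: measurable_coord_preimage.
by apply/seteqP; split => x h i; have := h i; rewrite /= in_itv/= //; exact.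
Qed.

Lemma obox_setI a b a' b' : obox a b `&` obox a' b' =
  obox (fun i => Num.max (a i) (a' i)) (fun i => Num.min (b i) (b' i)).
Proof.
apply/seteqP; split => x.
  move=> [h h'] i; have := h i; have := h' i.
  by rewrite gt_max le_min => /andP[-> ->] /andP[-> ->].
move=> h; split => i; have := h i.
  by rewrite gt_max le_min => /andP[/andP[-> _] /andP[-> _]].
by rewrite gt_max le_min => /andP[/andP[_ ->] /andP[_ ->]].
Qed.

(** An interval ]c, d] in one coordinate pulls back to a slab, which is the countable union of the
    boxes whose other sides are ]-m, m]. *)
Lemma rV_measurableE :
  @measurable _ 'rV[R]_N = <<s [set B | exists a b, B = obox a b] >>.
Proof.
apply/seteqP; split; last first.
  apply: smallest_sub; first exact: sigma_algebra_measurable.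
  by move=> _ [a [b ->]]; exact: measurable_obox.
set S := <<s _ >>.
have sS : sigma_algebra setT S by exact: smallest_sigma_algebra.
apply: smallest_sub => // A; rewrite -bigcup_seq => -[i _ [Y mY <-]].
rewrite setTI.
have : preimage_set_system setT (fun x : 'rV[R]_N => x ord0 i : measurableTypeR R)
    ((@ocitv R).-sigma.-measurable) ((fun x : 'rV[R]_N => x ord0 i) @^-1` Y).
  by exists Y => //; rewrite setTI.
rewrite -g_sigma_preimageE; apply: smallest_sub => //.
move=> _ [_ [[c d] _ <-] <-]; rewrite setTI.
rewrite (_ : _ @^-1` _ = \bigcup_m obox
  (fun j => if j == i then c else - m%:R) (fun j => if j == i then d else m%:R)).
  have [_ _ sU] := sS; apply: sU => m.
  by apply: sub_gen_smallest; do 2 eexists.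
apply/seteqP; split => x /=; rewrite in_itv/=.
  move=> xcd.
  exists (\sum_(j < N) (`|Num.floor `|x ord0 j| |%N.+1))%N => // j.
  case: eqP => [->//|_]; set m := (\sum_(_ < _) _)%N.
  have : `|x ord0 j| < m%:R.
    have := floorD1_gt `|x ord0 j|.
    set k := Num.floor _ => h.
    have k0 : 0 <= k by rewrite /k floor_ge0.
    apply: lt_le_trans h _.
    rewrite -(gez0_abs k0) -PoszD -pmulrn ler_nat.
    by rewrite /m (bigD1 j)//= addn1 leq_addr.
  by rewrite ltr_norml => /andP[h1 /ltW h2]; rewrite h1 h2.
by move=> [m _] /(_ i); rewrite eqxx.
Qed.

Lemma moll_cst n u x (c : R) : (forall z, rho n z != 0 -> u (x + z) = c) -> moll n u x = c.
Proof.
move=> h; rewrite /moll (@eq_Rintegral _ _ _ _ _ (fun z => rho n z * c)); last first.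
  by move=> z _; have [->|/h->//] := eqVneq (rho n z) 0; rewrite !mul0r.
rewrite RintegralZr//.
  by rewrite /Rintegral integral_rho mul1r.
apply/integrableP; split; first by apply/measurable_EFinP; exact: measurable_rho.
under eq_integral do rewrite /= ger0_norm ?rho_ge0//.
by rewrite integral_rho ltry.
Qed.

Lemma measurable_ind A : measurable A -> measurable_fun setT (\1_A : 'rV[R]_N -> R).
Proof. by move=> mA; exact: measurable_indic. Qed.

Lemma moll_ind_le1 n A x : measurable A -> `|moll n (\1_A) x| <= 1.
Proof.
move=> mA.
have := @jensen_powR _ _ _ leb (rho n) (fun z => \1_A (x + z)) 2 _
  (measurable_rho n) _ (@rho_ge0 _ _ n) (integral_rho n).
rewrite ltr1n => /(_ erefl) h.
have {}h := h (measurable_shift x (measurable_ind mA)).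
rewrite -(@ler_pXn2r _ 2)// ?nnegrE// expr1n -powR_mulrn// -lee_fin.
apply: le_trans h _.
rewrite -(integral_rho (N := N) n); apply: ge0_le_integral => //.
- by move=> z _; rewrite lee_fin mulr_ge0 ?rho_ge0 ?powR_ge0.
- apply/measurable_EFinP/measurable_funM; first exact: measurable_rho.
  apply: (measurableT_comp (measurable_powR 2)); apply: measurableT_comp => //.
  exact: (measurable_shift x (measurable_ind mA)).
- by apply/measurable_EFinP; exact: measurable_rho.
move=> z _; rewrite lee_fin ler_piMr ?rho_ge0// powR_mulrn// indicE.
by case: (_ \in _); rewrite ?normr1 ?normr0 ?expr1n ?expr0n.
Qed.

(** At every point the mollified indicator is eventually equal to the indicator: inside, 1/(n+1)
    falls below every [x_i - a_i]; outside, either some x_i <= a_i and the kernel only moves further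
    down, or some x_i > b_i and short moves stay above b_i. Dominated convergence concludes. *)
Lemma mollifiable_obox a b : mollifiable (\1_(obox a b) : 'rV[R]_N -> R).
Proof.
have mB := measurable_obox a b.
have [c hc] : exists c : R, forall i, - c <= a i /\ b i <= c.
  exists (\sum_i (`|a i| + `|b i|)) => i; set c := \sum_(_ <- _) _.
  have : `|a i| + `|b i| <= c.
    by rewrite /c (bigD1 i)//= lerDl sumr_ge0// => j _; rewrite addr_ge0.
  move: c => c h; have := ler_norm (b i); have := ler_norm (- a i); rewrite normrN.
  have := normr_ge0 (a i); have := normr_ge0 (b i).
  by move=> *; split; lra.
(* The upper sides are moved by 1: with [z] in the support of the kernel, [x + z] in the box only
   gives x_i < b_i + 1. *)
pose C : set 'rV[R]_N := [set x | forall i, - c <= x ord0 i <= c + 1].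
have mC : measurable C.
  rewrite (_ : C = \bigcap_(i in [set: 'I_N]) [set x | (`[- c, c + 1]%classic : set R) (x ord0 i)]).
    by apply: fin_bigcap_measurable => // i _; exact: measurable_coord_preimage.
  by apply/seteqP; split => x h i; have := h i; rewrite /= in_itv/= //; exact.
have CL : L2 leb (\1_C : 'rV[R]_N -> R).
  apply: (@L2_bounded_box _ _ _ (- c) (c + 1) 1).
  - exact: measurable_ind.
  - by move=> x; rewrite indicE; case: (_ \in _); rewrite ?normr1 ?normr0.
  - move=> x i; rewrite indicE; case: (boolP (x \in C)) => [/set_mem Cx _|]; last by rewrite eqxx.
    exact: Cx.
have sub x : obox a b x -> C x.
  move=> h i; have [h3 h4] := hc i; have /andP[h1 h2] := h i.
  by apply/andP; split; lra.
have nsub n x : ~ C x -> forall z, rho n z != 0 -> ~ obox a b (x + z).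
  move=> nC z rz h; apply: nC => i; have [h1 h2] := hc i.
  have /andP[] := h i; rewrite !mxE => h3 h4.
  have /andP[h5 h6] := rho_supp i rz.
  have h7 : n.+1%:R^-1 <= 1 :> R by rewrite invf_le1 ?ltr0n// ler1n.
  move: (n.+1%:R^-1) h5 h7 => e h5 h7.
  by apply/andP; split; lra.
split.
  apply: (L2_le _ CL); first exact: measurable_ind.
  move=> x; rewrite !indicE; case: (boolP (x \in obox a b)) => [/set_mem/sub h|_].
    by rewrite mem_set.
  by rewrite normr0.
apply: (@vanishing_dct _ _ (fun n => moll n (\1_(obox a b))) _ (\1_C)) => //.
- by move=> k; apply: measurable_moll; exact: measurable_ind.
- move=> x; apply: cvg_near_cst.
  have [Bx|nBx] := pselect (obox a b x).
    have H : \forall n \near \oo, forall i, n.+1%:R^-1 < x ord0 i - a i.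
      apply: filter_forall => i; have /andP[h _] := Bx i.
      have h0 : 0 < x ord0 i - a i by rewrite subr_gt0.
      exact: near_infty_natSinv_lt (PosNum h0).
    near=> n; rewrite (@moll_cst n _ x 1) ?indicE ?mem_set//.
    move=> z rz; rewrite indicE mem_set// => i; rewrite !mxE.
    have /andP[h5 h6] := rho_supp i rz; have /andP[h1 h2] := Bx i.
    have h7 : n.+1%:R^-1 < x ord0 i - a i by move: i {rz h5 h6 h1 h2}; near: n; exact: H.
    move: (n.+1%:R^-1) h5 h7 => e h5 h7.
    by apply/andP; split; lra.
  have [i nBi] : exists i, ~~ (a i < x ord0 i <= b i).
    by apply/not_existsP => h; apply: nBx => i; have := h i; case: (_ && _).
  have [xa|ax] := leP (x ord0 i) (a i).
    near=> n; rewrite (@moll_cst n _ x 0) ?indicE ?memNset//.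
    move=> z rz; rewrite indicE memNset// => /(_ i); rewrite !mxE.
    have /andP[_ h6] := rho_supp i rz => /andP[h1 h2]; lra.
  rewrite ax /= -ltNge in nBi.
  have H : \forall n \near \oo, n.+1%:R^-1 < x ord0 i - b i.
    have h0 : 0 < x ord0 i - b i by rewrite subr_gt0.
    exact: near_infty_natSinv_lt (PosNum h0).
  near=> n; rewrite (@moll_cst n _ x 0) ?indicE ?memNset//.
  move=> z rz; rewrite indicE memNset// => /(_ i); rewrite !mxE.
  have h7 : n.+1%:R^-1 < x ord0 i - b i by near: n.
  have /andP[h5 _] := rho_supp i rz => /andP[h1 h2].
  by move: (n.+1%:R^-1) h5 h7 => e h5 h7; lra.
- move=> n x; rewrite [X in _ <= X]indicE; case: (boolP (x \in C)) => [_|].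
    by rewrite moll_ind_le1.
  rewrite notin_setE => nC; rewrite (@moll_cst n _ x 0) ?normr0//.
  by move=> z /(nsub _ _ nC) nB; rewrite indicE memNset.
Unshelve. all: by end_near. Qed.

Let K m := obox (fun=> - m%:R) (fun=> m%:R).

(** Dynkin's lemma over the boxes. Intersecting with a cube keeps the indicators of complements in
    L^2 and provides the dominating function for disjoint unions. *)
Lemma mollifiable_indK A m : measurable A -> mollifiable (\1_(A `&` K m) : 'rV[R]_N -> R).
Proof.
move=> mA.
have mK : measurable (K m) by exact: measurable_obox.
have KL : L2 leb (\1_(K m) : 'rV[R]_N -> R) by case: (mollifiable_obox (fun=> - m%:R) (fun=> m%:R)).
rewrite rV_measurableE in mA.
move: A mA; apply: dynkin_induction.
- by rewrite -rV_measurableE.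
- by move=> _ _ [a [b ->]] [a' [b' ->]]; rewrite obox_setI; do 2 eexists.
- by rewrite setTI; exact: mollifiable_obox.
- by move=> _ [a [b ->]]; rewrite obox_setI; exact: mollifiable_obox.
- move=> S mS PS.
  rewrite (_ : \1_(~` S `&` K m) = fun x => \1_(K m) x + -1 * \1_(S `&` K m) x :> R).
    by apply: mollifiableD; [exact: mollifiable_obox|exact: mollifiableZ].
  apply/funext => x; rewrite !indicE !in_setI in_setC.
  by case: (x \in S) => /=; case: (x \in K m) => /=; ring.
- move=> F mF tF PF.
  have fin n : mollifiable (fun x => \sum_(k < n) \1_(F k `&` K m) x : R).
    exact: mollifiable_sum.
  have E x k : F k x -> forall n, (k < n)%N -> \sum_(j < n) \1_(F j `&` K m) x = \1_(K m) x :> R.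
    move=> Fk n kn; rewrite (bigD1 (Ordinal kn))//= big1 ?addr0.
      by rewrite !indicE in_setI mem_set.
    move=> j jk; rewrite indicE in_setI memNset// => Fj.
    move/trivIsetP : tF => /(_ j k Logic.I Logic.I).
    have -> : (j : nat) != k by apply: contra jk => /eqP jk; apply/eqP/val_inj.
    by move=> /(_ erefl); apply/eqP/set0P; exists x.
  have E0 x n : ~ (\bigcup_k F k) x -> \sum_(j < n) \1_(F j `&` K m) x = 0 :> R.
    move=> nF; rewrite big1// => j _; rewrite indicE in_setI memNset// => Fj.
    by apply: nF; exists j.
  apply: (@mollifiable_dct _ _ _ (fun n x => \sum_(k < n) \1_(F k `&` K m) x) (\1_(K m))) => //.
  + apply: measurable_ind; apply: measurableI => //; exact: bigcupT_measurable.
  + move=> x; apply: cvg_near_cst.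
    have [[k _ Fk]|nF] := pselect ((\bigcup_k F k) x).
      near=> n; rewrite (E x k)//; last by near: n; exact: nbhs_infty_gt.
      by rewrite !indicE in_setI (mem_set (_ : (\bigcup_k F k) x))//; exists k.
    by near=> n; rewrite E0// indicE in_setI memNset.
  + move=> n x.
    have [[k Fk]|nF] := pselect (exists k : 'I_n, F k x).
      by rewrite (E x k)// indicE; case: (_ \in _); rewrite ?normr1 ?normr0.
    rewrite big1 ?normr0 ?indicE// => j _; rewrite indicE in_setI memNset// => Fj.
    by apply: nF; exists j.
Unshelve. all: by end_near. Qed.

End moll_density.

(** * Calculus of |t|^q *)

Section abs_power.
Context {R : realType}.
Implicit Types (q t e : R).

Lemma near0_powR q e : 0 < q -> 0 < e -> \forall t \near (0 : R), `|t| `^ q < e.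
Proof.
move=> q0 e0.
have c0 : 0 < e `^ q^-1 by exact: powR_gt0.
near=> t.
have tc : `|t| < e `^ q^-1.
  near: t; have := @nbhs0_lt R R (e `^ q^-1) c0; apply: filterS => t.
  by [].
have := gt0_ltr_powR q0 (_ : `|t| \in Num.nneg) (_ : e `^ q^-1 \in Num.nneg) tc.
rewrite !nnegrE => /(_ (normr_ge0 _) (powR_ge0 _ _)).
by rewrite -powRrM mulVf ?gt_eqF// powRr1 ?ltW.
Unshelve. all: by end_near. Qed.

Lemma is_derive_powR_pos q t : 0 < t -> is_derive t 1 (fun t => t `^ q) (q * t `^ (q - 1)).
Proof.
move=> t0; have ti : t \in `]0, +oo[ by rewrite in_itv/= t0.
apply: DeriveDef; first exact: derivable_powR.
by rewrite -derive1E powR_derive1.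
Qed.

Lemma powR_sub1 q t : 0 < t -> t `^ (q - 1) = t `^ (q - 2) * t.
Proof.
move=> t0; rewrite -[X in _ * X]powRr1 ?ltW// -powRD; last by rewrite (gt_eqF t0) implybT.
by congr (_ `^ _); ring.
Qed.

Lemma is_derive_abs_powR_neq0 q t : t != 0 ->
  is_derive t 1 (fun t => `|t| `^ q) (q * (`|t| `^ (q - 2) * t)).
Proof.
move=> tn0; have := tn0; rewrite neq_lt => /orP[t0|t0].
  have t0' : 0 < - t by rewrite oppr_gt0.
  have d1 := is_derive_powR_pos q t0'.
  have d2 : is_derive t 1 (fun t : R => - t) (-1 : R) by exact: (is_deriveN (is_derive_id t 1)).
  have h := is_derive1_comp d1 d2.
  rewrite (_ : q * (`|t| `^ (q - 2) * t) = q * (- t) `^ (q - 1) * -1).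
    apply: near_eq_is_derive h; near=> s; rewrite /= ltr0_norm//; near: s; exact: lt_nbhsl.
  by rewrite ltr0_norm// powR_sub1//; ring.
have h := is_derive_powR_pos q t0.
rewrite (_ : q * (`|t| `^ (q - 2) * t) = q * t `^ (q - 1)).
  apply: near_eq_is_derive h; near=> s; rewrite gtr0_norm//; near: s; exact: lt_nbhsr.
by rewrite gtr0_norm// powR_sub1.
Unshelve. all: by end_near. Qed.

(** At 0 the factor [t] makes the formula vanish even when q - 2 is negative, and the difference
    quotient has size |h|^(q-1). *)
Lemma is_derive_abs_powR q t : 1 < q ->
  is_derive t 1 (fun t => `|t| `^ q) (q * (`|t| `^ (q - 2) * t)).
Proof.
move=> q1; have [->|] := eqVneq t 0; last exact: is_derive_abs_powR_neq0.
rewrite !mulr0.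
have q0 : 0 < q by lra.
have q10 : 0 < q - 1 by lra.
have H : h^-1 *: (((fun t : R => `|t| `^ q) \o shift 0) (h *: 1) -
    `|(0 : R)| `^ q) @[h --> 0^'] --> (0 : R).
  apply/cvgrPdist_lt => e e0; near=> h.
  have h0 : h != 0 by near: h; exact: nbhs_dnbhs_neq.
  rewrite sub0r normrN normr0 powR0 ?gt_eqF// subr0 /= addr0 [h%:A]mulr1 normrZ normfV.
  have hp : 0 < `|h| by rewrite normr_gt0.
  rewrite (ger0_norm (powR_ge0 _ _)) -(mulr_powRB1 (ltW hp) q0) mulrA mulVf ?gt_eqF// mul1r.
  near: h; apply: nbhs_dnbhs; exact: near0_powR.
apply: DeriveDef; first by apply/cvg_ex; exists 0.
exact: (cvg_lim _ H).
Unshelve. all: by end_near. Qed.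

Lemma continuous_abs_powR q : 0 <= q -> continuous (fun t : R => `|t| `^ q).
Proof.
rewrite le_eqVlt => /predU1P[<- t|q0 t].
  by under eq_fun do rewrite powRr0; exact: cvg_cst.
have [->|t0] := eqVneq t 0.
  apply/cvgrPdist_lt => e e0; have := near0_powR q0 e0; apply: filterS => s.
  by rewrite normr0 powR0 ?gt_eqF// sub0r normrN (ger0_norm (powR_ge0 _ _)).
apply/differentiable_continuous/derivable1_diffP.
exact: (@ex_derive _ _ _ _ _ _ _ (is_derive_abs_powR_neq0 q t0)).
Qed.

End abs_power.

(** * Convergence almost everywhere of mollifications *)

Section moll_ae.
Import HBSimple HBNNSimple.
Context {R : realType} {N : nat}.
Local Notation leb := (@lebesgue_rV R N).
Local Notation mu := (@lebesgue_measure R).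
Implicit Types (u v w : 'rV[R]_N -> R) (x y z : 'rV[R]_N) (n m : nat) (i : 'I_N).

Lemma L2_ge0_mollifiable u : L2 leb u -> (forall x, 0 <= u x) -> mollifiable u.
Proof.
move=> uL u0; have mu_ := L2_measurable uL.
have mu' : measurable_fun setT (EFin \o u) by exact/measurable_EFinP.
pose f := nnsfun_approx measurableT mu'.
have fle k x : f k x <= u x.
  rewrite -lee_fin.
  have h := @cvg_nnsfun_approx _ _ _ setT measurableT _ mu'
    (fun x _ => ltac:(by rewrite lee_fin)) x Logic.I.
  have nd : nondecreasing_seq (EFin \o f^~ x).
    by move=> a b ab; rewrite lee_fin; exact/lefP/nd_nnsfun_approx.
  rewrite -[leRHS]/((EFin \o u) x) -(cvg_lim _ h)//.
  apply: (@le_trans _ _ (ereal_sup (range (EFin \o f^~ x)))).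
    by apply: ereal_sup_ubound; exists k.
  by have /cvg_lim -> := ereal_nondecreasing_cvgn nd.
pose K m := @obox R N (fun=> - m%:R) (fun=> m%:R).
(* The cutoff by the cube [K k] brings the level sets of the simple function within reach of
   [mollifiable_indK]; at each point it is eventually 1. *)
apply: (@mollifiable_dct _ _ u (fun k x => f k x * \1_(K k) x) u) => //.
- move=> k.
  rewrite (_ : (fun x => _) = fun x => \sum_(y <- finmap.enum_fset (fset_set (range (f k))))
      y * \1_(f k @^-1` [set y] `&` K k) x).
    apply: mollifiable_sum => y; apply: mollifiableZ; apply: mollifiable_indK.
    by rewrite -[X in measurable X]setTI; exact: measurable_funP.
  apply/funext => x; rewrite [in LHS]fimfunE fsbig_finite//= big_distrl/=.
  apply: eq_bigr => y _; rewrite -mulrA !indicE in_setI.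
  by rewrite -natrM mulnb.
- move=> x.
  have h := @cvg_nnsfun_approx _ _ _ setT measurableT _ mu'
    (fun x _ => ltac:(by rewrite lee_fin)) x Logic.I.
  have {}h : f k x @[k --> \oo] --> u x by exact: (fine_cvg h).
  rewrite -[X in _ --> X]mulr1.
  apply: cvgM => //; apply: cvg_near_cst.
  have H : \forall k \near \oo, forall i, `|x ord0 i| < k%:R.
    by apply: filter_forall => i; exact: nbhs_infty_gtr.
  near=> k; rewrite indicE mem_set// => i.
  have : `|x ord0 i| < k%:R by move: i; near: k.
  by rewrite ltr_norml => /andP[-> /ltW ->].
- move=> k x; rewrite ger0_norm ?mulr_ge0//.
  rewrite indicE; case: (_ \in _); rewrite ?mulr1 ?mulr0//.
Unshelve. all: by end_near. Qed.

Lemma L2_mollifiable u : L2 leb u -> mollifiable u.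
Proof.
move=> uL; have mu_ := L2_measurable uL.
have pL : L2 leb (fun x => Num.max (u x) 0).
  apply: (L2_le _ uL); first exact: measurable_maxr.
  move=> x; rewrite ger0_norm; last by rewrite le_max lexx orbT.
  by rewrite ge_max ler_norm normr_ge0.
have nL : L2 leb (fun x => Num.max (- u x) 0).
  apply: (L2_le _ uL).
    by apply: measurable_maxr => //; exact: measurable_funN.
  move=> x; rewrite ger0_norm; last by rewrite le_max lexx orbT.
  by rewrite ge_max -normrN ler_norm normr_ge0.
rewrite (_ : u = fun x => Num.max (u x) 0 + -1 * Num.max (- u x) 0).
  apply: mollifiableD; last apply: mollifiableZ.
    by apply: L2_ge0_mollifiable => // x; rewrite le_max lexx orbT.
  by apply: L2_ge0_mollifiable => // x; rewrite le_max lexx orbT.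
apply/funext => x; case: (leP 0 (u x)) => h.
  by rewrite max_r ?oppr_le0// mulr0 addr0.
by rewrite max_l ?oppr_ge0 ?(ltW h)//; ring.
Qed.

(** Along a subsequence the squared errors have summable integrals, so their series is integrable,
    hence finite almost everywhere, and its terms tend to 0 there. *)
Lemma moll_ae_subseq u : L2 leb u -> exists k : nat -> nat,
  {ae leb, forall x, moll (k j) u x @[j --> \oo] --> u x}.
Proof.
move=> uL; have [_ ve] := L2_mollifiable uL.
have mu_ := L2_measurable uL.
have H j : exists n, (moll_err u n <= (1 / (2 ^ j.+1)%:R)%:E)%E.
  have [|n0 hn] := ve (1 / (2 ^ j.+1)%:R); first by rewrite divr_gt0// ltr0n expn_gt0.
  by exists n0; exact: hn.
pose k j := sval (cid (H j)).
have hk j : (moll_err u (k j) <= (1 / (2 ^ j.+1)%:R)%:E)%E by rewrite /k; case: cid.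
exists k.
pose f j x := ((moll (k j) u x - u x) ^+ 2)%:E.
have f0 j x : (0 <= f j x)%E by rewrite lee_fin sqr_ge0.
have mf j : measurable_fun setT (f j).
  apply/measurable_EFinP/measurable_funX/measurable_funB => //; exact: measurable_moll.
have mS : measurable_fun setT (fun x => \sum_(0 <= j <oo) f j x)%E.
  by apply: ge0_emeasurable_sum => //.
have S0 x : (0 <= \sum_(0 <= j <oo) f j x)%E by exact: nneseries_ge0.
have intS : leb.-integrable setT (fun x => \sum_(0 <= j <oo) f j x)%E.
  apply/integrableP; split => //.
  under eq_integral do rewrite gee0_abs//.
  rewrite integral_nneseries//.
  apply: (@le_lt_trans _ _ (\sum_(0 <= j <oo) (1 / (2 ^ j.+1)%:R)%:E)%E); last first.
    by rewrite (le_lt_trans (epsilon_trick0 _ _))// ltry.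
  by apply: lee_nneseries => [j _ _|j _]; [exact: integral_ge0|exact: hk].
have := integrable_ae measurableT intS.
apply: filterS => x /(_ Logic.I) fx.
have Sx : (\sum_(0 <= j <oo) f j x < +oo)%E by rewrite -ge0_fin_numE.
have := nneseries_tail_cvg Sx (fun j _ => f0 j x).
move=> /cvg0_vanishing T0.
apply/cvgrPdist_le => e e0.
have [n0 hn] := T0 (e ^+ 2) ltac:(by rewrite exprn_gt0).
exists n0 => // j /= /hn h.
have : (f j x <= (e ^+ 2)%:E)%E.
  apply: le_trans h.
  have := @nneseries_lim_ge R (fun j => f j x) xpredT j j.+1 (fun _ _ _ => f0 _ _).
  by rewrite big_nat1.
rewrite lee_fin distrC -[in X in X -> _](real_normK (num_real (_ - _))).
by rewrite ler_pXn2r// nnegrE ?ltW.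
Qed.

Lemma moll_eq0_ae u : L2 leb u -> (forall n x, moll n u x = 0) ->
  {ae leb, forall x, u x = 0}.
Proof.
move=> uL u0; have [k] := moll_ae_subseq uL.
apply: filterS => x; under eq_fun do rewrite u0.
by move=> /cvg_lim <-//; rewrite lim_cst.
Qed.

Lemma moll_bounded_ae u (C : R) : L2 leb u -> (forall n x, `|moll n u x| <= C) ->
  {ae leb, forall x, `|u x| <= C}.
Proof.
move=> uL uC; have [k] := moll_ae_subseq uL.
apply: filterS => x kx.
have nf : `|moll (k j) u x| @[j --> \oo] --> `|u x| by apply: cvg_norm; exact: kx.
by rewrite -(cvg_lim _ nf)//; apply: limr_le; [apply/cvg_ex; exists (`|u x|) |apply: nearW].
Qed.

(** The way back from bounds uniform in [n] to [u]. An infinite bound [C] is allowed, which lets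
    comparison inequalities through without finiteness. *)
Lemma moll_fatou u (q : R) (C : \bar R) : 1 < q -> L2 leb u ->
  (forall n, \int[leb]_x (`|moll n u x| `^ q)%:E <= C)%E ->
  (\int[leb]_x (`|u x| `^ q)%:E <= C)%E.
Proof.
move=> q1 uL uC; have [k kx] := moll_ae_subseq uL.
have mu_ := L2_measurable uL.
have mpow w : measurable_fun setT w -> measurable_fun setT (fun x => (`|w x| `^ q)%:E).
  move=> mw; apply/measurable_EFinP; apply: (measurableT_comp (measurable_powR q)).
  exact: measurableT_comp.
have mk j : measurable_fun setT (fun x => (`|moll (k j) u x| `^ q)%:E).
  by apply: mpow; exact: measurable_moll.
have p0 j x : (0 <= (`|moll (k j) u x| `^ q)%:E)%E by rewrite lee_fin powR_ge0.
apply: (@le_trans _ _ (\int[leb]_x limn_einf (fun j => (`|moll (k j) u x| `^ q)%:E))%E).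
  rewrite le_eqVlt; apply/orP; left; apply/eqP.
  apply: ae_eq_integral => //.
  - exact: mpow.
  - under eq_fun do rewrite -[limn_einf _]oppeK -limn_esupN.
    apply: measurableT_comp => //.
    by apply: measurable_fun_limn_esup => j; apply: measurableT_comp => //; exact: mk.
  move: kx; apply: filterS => x kx _.
  have h : (`|moll (k j) u x| `^ q)%:E @[j --> \oo] --> (`|u x| `^ q)%:E.
    apply/cvg_EFin; first exact: nearW.
    apply: (@cvg_comp _ _ _ (fun j => moll (k j) u x) (fun t => `|t| `^ q) _ _ _ kx).
    by apply: continuous_abs_powR; apply/ltW/(lt_trans ltr01).
  by have [-> _] := cvg_limn_einf_sup h.
apply: le_trans (fatou leb measurableT mk _) _; first by move=> j x _; exact: p0.
rewrite limn_einf_lim; apply: lime_le; first exact: is_cvg_einfs.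
apply: nearW => j; apply: le_trans (uC (k j)).
by apply: ereal_inf_lbound; exists j => //=.
Qed.

End moll_ae.

(** * Weak derivatives of mollified functions *)
Section convolution.
Context {R : realType} {N : nat}.
Local Notation leb := (@lebesgue_rV R N).
Local Notation mu := (@lebesgue_measure R).
Implicit Types (u v w g : 'rV[R]_N -> R) (x y z : 'rV[R]_N) (n m : nat) (i j : 'I_N)
  (h : 'I_N -> R -> R).

(** The support condition uses a closed interval and is stable under differentiation: off a closed
    interval the function vanishes locally. *)
Definition kernel h := (forall j, smooth_R (h j)) /\
  (forall j t, h j t != 0 -> -1 <= t <= 0).

Definition shift_kernel x h : 'I_N -> R -> R := fun j t => h j (t - x ord0 j).

(** The substituted form of [moll], with [x] in the kernel, where derivatives can fall. The kernel
    is arbitrary because partial derivatives of mollifiers occur too. *)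
Definition conv h u x := \int[leb]_y (tensor h (y - x) * u y).

Lemma tensor_shift_kernel h x y : tensor (shift_kernel x h) y = tensor h (y - x).
Proof. by apply: eq_bigr => j _; rewrite /shift_kernel !mxE. Qed.

Lemma kernel_eta n : kernel (fun=> eta n).
Proof.
split=> [j|j t /eta_supp/andP[h1 /ltW h2]]; first exact: smooth_eta.
by rewrite h2 andbT (le_trans _ (ltW h1))// lerN2 invf_le1 ?ltr0n// ler1n.
Qed.

Lemma derive1_eq0_outside (f : R -> R) (a b t : R) :
  (forall t, f t != 0 -> a <= t <= b) -> f^`()%classic t != 0 -> a <= t <= b.
Proof.
move=> fab; apply: contraR => /negP nt; apply/eqP; rewrite derive1E.
have -> : 'D_1 f t = 'D_1 (cst 0 : R -> R) t.
  apply: near_eq_derive.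
  have [ta|at_] := ltP t a.
    near=> s; apply/eqP; apply: contraT => /fab/andP[as_ _].
    have : s < a by near: s; exact: lt_nbhsl.
    by rewrite ltNge as_.
  have bt : b < t by rewrite ltNge; apply/negP => tb; apply: nt; rewrite at_ tb.
  near=> s; apply/eqP; apply: contraT => /fab/andP[_ sb].
  have : b < s by near: s; exact: lt_nbhsr.
  by rewrite ltNge sb.
by rewrite derive_cst.
Unshelve. all: by end_near. Qed.

Lemma kernel_derive_at h i : kernel h -> kernel (derive_at i h).
Proof.
move=> [sh hs]; split => j; rewrite /derive_at; case: eqP => _ //.
- exact: smooth_R_derive1.
- by move=> t; apply: derive1_eq0_outside => s; exact: hs.
- exact: hs.
Qed.

Lemma derive1_shift (f : R -> R) (a : R) : smooth_R f ->
  (fun t => f (t - a))^`()%classic = fun t => f^`()%classic (t - a).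
Proof.
move=> sf; apply/funext => t.
have d1 : is_derive (t - a) 1 f ('D_1 f (t - a)).
  by apply/derivableP; exact: smooth_R_derivable.
have d2 : is_derive t 1 (fun t : R => t - a) (1 : R).
  have := is_deriveD (is_derive_id t 1) (is_derive_cst (- a) t 1).
  by rewrite addr0.
have := @is_derive1_comp R f (fun t => t - a) t _ _ d1 d2; rewrite mulr1 => d.
by rewrite !derive1E; exact: (@derive_val _ _ _ _ _ _ _ d).
Qed.

Lemma derive_at_shift h i x : (forall j, smooth_R (h j)) ->
  derive_at i (shift_kernel x h) = shift_kernel x (derive_at i h).
Proof.
move=> sh; apply/funext => j; apply/funext => t.
rewrite /derive_at /shift_kernel; case: eqP => // _.
by rewrite derive1_shift.
Qed.

Lemma derive_atC h i j : derive_at i (derive_at j h) = derive_at j (derive_at i h).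
Proof. by apply/funext => k; rewrite /derive_at; case: eqP => //; case: eqP. Qed.

Lemma smooth_shift_kernel h x : kernel h -> forall j, smooth_R (shift_kernel x h j).
Proof.
move=> [sh _] j.
have := smooth_R_aff 1 (- x ord0 j) (sh j).
by under eq_fun do rewrite mul1r.
Qed.

Lemma test_function_kernel h x : kernel h -> test_function (tensor (shift_kernel x h)).
Proof.
move=> kh; apply: (@test_function_tensor _ _ _ (fun j => x ord0 j - 1) (fun j => x ord0 j)).
  exact: smooth_shift_kernel.
move=> j t; rewrite /shift_kernel => /kh.2 /andP[h1 h2].
by apply/andP; split; lra.
Qed.

Lemma derive_kernel h i x y : kernel h ->
  'D_(basis_vec i) (tensor (shift_kernel x h)) y = tensor (derive_at i h) (y - x).
Proof.
move=> kh.
have dh j t : derivable (shift_kernel x h j) t 1.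
  by apply: smooth_R_derivable; exact: smooth_shift_kernel.
have /(congr1 (fun f => f y)) /= -> := derive_tensor i dh.
by rewrite derive_at_shift; [rewrite tensor_shift_kernel|case: kh].
Qed.

(** The kernel translated by [x] is itself a test function, and its partial derivative in [y] is the
    translated derivative of the kernel. *)
Lemma conv_weak h i u g x : kernel h -> is_weak_partial i u g ->
  conv (derive_at i h) u x = - conv h g x.
Proof.
move=> kh ug; have := ug _ (test_function_kernel x kh).
rewrite /conv => e; transitivity (\int[leb]_y (u y * 'D_(basis_vec i) (tensor (shift_kernel x h)) y)).
  by apply: eq_Rintegral => y _; rewrite derive_kernel// mulrC.
rewrite e; congr (- _); apply: eq_Rintegral => y _.
by rewrite tensor_shift_kernel mulrC.
Qed.

Lemma measurable_kernel h x : kernel h -> measurable_fun setT (fun y => tensor h (y - x)).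
Proof.
move=> [sh _].
apply: (measurableT_comp (measurable_tensor _)).
  by move=> j; apply: continuous_measurable_fun; exact/smooth_R_continuous.
exact: measurable_fun_addrV.
Qed.

Lemma moll_conv n u x : measurable_fun setT u -> moll n u x = conv (fun=> eta n) u x.
Proof.
move=> mu_; rewrite /moll /conv /Rintegral; congr fine.
rewrite -[RHS](integral_shift x).
  by apply: eq_integral => z _; rewrite addrK [z + x]addrC.
apply/measurable_EFinP; apply: measurable_funM => //.
by apply: measurable_kernel; exact: kernel_eta.
Qed.

Lemma kernel_bounded h : kernel h -> exists2 M : R, 0 <= M & forall x, `|tensor h x| <= M.
Proof.
move=> [sh hs]; apply: tensor_bounded => j.
exact: (@smooth_R_bounded _ _ (-1) 0 (sh j) (hs j)).
Qed.

Lemma tensor_neq0 h x : tensor h x != 0 -> forall j, h j (x ord0 j) != 0.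
Proof.
move=> hx j; apply: contra_neq hx => hj.
by rewrite /tensor (bigD1 j)//= hj mul0r.
Qed.

Lemma L2_kernel h x : kernel h -> L2 leb (fun y => tensor h (y - x)).
Proof.
move=> kh; have [M M0 hM] := kernel_bounded kh.
pose c := \sum_j `|x ord0 j|.
have xc j : `|x ord0 j| <= c by rewrite /c (bigD1 j)//= lerDl sumr_ge0.
apply: (@L2_bounded_box _ _ _ (- c - 1) c M) => //.
  exact: measurable_kernel.
move=> y j /tensor_neq0 /(_ j) /kh.2; rewrite !mxE.
move: (xc j); rewrite ler_norml => /andP[h1 h2] /andP[h3 h4].
by move: c h1 h2 {xc} => c h1 h2; apply/andP; split; lra.
Qed.

Lemma integrable_conv h u x : kernel h -> L2 leb u ->
  leb.-integrable setT (fun y => (tensor h (y - x) * u y)%:E).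
Proof. by move=> kh uL; apply: L2_integrableM => //; exact: L2_kernel. Qed.

Lemma is_derive_kernel_line h i x y (s : R) : kernel h ->
  is_derive s 1 (fun s => tensor h (y - (x + s *: basis_vec i)))
   (- tensor (derive_at i h) (y - (x + s *: basis_vec i))).
Proof.
move=> kh.
have E s' : y - (x + s' *: basis_vec i) = (y - x) + (- s') *: basis_vec i.
  by rewrite opprD addrA scaleNr.
under eq_fun do rewrite E.
rewrite E.
have d := is_derive_tensor_line (x := y - x) (s := - s) (smooth_R_derivable (kh.1 i)).
have d2 : is_derive s 1 (fun t : R => - t) (-1 : R) by exact: (is_deriveN (is_derive_id s 1)).
have := @is_derive1_comp R (fun s => tensor h (y - x + s *: basis_vec i)) (fun t => - t) s _ _ d d2.
by rewrite mulrN1.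
Qed.

Lemma is_derive_conv_line h i u x (a : R) : kernel h -> L2 leb u ->
  is_derive a 1 (fun s => conv h u (x + s *: basis_vec i))
    (- conv (derive_at i h) u (x + a *: basis_vec i)).
Proof.
move=> kh uL; have kdh := kernel_derive_at i kh.
have [M M0 hM] := kernel_bounded kdh.
pose f s y := tensor h (y - (x + s *: basis_vec i)) * u y.
have df (s : R) y : is_derive s 1 (f ^~ y) (- tensor (derive_at i h) (y - (x + s *: basis_vec i)) * u y).
  have := is_deriveM (is_derive_kernel_line i x y s kh) (is_derive_cst (u y) s 1).
  by rewrite scaler0 add0r [_ *: _]mulrC.
have [c hc] : exists c : R, forall j, `|x ord0 j| <= c.
  exists (\sum_j `|x ord0 j|) => j.
  by rewrite (bigD1 j)//= lerDl sumr_ge0.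
(* A box containing the supports of the kernels translated by x + s e_i with |s - a| < 1. Since |s|
   <= |a| + 1 and the kernel has width at most 1, a margin of |a| + 2 is used, and 3 leaves room. *)
pose C : set 'rV[R]_N :=
    [set y | forall j, (`[- c - `|a| - 3, c + `|a| + 3]%classic : set R) (y ord0 j)].
have mC : measurable C.
  rewrite (_ : C = \bigcap_(j in [set: 'I_N])
      [set y | (`[- c - `|a| - 3, c + `|a| + 3]%classic : set R) (y ord0 j)]).
    by apply: fin_bigcap_measurable => // j _; exact: measurable_coord_preimage.
  by apply/seteqP; split => y hy j; [move=> _; exact: hy|exact: (hy j Logic.I)].
have CL : L2 leb (fun y => M * \1_C y).
  apply: L2Z; apply: (@L2_bounded_box _ _ _ (- c - `|a| - 3) (c + `|a| + 3) 1).
  - exact: measurable_ind.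
  - by move=> y; rewrite indicE; case: (_ \in _); rewrite ?normr1 ?normr0.
  - move=> y j; rewrite indicE; case: (boolP (y \in C)) => [/set_mem Cy _|]; last by rewrite eqxx.
    by have := Cy j; rewrite /= in_itv.
have auL : L2 leb (fun y => `|u y|).
  apply: (L2_le _ uL); last by move=> y; rewrite normr_id.
  by apply: measurableT_comp => //; exact: (L2_measurable uL).
have Ia : `]a - 1, a + 1[%classic a by rewrite /= in_itv/=; apply/andP; split; lra.
have intf (s : R) : `]a - 1, a + 1[%classic s -> leb.-integrable setT (EFin \o f s).
  by move=> _; exact: integrable_conv.
have derf (s : R) y : `]a - 1, a + 1[%classic s -> setT y -> derivable (f ^~ y) s 1.
  by move=> _ _; exact: (@ex_derive _ _ _ _ _ _ _ (df s y)).
have G0 y : 0 <= M * \1_C y * `|u y| by rewrite !mulr_ge0.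
have intG : leb.-integrable setT (EFin \o (fun y => M * \1_C y * `|u y|)).
  exact: L2_integrableM.
have Gub (s : R) y : `]a - 1, a + 1[%classic s -> setT y ->
    `|(partial1of2 f) s y| <= M * \1_C y * `|u y|.
  rewrite /= in_itv/= => /andP[s1 s2] _.
  rewrite /partial1of2 derive1E (@derive_val _ _ _ _ _ _ _ (df s y)) normrM normrN.
  apply: ler_wpM2r => //.
  rewrite indicE; case: (boolP (y \in C)) => [_|]; first by rewrite mulr1.
  rewrite notin_setE => nC; rewrite mulr0.
  have [->|/tensor_neq0 hn] := eqVneq (tensor (derive_at i h) (y - (x + s *: basis_vec i))) 0.
    by rewrite normr0.
  exfalso; apply: nC => j /=; rewrite in_itv/=.
  have /kdh.2 := hn j; rewrite !mxE.
  have := hc j; rewrite ler_norml => /andP[h1 h2] /andP[].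
  have : `|s * ((0 == 0 :> 'I_1) && (j == i))%:R| <= `|a| + 1.
    rewrite normrM eqxx /= (@le_trans _ _ `|s|)//.
      by case: eqP => _; rewrite ?normr1 ?normr0 ?mulr1 ?mulr0.
    rewrite -[s](subrK a) (le_trans (ler_normD _ _))// addrC lerD2l.
    by rewrite ler_norml; apply/andP; split; lra.
  move: (s * _) (normr_ge0 a) => t.
  rewrite ler_norml => ? /andP[] *.
  by apply/andP; split; lra.
have D := derivable_under_integral measurableT Ia intf derf G0 intG Gub.
have E := differentiation_under_integral measurableT Ia intf derf G0 intG Gub.
apply: DeriveDef => //.
rewrite -derive1E E /conv -[RHS]mulN1r -RintegralZl//; last exact: integrable_conv.
apply: eq_Rintegral => y _.
by rewrite /partial1of2 derive1E (@derive_val _ _ _ _ _ _ _ (df a y)); ring.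
Qed.

(** Two signs cancel: one from differentiating the kernel in [x] instead of [y], the other from the
    definition of the weak derivative. *)
Lemma is_derive_moll_line n i u g x (s : R) : L2 leb u -> L2 leb g -> is_weak_partial i u g ->
  is_derive s 1 (fun s => moll n u (x + s *: basis_vec i)) (moll n g (x + s *: basis_vec i)).
Proof.
move=> uL gL ug; have kh := kernel_eta n.
have := is_derive_conv_line i x s kh uL.
rewrite (conv_weak _ kh ug) opprK -moll_conv; last exact: (L2_measurable gL).
have -> // : moll n u = conv (fun=> eta n) u.
by apply/funext => y; apply: moll_conv; exact: (L2_measurable uL).
Qed.

Lemma continuous_moll_line n i u x : L2 leb u ->
  continuous (fun s : R => moll n u (x + s *: basis_vec i)).
Proof.
move=> uL s; have -> : moll n u = conv (fun=> eta n) u.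
  by apply/funext => y; apply: moll_conv; exact: (L2_measurable uL).
apply/differentiable_continuous/derivable1_diffP.
exact: (@ex_derive _ _ _ _ _ _ _ (is_derive_conv_line i x s (kernel_eta n) uL)).
Qed.

(** By [conv_weak] the mollification of a weak derivative is determined by [u], so that the
    difference has zero mollifications. *)
Lemma weak_partial_unique i u g g' : L2 leb g -> L2 leb g' ->
  is_weak_partial i u g -> is_weak_partial i u g' -> {ae leb, forall x, g x = g' x}.
Proof.
move=> gL gL' ug ug'.
have dL : L2 leb (fun x => g x + -1 * g' x) by apply: L2D => //; exact: L2Z.
have : {ae leb, forall x, g x + -1 * g' x = 0}.
  apply: moll_eq0_ae => // n x; rewrite mollD//; last exact: L2Z.
  rewrite mollZ// !moll_conv; [|exact: (L2_measurable gL')|exact: (L2_measurable gL)].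
  have := conv_weak x (kernel_eta n) ug; rewrite (conv_weak x (kernel_eta n) ug').
  by move=> h; rewrite mulN1r h addNr || lra.
by apply: filterS => x; lra.
Qed.

(** Applying [conv_weak] twice moves both derivatives onto the kernel, where [derive_atC] exchanges
    them; both sides then have the same mollifications. *)
Lemma weak_partialC i j u vi vj vij vji : L2 leb u -> L2 leb vi -> L2 leb vj ->
  L2 leb vij -> L2 leb vji -> is_weak_partial i u vi -> is_weak_partial j u vj ->
  is_weak_partial j vi vij -> is_weak_partial i vj vji ->
  {ae leb, forall x, vij x = vji x}.
Proof.
move=> uL viL vjL vijL vjiL uvi uvj uvij uvji.
have dL : L2 leb (fun x => vij x + -1 * vji x) by apply: L2D => //; exact: L2Z.
have : {ae leb, forall x, vij x + -1 * vji x = 0}.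
  apply: moll_eq0_ae => // n x; rewrite mollD//; last exact: L2Z.
  rewrite mollZ// !moll_conv; [|exact: (L2_measurable vjiL)|exact: (L2_measurable vijL)].
  have kh := kernel_eta n.
  have := conv_weak x (kernel_derive_at j kh) uvi; rewrite (conv_weak x kh uvij).
  have := conv_weak x (kernel_derive_at i kh) uvj; rewrite (conv_weak x kh uvji).
  rewrite derive_atC; lra.
by apply: filterS => x; lra.
Qed.

End convolution.

(** * Estimates along lines *)

Section line_estimates.
Context {R : realType}.
Local Notation mu := (@lebesgue_measure R).

Lemma integral_derive_segment (F f : R -> R) (a b : R) : a < b ->
  (forall s : R, is_derive s 1 F (f s)) -> continuous f ->
  (\int[mu]_(s in `[a, b]) (f s)%:E = (F b - F a)%:E)%E.
Proof.
move=> ab dF cf.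
have cF : continuous F.
  move=> s; apply/differentiable_continuous/derivable1_diffP.
  exact: (@ex_derive _ _ _ _ _ _ _ (dF s)).
rewrite (@continuous_FTC2 R f F a b)//.
- exact: continuous_subspaceT.
- split.
  + by move=> s _; exact: (@ex_derive _ _ _ _ _ _ _ (dF s)).
  + exact/cvg_at_right_filter/cF.
  + exact/cvg_at_left_filter/cF.
- by move=> s _; rewrite derive1E; exact: (@derive_val _ _ _ _ _ _ _ (dF s)).
Qed.

(** Replaces decay at infinity: if [h 0] exceeded the total variation by d > 0, then [h] would stay
    above [d] on all of ]-oo, 0] and could not be integrable. *)
Lemma le_integral_norm_derive (h h' : R -> R) : (forall s, 0 <= h s) ->
  (forall s : R, is_derive s 1 h (h' s)) -> continuous h' ->
  (\int[mu]_s (h s)%:E < +oo)%E ->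
  ((h 0)%:E <= \int[mu]_s (`|h' s|)%:E)%E.
Proof.
move=> h0 dh ch' hy.
have ch : continuous h.
  move=> s; apply/differentiable_continuous/derivable1_diffP.
  exact: (@ex_derive _ _ _ _ _ _ _ (dh s)).
have mh : measurable_fun setT (h : measurableTypeR R -> R) by exact: continuous_measurable_fun.
have mh' : measurable_fun setT (h' : measurableTypeR R -> R) by exact: continuous_measurable_fun.
rewrite leNgt; apply/negP.
set J := (X in (X < _)%E) => Jh.
have J0 : (0 <= J)%E by apply: integral_ge0 => s _; rewrite lee_fin.
have JE : J = (fine J)%:E by rewrite fineK// ge0_fin_numE// (lt_trans Jh)// ltry.
pose d := h 0 - fine J.
have d0 : 0 < d by rewrite subr_gt0 -lte_fin -JE.
have hd s : s <= 0 -> d <= h s.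
  rewrite le_eqVlt => /predU1P[->|s0].
    by rewrite /d gerBl fine_ge0.
  have : (`|(h 0 - h s)%:E| <= J)%E.
    rewrite -(integral_derive_segment s0 dh ch').
    apply: le_trans (le_abse_integral _ _ _) _ => //.
      exact/measurable_EFinP/measurable_funTS.
    apply: ge0_subset_integral => //.
    by apply/measurable_EFinP; exact: measurableT_comp.
  rewrite JE lee_fin => /(le_trans (ler_norm _)); rewrite /d; lra.
have lb k : ((k.+1%:R * d)%:E <= \int[mu]_s (h s)%:E)%E.
  apply: (@le_trans _ _ (\int[mu]_(s in `[(- k.+1%:R)%R, 0%R]) d%:E)%E).
    rewrite integral_cst//= lebesgue_measure_itv/= lte_fin oppr_lt0 ltr0n/=.
    by rewrite -EFinD -EFinM lee_fin add0r opprK mulrC.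
  apply: (@le_trans _ _ (\int[mu]_(s in `[(- k.+1%:R)%R, 0%R]) (h s)%:E)%E).
    apply: ge0_le_integral => //.
    - by move=> s _; rewrite lee_fin ltW.
    - exact/measurable_EFinP/measurable_funTS.
    - by move=> s; rewrite /= in_itv/= => /andP[_ s0]; rewrite lee_fin hd.
  apply: ge0_subset_integral => //.
  + exact/measurable_EFinP.
  + by move=> s _; rewrite lee_fin.
set H := (\int[mu]_s (h s)%:E)%E in hy lb.
have H0 : (0 <= H)%E by apply: integral_ge0 => s _; rewrite lee_fin.
have HE : H = (fine H)%:E by rewrite fineK// ge0_fin_numE.
have := lb (Num.Def.truncn (fine H / d)).
rewrite HE lee_fin leNgt -ltr_pdivrMr//.
by rewrite truncnS_gt.
Qed.

End line_estimates.

Section mollified_derivative.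
Context {R : realType} {N : nat}.
Local Notation leb := (@lebesgue_rV R N).
Local Notation mu := (@lebesgue_measure R).
Implicit Types (u v w g : 'rV[R]_N -> R) (x y z : 'rV[R]_N) (n m : nat) (i j : 'I_N).

Lemma L2_moll n u : L2 leb u -> L2 leb (moll n u).
Proof.
move=> [mu_ uy]; split; first exact: measurable_moll.
rewrite -integral_powR2; apply: le_lt_trans (integral_moll_le n _ mu_) _.
  by rewrite ltr1n.
by rewrite integral_powR2.
Qed.

Lemma moll_sqr_le n u x : measurable_fun setT u ->
  ((moll n u x ^+ 2)%:E <= \int[leb]_y (rho n (y - x) * u y ^+ 2)%:E)%E.
Proof.
move=> mu_.
have := @jensen_powR _ _ _ leb (rho n) (fun z => u (x + z)) 2 _ (measurable_rho n)
  (measurable_shift x mu_) (@rho_ge0 _ _ n) (integral_rho n).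
rewrite ltr1n -/(moll n u x) => /(_ erefl).
rewrite powR_mulrn// real_normK ?num_real// => /le_trans; apply.
rewrite -[leRHS](ge0_integral_shift x); last 2 first.
- apply/measurable_EFinP/measurable_funM; last exact: measurable_funX.
  exact: (measurable_kernel x (@kernel_eta R N n)).
- by move=> y; rewrite lee_fin mulr_ge0 ?rho_ge0 ?sqr_ge0.
rewrite le_eqVlt; apply/orP; left; apply/eqP.
apply: eq_integral => z _; rewrite addrK [x + z]addrC.
by rewrite powR_mulrn// real_normK ?num_real.
Qed.

(** The bound depends on [n] and is therefore used only for integrability and finiteness, never in
    the limiting estimates. *)
Lemma moll_bounded n u : L2 leb u -> exists2 B : R, 0 <= B & forall x, `|moll n u x| <= B.
Proof.
move=> uL; have mu_ := L2_measurable uL; have [_ uy] := uL.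
have [M M0 hM] := kernel_bounded (@kernel_eta R N n).
set J := (\int[leb]_x (u x ^+ 2)%:E)%E in uy.
have J0 : (0 <= J)%E by apply: integral_ge0 => s _; rewrite lee_fin sqr_ge0.
have JE : J = (fine J)%:E by rewrite fineK// ge0_fin_numE.
exists (Num.sqrt (M * fine J)) => [|x]; first exact: sqrtr_ge0.
rewrite -sqrtr_sqr; apply: ler_wsqrtr; rewrite -lee_fin.
apply: le_trans (moll_sqr_le n x mu_) _.
rewrite EFinM -JE -ge0_integralZl_EFin//.
- apply: ge0_le_integral => //.
  + by move=> y _; rewrite lee_fin mulr_ge0 ?rho_ge0 ?sqr_ge0.
  + apply/measurable_EFinP/measurable_funM; last exact: measurable_funX.
    exact: (measurable_kernel x (@kernel_eta R N n)).
  + apply: measurable_funeM; exact/measurable_EFinP/measurable_funX.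
  + move=> y _; rewrite -EFinM lee_fin ler_wpM2r ?sqr_ge0//.
    by rewrite (le_trans (ler_norm _))// hM.
- by move=> y _; rewrite lee_fin sqr_ge0.
- exact/measurable_EFinP/measurable_funX.
Qed.

(** True on every line, not only on almost every one: by Tonelli, a fixed [y] is seen by the kernel
    only for [s] in an interval of length 1, so that a multiple of the integral of u^2 dominates. *)
Lemma integral_moll_line_lty n i u x : L2 leb u ->
  (\int[mu]_s (moll n u (x + s *: basis_vec i) ^+ 2)%:E < +oo)%E.
Proof.
move=> uL; have mu_ := L2_measurable uL; have [_ uy] := uL.
have kh := @kernel_eta R N n.
have [M M0 hM] := kernel_bounded kh.
have mline : measurable_fun setT
    (fun p : measurableTypeR R * 'rV[R]_N => p.2 - (x + p.1 *: basis_vec i)).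
  apply: measurable_fun_coordP => j; under eq_fun do rewrite !mxE.
  apply: measurable_funB.
    exact: (measurableT_comp (measurable_coord j) measurable_snd).
  apply: measurable_funD => //; apply: measurable_funM => //; exact: measurable_fst.
have mF : measurable_fun setT (fun p : measurableTypeR R * 'rV[R]_N =>
    (rho n (p.2 - (x + p.1 *: basis_vec i)) * u p.2 ^+ 2)%:E).
  apply/measurable_EFinP/measurable_funM.
    exact: (measurableT_comp (measurable_rho n) mline).
  apply: measurable_funX; exact: (measurableT_comp mu_ measurable_snd).
have F0 s y : (0 <= (rho n (y - (x + s *: basis_vec i)) * u y ^+ 2)%:E)%E.
  by rewrite lee_fin mulr_ge0 ?rho_ge0 ?sqr_ge0.
have ml : measurable_fun setT (fun s : measurableTypeR R => moll n u (x + s *: basis_vec i)).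
  by apply: (measurableT_comp (measurable_moll n mu_)); exact: measurable_line1.
apply: (@le_lt_trans _ _ (\int[mu]_s \int[leb]_y (rho n (y - (x + s *: basis_vec i)) * u y ^+ 2)%:E)%E).
  apply: ge0_le_integral => //.
  - by move=> s _; rewrite lee_fin sqr_ge0.
  - exact/measurable_EFinP/measurable_funX.
  - by apply: (measurable_fun_fubini_tonelli_F _ mF) => -[].
  - by move=> s _; exact: moll_sqr_le.
rewrite tonelli//.
apply: (@le_lt_trans _ _ (\int[leb]_y (M%:E * (u y ^+ 2)%:E))%E).
  apply: ge0_le_integral => //.
  - by move=> y _; exact: integral_ge0.
  - by apply: (measurable_fun_fubini_tonelli_G _ mF) => -[].
  - apply: measurable_funeM; exact/measurable_EFinP/measurable_funX.
  move=> y _.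
  apply: (@le_trans _ _
    (\int[mu]_(s in `[(y ord0 i - x ord0 i)%R, (y ord0 i - x ord0 i + 1)%R]) (M * u y ^+ 2)%:E)%E).
    rewrite [leRHS]integral_mkcond; apply: ge0_le_integral => //.
    - have mp : measurable_fun setT (fun s : measurableTypeR R => (s, y)).
        exact: measurable_fun_pair.
      exact: (measurableT_comp mF mp).
    - by apply/(measurable_restrictT _ _).1.
    move=> s _; rewrite patchE; case: ifPn => [_|].
      by rewrite lee_fin ler_wpM2r ?sqr_ge0// (le_trans (ler_norm _))// hM.
    rewrite notin_setE/= in_itv/= => ns; rewrite lee_fin.
    have [->|/tensor_neq0 hn] := eqVneq (rho n (y - (x + s *: basis_vec i))) 0.
      by rewrite mul0r.
    exfalso; apply: ns; have := kh.2 i _ (hn i); rewrite !mxE eqxx/= eqxx mulr1.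
    by move=> /andP[h1 h2]; apply/andP; split; lra.
  rewrite integral_cst//= lebesgue_measure_itv/= lte_fin ltrDl ltr01.
  rewrite -EFinB -EFinM lee_fin (_ : _ - (_ - _) = 1); last by ring.
  by rewrite mulr1.
rewrite ge0_integralZl_EFin//.
- by rewrite lte_mul_pinfty// lee_fin.
- by move=> y _; rewrite lee_fin sqr_ge0.
- exact/measurable_EFinP/measurable_funX.
Qed.

End mollified_derivative.

(** * Power integrals along weak directional derivatives *)
Section power_energy.
Context {R : realType} {N : nat}.
Local Notation leb := (@lebesgue_rV R N).
Local Notation mu := (@lebesgue_measure R).
Implicit Types (u v w : 'rV[R]_N -> R) (x y z : 'rV[R]_N) (n m : nat) (i j : 'I_N).

(* Translation invariance: integrate [H (x + e_i) - H x], the integral of [h]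
   along a unit segment, over all [x]. *)
Lemma integral_line_derivative0 i (H h : 'rV[R]_N -> R) :
  leb.-integrable setT (EFin \o H) -> leb.-integrable setT (EFin \o h) ->
  (forall x (s : R), is_derive s 1 (fun s => H (x + s *: basis_vec i)) (h (x + s *: basis_vec i))) ->
  (forall x, continuous (fun s : R => h (x + s *: basis_vec i))) ->
  (\int[leb]_x (h x)%:E = 0)%E.
Proof.
move=> iH ih dH ch.
have mh : measurable_fun setT h by apply/measurable_EFinP; case/integrableP: ih.
pose F (p : 'rV[R]_N * measurableTypeR R) : \bar R :=
  (h (p.1 + p.2 *: basis_vec i) * \1_(`[0%R, 1%R]%classic : set R) p.2)%:E.
have m01 : measurable_fun setT (\1_(`[0%R, 1%R]%classic : set R) : measurableTypeR R -> R).
  by apply: measurable_indic; exact: measurable_itv.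
have int01 : (\int[mu]_s (\1_(`[0%R, 1%R]%classic : set R) s)%:E = 1)%E.
  rewrite integral_indic// setIT; have := @lebesgue_measure_itv R `[0, 1].
  by rewrite /= lte_fin ltr01 -EFinB subr0.
have mF : measurable_fun setT F.
  apply/measurable_EFinP/measurable_funM.
    exact: (measurableT_comp mh (measurable_line i)).
  exact: (measurableT_comp m01 measurable_snd).
have shift_int (s : R) : (\int[leb]_x (h (x + s *: basis_vec i))%:E = \int[leb]_x (h x)%:E)%E.
  by apply: (integral_shift (s *: basis_vec i) (f := EFin \o h)); exact/measurable_EFinP.
have shift_abs (s : R) : (\int[leb]_x `|(h (x + s *: basis_vec i))%:E| = \int[leb]_x `|(h x)%:E|)%E.
  apply: (ge0_integral_shift (s *: basis_vec i) (f := fun x => `|(h x)%:E|%E)) => //.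
  by apply: measurableT_comp => //; exact/measurable_EFinP.
have iF : (leb \x mu)%E.-integrable setT F.
  apply/integrable21ltyP => //.
  rewrite (eq_integral (fun s : measurableTypeR R =>
      (\int[leb]_x `|(h x)%:E|) * (\1_(`[0%R, 1%R]%classic : set R) s)%:E)%E); last first.
    move=> s _; rewrite -(shift_abs s) -ge0_integralZr//; last first.
      apply: measurableT_comp => //; apply/measurable_EFinP.
      by apply: (measurableT_comp mh); exact: measurable_fun_addrV.
    apply: eq_integral => x _; rewrite /F /= normrM EFinM; congr (_ * _%:E)%E.
    by rewrite ger0_norm.
  rewrite ge0_integralZl//; last 2 first.
  - exact/measurable_EFinP.
  - exact: integral_ge0.
  case/integrableP: ih => _ ihy.
  by rewrite [X in (_ * X)%E]int01 mule1.
have inner x : (\int[mu]_s F (x, s) = (H (x + basis_vec i) - H x)%:E)%E.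
  rewrite (eq_integral (fun s : measurableTypeR R =>
      (((fun s => h (x + s *: basis_vec i)) \_ `[0%R, 1%R]) s)%:E)); last first.
    by move=> s _; rewrite /F /= patchE indicE; case: (_ \in _); rewrite ?mulr1 ?mulr0.
  have := integral_derive_segment ltr01 (dH x) (ch x).
  rewrite scale1r scale0r addr0 => <-.
  by rewrite [RHS]integral_mkcond; apply: eq_integral => s _; rewrite restrict_EFin.
have outer s : (\int[leb]_x F (x, s) =
    (\int[leb]_x (h x)%:E) * (\1_(`[0%R, 1%R]%classic : set R) s)%:E)%E.
  rewrite -(shift_int s) -integralZr//.
  exact: (integrable_shift (s *: basis_vec i) ih).
have := Fubini iF.
under eq_integral do rewrite inner.
under [X in _ = X -> _]eq_integral do rewrite outer.
under eq_integral do rewrite EFinB.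
rewrite integralB//; last exact: (integrable_shift (basis_vec i) iH).
rewrite (integral_shift (basis_vec i) (f := EFin \o H)); last by case/integrableP: iH.
rewrite subee; last exact: integrable_fin_num.
have hf : (\int[leb]_x (h x)%:E)%E \is a fin_num by exact: (integrable_fin_num measurableT ih).
rewrite -(fineK hf) integralZl//; last first.
  apply/integrableP; split; first exact/measurable_EFinP.
  under eq_integral do rewrite gee0_abs ?lee_fin//.
  by rewrite [X in (X < _)%E]int01 ltry.
by rewrite [X in (_ * X)%E]int01 mule1.
Qed.

Lemma integrable_le (f g : 'rV[R]_N -> R) : measurable_fun setT f ->
  leb.-integrable setT (EFin \o g) -> (forall x, `|f x| <= g x) ->
  leb.-integrable setT (EFin \o f).
Proof.
move=> mf ig fg; apply: le_integrable ig => //; first exact/measurable_EFinP.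
by move=> x _; rewrite lee_fin (le_trans (fg x))// ler_norm.
Qed.

Lemma measurable_abs_powR (q : R) u : measurable_fun setT u ->
  measurable_fun setT (fun x => `|u x| `^ q).
Proof.
move=> mu_; apply: (measurableT_comp (measurable_powR q)).
exact: measurableT_comp.
Qed.

Lemma abs_powR_split (q t : R) : 2 <= q -> `|t| `^ q = `|t| `^ (q - 2) * t ^+ 2.
Proof.
move=> q2; have [->|t0] := eqVneq t 0.
  by rewrite expr0n mulr0 normr0 powR0// gt_eqF//; lra.
rewrite -[t ^+ 2]real_normK ?num_real// -powR_mulrn// -powRD; last by rewrite normr_eq0 t0 implybT.
by congr (_ `^ _); ring.
Qed.

Lemma integrable_abs_powR (q B : R) u : 2 <= q -> L2 leb u -> (forall x, `|u x| <= B) ->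
  leb.-integrable setT (EFin \o (fun x => `|u x| `^ q)).
Proof.
move=> q2 uL uB; have mu_ := L2_measurable uL.
apply: (integrable_le (g := fun x => B `^ (q - 2) * u x ^+ 2)).
- exact: measurable_abs_powR.
- have := integrableZl measurableT (B `^ (q - 2)) (L2_integrable_sqr uL).
  by apply: eq_integrable => // x _; rewrite EFinM.
- move=> x; rewrite ger0_norm ?powR_ge0// abs_powR_split// ler_wpM2r ?sqr_ge0//.
  by apply: ge0_ler_powR; rewrite ?nnegrE ?subr_ge0// (le_trans _ (uB x)).
Qed.

Lemma integrable_abs_powRM (q B : R) u v : 2 <= q -> L2 leb u -> L2 leb v ->
  (forall x, `|u x| <= B) ->
  leb.-integrable setT (EFin \o (fun x => `|u x| `^ (q - 2) * u x * v x)).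
Proof.
move=> q2 uL vL uB.
have mu_ := L2_measurable uL; have mv := L2_measurable vL.
apply: (integrable_le (g := fun x => B `^ (q - 2) * `|u x * v x|)).
- by apply: measurable_funM => //; apply: measurable_funM => //; exact: measurable_abs_powR.
- have := integrableZl measurableT (B `^ (q - 2)) (integrable_norm (L2_integrableM uL vL)).
  by apply: eq_integrable => // x _; rewrite EFinM.
- move=> x; rewrite -mulrA normrM ger0_norm ?powR_ge0// ler_wpM2r//.
  by apply: ge0_ler_powR; rewrite ?nnegrE ?subr_ge0// (le_trans _ (uB x)).
Qed.

(** The integrand is 1/q times the derivative of |moll n u|^q along e_i, whose integral is 0 by
    translation invariance. For q >= 2, boundedness of [moll n u] reduces integrability to L^2. *)
Lemma moll_power_orthogonal n i (q : R) u g : 2 <= q -> L2 leb u -> L2 leb g ->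
  is_weak_partial i u g ->
  \int[leb]_x (`|moll n u x| `^ (q - 2) * moll n u x * moll n g x) = 0.
Proof.
move=> q2 uL gL ug; have q1 : 1 < q by lra.
have [B B0 uB] := moll_bounded n uL.
have MuL := L2_moll n uL; have MgL := L2_moll n gL.
pose k x := `|moll n u x| `^ (q - 2) * moll n u x * moll n g x.
have ik : leb.-integrable setT (EFin \o k) by exact: (integrable_abs_powRM (B := B)).
suff : (\int[leb]_x ((q * k x)%:E) = 0)%E.
  under eq_integral do rewrite EFinM.
  rewrite integralZl// /Rintegral => /eqP; rewrite mule_eq0 eqe gt_eqF/=; last by lra.
  by move=> /eqP ->.
apply: (@integral_line_derivative0 i (fun x => `|moll n u x| `^ q)).
- exact: (integrable_abs_powR (B := B)).
- have := integrableZl measurableT q ik.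
  by apply: eq_integrable => // x _; rewrite /= EFinM.
- move=> x s.
  have := @is_derive1_comp R (fun t => `|t| `^ q) (fun s => moll n u (x + s *: basis_vec i)) s _ _
    (is_derive_abs_powR _ q1) (is_derive_moll_line n x s uL gL ug).
  by rewrite /k -!mulrA.
- move=> x s; have cu := @continuous_moll_line R N n i u x uL s.
  have cg := @continuous_moll_line R N n i g x gL s.
  apply: cvgM; first exact: cvg_cst.
  apply: cvgM => //; apply: cvgM => //.
  apply: (@cvg_comp _ _ _ (fun s => moll n u (x + s *: basis_vec i))
    (fun t => `|t| `^ (q - 2)) _ _ _ cu).
  by apply: continuous_abs_powR; lra.
Qed.

(** Convexity of |.|^q on the line: [young_powR] at |a| and |a + t b|, after bounding the product of
    |a|^(q-2) a and a + t b by absolute values. *)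
Lemma powR_tangent (a b t q : R) : 2 <= q ->
  `|a| `^ q + q * t * (`|a| `^ (q - 2) * a * b) <= `|a + t * b| `^ q.
Proof.
move=> q2; have q1 : 1 < q by lra.
have h1 := young_powR (normr_ge0 a) (normr_ge0 (a + t * b)) q1.
have h2 : `|a| `^ (q - 2) * a * (a + t * b) <= `|a| `^ (q - 1) * `|a + t * b|.
  have [->|a0] := eqVneq a 0; first by rewrite mulr0 mul0r mulr_ge0// powR_ge0.
  rewrite powR_sub1 ?normr_gt0// -!mulrA ler_wpM2l ?powR_ge0//.
  by rewrite -normrM ler_norm.
have h3 : `|a| `^ (q - 2) * a * (a + t * b) = `|a| `^ q + t * (`|a| `^ (q - 2) * a * b).
  by rewrite (abs_powR_split _ q2); ring.
rewrite h3 in h2.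
have h4 := ler_wpM2l (_ : 0 <= q) h2.
have := h4 ltac:(lra); lra.
Qed.

(** Only the left side passes to the limit. On the right, [integral_moll_le] compares the
    mollification of [u + t * phi] with the function itself for each [n], so that neither integral
    has to be finite. *)
Lemma power_energy_min (q t : R) (nu : 'I_N -> R) u (g : 'I_N -> 'rV[R]_N -> R) : 2 <= q ->
  L2 leb u -> (forall i, L2 leb (g i)) -> (forall i, is_weak_partial i u (g i)) ->
  (\int[leb]_x (`|u x| `^ q)%:E <=
   \int[leb]_x (`|u x + t * \sum_i nu i * g i x| `^ q)%:E)%E.
Proof.
move=> q2 uL gL ug; have q1 : 1 < q by lra.
pose phi x := \sum_i nu i * g i x.
have phiL : L2 leb phi by apply: L2_sum => i; exact: L2Z.
have wL : L2 leb (fun x => u x + t * phi x) by apply: L2D => //; exact: L2Z.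
apply: moll_fatou => // n.
apply: le_trans (integral_moll_le n q1 (L2_measurable wL)).
have [B B0 uB] := moll_bounded n uL.
have [C C0 wC] := moll_bounded n wL.
have MuL := L2_moll n uL.
have Mphi x : moll n phi x = \sum_i nu i * moll n (g i) x.
  rewrite /phi; elim: (index_enum _) => [|i s IH].
    rewrite big_nil; under [LHS]eq_Rintegral do rewrite big_nil mulr0.
    by rewrite /Rintegral integral0.
  rewrite big_cons -IH -mollZ//.
  rewrite -mollD; [|exact: L2Z|by apply: L2_sum => j; exact: L2Z].
  by congr (moll n _ x); apply/funext => y; rewrite big_cons.
pose k i x := `|moll n u x| `^ (q - 2) * moll n u x * moll n (g i) x.
have ik i : leb.-integrable setT (EFin \o k i).
  by apply: (integrable_abs_powRM (B := B)) => //; exact: L2_moll.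
have k0 i : (\int[leb]_x (k i x)%:E = 0)%E.
  have := moll_power_orthogonal n q2 uL (gL i) (ug i).
  rewrite /Rintegral -/(k i) => h.
  by rewrite -[LHS]fineK ?h//; exact: (integrable_fin_num measurableT (ik i)).
have iu := integrable_abs_powR q2 MuL uB.
have iw := integrable_abs_powR q2 (L2_moll n wL) wC.
have isum : leb.-integrable setT (fun x => \sum_i (q * t * nu i)%:E * (k i x)%:E)%E.
  by apply: integrable_sum => // i _; apply: integrableZl => //; exact: ik.
apply: (@le_trans _ _ (\int[leb]_x ((`|moll n u x| `^ q)%:E + \sum_i (q * t * nu i)%:E * (k i x)%:E))%E).
  rewrite integralD// integral_sum//; last first.
    by move=> i; apply: integrableZl => //; exact: ik.
  rewrite big1 ?adde0// => i _.
  by rewrite integralZl ?k0 ?mule0//; exact: ik.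
apply: le_integral => //; first exact: integrableD.
move=> x _; under eq_bigr do rewrite -EFinM.
rewrite sumEFin -EFinD lee_fin.
rewrite mollD//; last exact: L2Z.
rewrite mollZ// Mphi.
apply: le_trans (powR_tangent (moll n u x) (\sum_i nu i * moll n (g i) x) t q2).
rewrite lerD2l le_eqVlt; apply/orP; left; apply/eqP.
rewrite !mulr_sumr; apply: eq_bigr => i _; rewrite /k; ring.
Qed.

End power_energy.

(** * Sobolev embedding *)
Section gagliardo_nirenberg.
Context {R : realType} {N' : nat}.
Local Notation N := N'.+1.
Local Notation leb := (@lebesgue_rV R N).
Local Notation mu := (@lebesgue_measure R).
Implicit Types (u v w : 'rV[R]_N -> R) (x y z : 'rV[R]_N) (n m : nat) (i j : 'I_N).

Lemma powR_sub2 (t q : R) : q != 1 -> `|t| `^ (q - 2) * `|t| = `|t| `^ (q - 1).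
Proof.
move=> q1; have [->|t0] := eqVneq t 0.
  by rewrite normr0 mulr0 powR0// subr_eq0.
by rewrite [RHS]powR_sub1// normr_gt0.
Qed.

(** [le_integral_norm_derive] applied to |moll n u|^c on the line through [x]. With c >= 2 this
    power is at most a constant times (moll n u)^2, hence integrable on the line. *)
Lemma moll_powR_le_line_int n i u g (c : R) x : 2 <= c -> L2 leb u -> L2 leb g ->
  is_weak_partial i u g ->
  ((`|moll n u x| `^ c)%:E <=
   line_int i (fun y => (c * (`|moll n u y| `^ (c - 1) * `|moll n g y|))%:E) x)%E.
Proof.
move=> c2 uL gL ug; have c1 : 1 < c by lra.
have [B B0 uB] := moll_bounded n uL.
have mMu : measurable_fun setT (moll n u) by exact: measurable_moll (L2_measurable uL).
pose h (s : R) := `|moll n u (x + s *: basis_vec i)| `^ c.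
pose h' (s : R) := c * (`|moll n u (x + s *: basis_vec i)| `^ (c - 2) *
  moll n u (x + s *: basis_vec i)) * moll n g (x + s *: basis_vec i).
have -> : moll n u x = moll n u (x + 0 *: basis_vec i) by rewrite scale0r addr0.
have dh (s : R) : is_derive s 1 h (h' s).
  exact: (@is_derive1_comp R (fun t => `|t| `^ c) (fun s => moll n u (x + s *: basis_vec i)) s _ _
    (is_derive_abs_powR _ c1) (is_derive_moll_line n x s uL gL ug)).
have ch' : continuous h'.
  move=> s; have cu := @continuous_moll_line R N n i u x uL s.
  have cg := @continuous_moll_line R N n i g x gL s.
  apply: cvgM => //; apply: cvgM; first exact: cvg_cst.
  apply: cvgM => //.
  apply: (@cvg_comp _ _ _ (fun s => moll n u (x + s *: basis_vec i))
    (fun t => `|t| `^ (c - 2)) _ _ _ cu).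
  by apply: continuous_abs_powR; lra.
have ml : measurable_fun setT (fun s : measurableTypeR R => moll n u (x + s *: basis_vec i)).
  exact: (measurableT_comp mMu (measurable_line1 i x)).
have hy : (\int[mu]_s (h s)%:E < +oo)%E.
  apply: (@le_lt_trans _ _ (\int[mu]_s
    ((B `^ (c - 2))%:E * (moll n u (x + s *: basis_vec i) ^+ 2)%:E))%E).
    apply: ge0_le_integral => //.
    - by move=> s _; rewrite lee_fin powR_ge0.
    - apply/measurable_EFinP; apply: (measurableT_comp (measurable_powR c)).
      exact: measurableT_comp.
    - by apply: measurable_funeM; exact/measurable_EFinP/measurable_funX.
    - move=> s _; rewrite -EFinM lee_fin /h abs_powR_split// ler_wpM2r ?sqr_ge0//.
      by apply: ge0_ler_powR; rewrite ?nnegrE ?subr_ge0// (le_trans _ (uB x)).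
  rewrite ge0_integralZl_EFin ?powR_ge0//.
  - by rewrite lte_mul_pinfty ?lee_fin ?powR_ge0// integral_moll_line_lty.
  - by move=> s _; rewrite lee_fin sqr_ge0.
  - exact/measurable_EFinP/measurable_funX.
apply: le_trans (le_integral_norm_derive (fun s => powR_ge0 _ _) dh ch' hy) _.
rewrite le_eqVlt; apply/orP; left; apply/eqP.
apply: eq_integral => s _; congr (_%:E).
rewrite /h' !normrM (ger0_norm (powR_ge0 _ _)) (ger0_norm (_ : 0 <= c)); last by lra.
by rewrite powR_sub2 ?mulrA// gt_eqF.
Qed.

Lemma hoelder2_integral (f g : 'rV[R]_N -> \bar R) :
  measurable_fun setT f -> measurable_fun setT g ->
  (forall x, 0 <= f x)%E -> (forall x, 0 <= g x)%E ->
  (\int[leb]_x (f x `^ 2^-1 * g x `^ 2^-1) <=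
   (\int[leb]_x f x) `^ 2^-1 * (\int[leb]_x g x) `^ 2^-1)%E.
Proof.
move=> mf mg f0 g0.
pose F (k : 'I_2) := if k == ord0 then f else g.
have mF (k : 'I_2) : measurable_fun setT (F k) by rewrite /F; case: ifP.
have F0 (k : 'I_2) x : (0 <= F k x)%E by rewrite /F; case: ifP.
have := hoelder_prod leb mF F0.
rewrite big_ord_recl big_ord1 /=.
by under eq_integral do rewrite big_ord_recl big_ord1 /=.
Qed.

Variables (u : 'rV[R]_N -> R) (g : 'I_N -> 'rV[R]_N -> R).
Hypothesis uL : L2 leb u.
Hypothesis gL : forall i, L2 leb (g i).
Hypothesis ug : forall i, is_weak_partial i u (g i).

Let X n (q : R) := fine (\int[leb]_x (`|moll n u x| `^ q)%:E)%E.

Let XE n (q : R) : 2 <= q -> (\int[leb]_x (`|moll n u x| `^ q)%:E = (X n q)%:E)%E.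
Proof.
move=> q2; have [B B0 uB] := moll_bounded n uL.
rewrite /X fineK//; apply: (integrable_fin_num measurableT).
exact: (integrable_abs_powR q2 (L2_moll n uL) uB).
Qed.

Let X0 n q : 0 <= X n q.
Proof. by apply/fine_ge0/integral_ge0 => x _; rewrite lee_fin powR_ge0. Qed.

(** One constant for all mollified partial derivatives and all [n], by contraction in L^2. *)
Let S := 1 + \sum_i fine (\int[leb]_x (g i x ^+ 2)%:E)%E.

Let S0 : 0 <= S.
Proof.
rewrite addr_ge0// sumr_ge0// => i _.
by apply/fine_ge0/integral_ge0 => x _; rewrite lee_fin sqr_ge0.
Qed.

Let integral_moll_gradient_le n i : (\int[leb]_x (moll n (g i) x ^+ 2)%:E <= S%:E)%E.
Proof.
have [mg gy] := gL i.
rewrite -integral_powR2; apply: le_trans (integral_moll_le n _ mg) _; first by rewrite ltr1n.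
rewrite integral_powR2.
have p0 k : (0 <= \int[leb]_x (g k x ^+ 2)%:E)%E.
  by apply: integral_ge0 => x _; rewrite lee_fin sqr_ge0.
rewrite -[leLHS]fineK ?ge0_fin_numE// lee_fin /S (bigD1 i)//= addrCA lerDl.
by rewrite addr_ge0// sumr_ge0// => k _; exact: fine_ge0.
Qed.

Let slope n (c : R) i y := (c * (`|moll n u y| `^ (c - 1) * `|moll n (g i) y|))%:E.

Let slope_ge0 n (c : R) i y : 2 <= c -> (0 <= slope n c i y)%E.
Proof. by move=> c2; rewrite lee_fin mulr_ge0 ?mulr_ge0 ?powR_ge0//; lra. Qed.

Let measurable_slope n (c : R) i : measurable_fun setT (slope n c i).
Proof.
have mMu : measurable_fun setT (moll n u) by exact: measurable_moll (L2_measurable uL).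
have mMg : measurable_fun setT (moll n (g i)) by exact: measurable_moll (L2_measurable (gL i)).
apply/measurable_EFinP; apply: measurable_funM => //; apply: measurable_funM.
  exact: measurable_abs_powR.
exact: measurableT_comp.
Qed.

(** Cauchy-Schwarz separates the function from its derivative; squaring |moll n u|^(c-1) gives the
    exponent 2c - 2. *)
Let integral_slope_le n (c : R) i : 2 <= c ->
  (\int[leb]_y slope n c i y <= (c * (X n (2 * c - 2) * S) `^ 2^-1)%:E)%E.
Proof.
move=> c2.
have mMu : measurable_fun setT (moll n u) by exact: measurable_moll (L2_measurable uL).
have mMg : measurable_fun setT (moll n (g i)) by exact: measurable_moll (L2_measurable (gL i)).
have mU : measurable_fun setT (fun y => (`|moll n u y| `^ (2 * c - 2))%:E).
  by apply/measurable_EFinP; exact: measurable_abs_powR.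
have mG : measurable_fun setT (fun y => (moll n (g i) y ^+ 2)%:E).
  by apply/measurable_EFinP; exact: measurable_funX.
rewrite /slope; under eq_integral do rewrite EFinM.
rewrite ge0_integralZl_EFin//; last 2 first.
- apply/measurable_EFinP; apply: measurable_funM; first exact: measurable_abs_powR.
  exact: measurableT_comp.
- lra.
rewrite EFinM; apply: lee_wpmul2l; first by rewrite lee_fin; lra.
rewrite (eq_integral (fun y => (`|moll n u y| `^ (2 * c - 2))%:E `^ 2^-1 *
    (moll n (g i) y ^+ 2)%:E `^ 2^-1)%E); last first.
  move=> y _; rewrite !poweR_EFin -EFinM; congr ((_ * _)%:E).
    by rewrite -powRrM; congr (_ `^ _); field.
  by rewrite powR12_sqrt ?sqr_ge0// sqrtr_sqr.
apply: le_trans (hoelder2_integral mU mG _ _) _.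
- by move=> y; rewrite lee_fin powR_ge0.
- by move=> y; rewrite lee_fin sqr_ge0.
rewrite XE; last by lra.
rewrite powRM ?X0// EFinM poweR_EFin; apply: lee_wpmul2l; first by rewrite lee_fin powR_ge0.
have grad_le := integral_moll_gradient_le n i.
rewrite -poweR_EFin; apply: gt0_ler_poweR => //.
- by rewrite in_itv/= leey integral_ge0// => y _; rewrite lee_fin sqr_ge0.
- by rewrite in_itv/= leey lee_fin S0.
Qed.

(** |moll n u|^c is written as the product of [N] copies of its N-th root, each bounded by the line
    integral in its own direction, and [loomis_whitney] applies. *)
Let gns_weighted n (c : R) (w : 'rV[R]_N -> \bar R) : 2 <= c ->
  measurable_fun setT w -> (forall x, 0 <= w x)%E ->
  (\int[leb]_x (w x `^ N%:R^-1 * (`|moll n u x| `^ c)%:E) <=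
   (\int[leb]_x w x) `^ N%:R^-1 * (c * (X n (2 * c - 2) * S) `^ 2^-1)%:E)%E.
Proof.
move=> c2 mw w0.
have mMu : measurable_fun setT (moll n u) by exact: measurable_moll (L2_measurable uL).
set D := c * _.
have D0 : 0 <= D by rewrite mulr_ge0 ?powR_ge0//; lra.
have N0 : (0 < N%:R :> R) by rewrite ltr0n.
have prodE (a : \bar R) : (0 <= a)%E -> (\prod_(i < N) a `^ N%:R^-1 = a)%E.
  by move=> a0; rewrite prode_const_poweR ?invr_gt0// mulVf ?gt_eqF// poweRe1.
have prod_le (a b : 'I_N -> \bar R) : (forall i, 0 <= a i)%E -> (forall i, a i <= b i)%E ->
    (\prod_i a i `^ N%:R^-1 <= \prod_i b i `^ N%:R^-1)%E.
  move=> a0 ab; elim: (index_enum _) => [|i s IH]; first by rewrite !big_nil.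
  rewrite !big_cons; apply: lee_pmul => //.
  - exact: poweR_ge0.
  - by apply: prode_ge0 => k _; exact: poweR_ge0.
  - apply: gt0_ler_poweR => //; rewrite ?in_itv/= ?leey ?andbT//.
    exact: le_trans (a0 i) (ab i).
have mwp : measurable_fun setT (fun x => w x `^ N%:R^-1)%E.
  exact: (measurableT_comp (measurable_poweR _) mw).
apply: (@le_trans _ _ (\int[leb]_x (w x `^ N%:R^-1 *
   \prod_i (line_int i (slope n c i) x `^ N%:R^-1)))%E).
  apply: ge0_le_integral => //.
  - by move=> x _; rewrite mule_ge0 ?poweR_ge0// lee_fin powR_ge0.
  - apply: emeasurable_funM => //; apply/measurable_EFinP; exact: measurable_abs_powR.
  - apply: emeasurable_funM => //; apply: emeasurable_prod => i.
    apply: (measurableT_comp (measurable_poweR _)); apply: measurable_line_int => //.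
    by move=> x; exact: slope_ge0.
  - move=> x _; apply: lee_wpmul2l; first exact: poweR_ge0.
    rewrite -[leLHS]prodE ?lee_fin ?powR_ge0//.
    apply: (prod_le (fun=> (`|moll n u x| `^ c)%:E)) => i.
      by rewrite lee_fin powR_ge0.
    exact: moll_powR_le_line_int.
apply: le_trans (loomis_whitney mw w0 (measurable_slope n c) (fun i x => slope_ge0 n i x c2)) _.
apply: lee_wpmul2l; first exact: poweR_ge0.
rewrite -[leRHS]prodE ?lee_fin//.
apply: (prod_le (fun i => \int[leb]_x slope n c i x)%E) => i.
  by apply: integral_ge0 => x _; exact: slope_ge0.
exact: integral_slope_le.
Qed.

(* The condition on [c] makes the weight |u_n|^q reproduce the integrand. *)
Let gns n (c q : R) : 2 <= c -> 2 <= q -> q / N%:R + c = q ->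
  X n q <= X n q `^ N%:R^-1 * (c * (X n (2 * c - 2) * S) `^ 2^-1).
Proof.
move=> c2 q2 qc.
have mMu : measurable_fun setT (moll n u) by exact: measurable_moll (L2_measurable uL).
have mq : measurable_fun setT (fun x => (`|moll n u x| `^ q)%:E).
  by apply/measurable_EFinP; exact: measurable_abs_powR.
have := gns_weighted n c2 mq (fun x => powR_ge0 _ _).
rewrite XE// poweR_EFin -EFinM.
rewrite (eq_integral (fun x => (`|moll n u x| `^ q)%:E)) ?XE ?lee_fin//.
move=> x _; rewrite poweR_EFin -EFinM -powRrM; congr (_%:E).
have [->|t0] := eqVneq (moll n u x) 0.
  by rewrite normr0 !(@powR0 _ q) ?(@powR0 _ c) ?mulr0// gt_eqF//; lra.
by rewrite -powRD ?qc// normr_eq0 t0 implybT.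
Qed.

(** Absorbs a power of [Y] with exponent below 1 into the left side. [Y] is a norm known to be
    finite for each [n], and the resulting bound is independent of [n]. *)
Lemma powR_self_improve (Y a c : R) : 0 <= Y -> a < 1 -> 0 <= c -> Y <= Y `^ a * c ->
  Y <= c `^ (1 - a)^-1.
Proof.
rewrite le_eqVlt => /predU1P[<- *|Y0 a1 c0 h]; first exact: powR_ge0.
have a1' : 0 < 1 - a by rewrite subr_gt0.
have h' : Y `^ (1 - a) <= c.
  rewrite powRB; last by rewrite gt_eqF ?implybT.
  by rewrite powRr1 ?(ltW Y0)// ler_pdivrMr ?powR_gt0// mulrC.
have := ge0_ler_powR (_ : 0 <= (1 - a)^-1) (_ : Y `^ (1 - a) \in Num.nneg) (_ : c \in Num.nneg) h'.
rewrite invr_ge0 ltW// !nnegrE powR_ge0 => /(_ isT isT c0).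
by rewrite -powRrM mulfV ?gt_eqF// (powRr1 (ltW Y0)).
Qed.

Lemma sobolev_critical : (2 <= N')%N ->
  (\int[leb]_x (`|u x| `^ (2 * N%:R / (N%:R - 2)))%:E < +oo)%E.
Proof.
(* This [c] satisfies both q/N + c = q, as [gns] requires, and 2c - 2 = q, so that the same norm
   appears on both sides and can be absorbed: the exponents 1/N and 1/2 add up to less than 1. *)
move=> N3; set q := _ / _; pose c : R := 2 * (N%:R - 1) / (N%:R - 2).
have N3' : 3 <= N%:R :> R by rewrite ler_nat.
have c2 : 2 <= c by rewrite /c ler_pdivlMr; lra.
have q2 : 2 <= q by rewrite /q ler_pdivlMr; lra.
have qc : q / N%:R + c = q.
  rewrite /q /c; move: (N%:R : R) N3' => M M3; field.
  by rewrite !gt_eqF ?subr_gt0//; lra.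
have qE : 2 * c - 2 = q.
  rewrite /q /c; move: (N%:R : R) N3' => M M3; field.
  by rewrite gt_eqF ?subr_gt0//; lra.
pose C := c * S `^ 2^-1.
have C0 : 0 <= C by rewrite mulr_ge0 ?powR_ge0//; lra.
apply: (@le_lt_trans _ _ (C `^ (1 - (N%:R^-1 + 2^-1))^-1)%:E); last exact: ltry.
apply: moll_fatou => //; first by lra.
move=> n; rewrite XE// lee_fin; apply: powR_self_improve => //.
  have : N%:R^-1 <= 3^-1 :> R by rewrite lef_pV2 ?posrE; lra.
  by move: (N%:R^-1) => a; lra.
have := gns n c2 q2 qc; rewrite qE powRM//.
rewrite powRD; last first.
  by rewrite gt_eqF// addr_gt0// invr_gt0; lra.
by move=> /le_trans; apply; rewrite le_eqVlt; apply/orP; left; apply/eqP; rewrite /C; ring.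
Qed.

(** No exponent closes the estimate in dimension 2, so it climbs through the even exponents: with c
    = m + 2, the exponent 2c is controlled by 2c - 2 = 2(m+1), the previous one. *)
Lemma sobolev_dim2 m : N' = 1%N -> (\int[leb]_x (`|u x| `^ (2 * m.+1%:R))%:E < +oo)%E.
Proof.
move=> N2.
have [C hC] : exists C : R, forall n, X n (2 * m.+1%:R) <= C.
  elim: m => [|m [C hC]].
    exists (fine (\int[leb]_x (u x ^+ 2)%:E)%E) => n.
    have [mu_ uy] := uL.
    rewrite -lee_fin -XE ?mulr1// fineK; last first.
      by rewrite ge0_fin_numE//; apply: integral_ge0 => x _; rewrite lee_fin sqr_ge0.
    by rewrite -integral_powR2; apply: integral_moll_le => //; rewrite ltr1n.
  pose c : R := m.+2%:R.
  have c2 : 2 <= c by rewrite /c ler_nat.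
  exists ((c * (C * S) `^ 2^-1) `^ (1 - 2^-1)^-1) => n.
  have C0 : 0 <= C by apply: le_trans (hC n).
  apply: powR_self_improve => //.
  - lra.
  - by rewrite mulr_ge0 ?powR_ge0//; lra.
  have q2 : 2 <= 2 * c by lra.
  have NR : N%:R = 2 :> R by rewrite N2.
  have qc : 2 * c / N%:R + c = 2 * c by rewrite NR; field.
  have := gns n c2 q2 qc; rewrite NR => /le_trans; apply.
  apply: ler_wpM2l; first exact: powR_ge0.
  apply: ler_wpM2l; first exact: le_trans c2.
  apply: ge0_ler_powR; rewrite ?nnegrE ?mulr_ge0//.
  rewrite ler_wpM2r//; apply: le_trans (hC n).
  by rewrite /c -[m.+2%:R]natr1 mulrDr mulr1 addrK.
apply: (@le_lt_trans _ _ C%:E); last exact: ltry.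
apply: moll_fatou => //.
  rewrite (lt_le_trans (_ : 1 < 2))// ?ltr1n// ler_peMr// ler1n//.
by move=> n; rewrite XE ?lee_fin// ler_peMr// ler1n.
Qed.

End gagliardo_nirenberg.

Section sobolev_embedding.
Context {R : realType}.
Implicit Types (n m : nat).

(** In dimension 1 the line integral is the full integral: the line estimate with c = 2 bounds |moll
    n u|^2 by the integral of 2 |moll n u| |moll n g|, hence by the two L^2 norms squared. *)
Lemma sobolev_dim1 (u g : 'rV[R]_1 -> R) : L2 (lebesgue_rV 1) u ->
  L2 (lebesgue_rV 1) g -> is_weak_partial ord0 u g ->
  exists2 C : R, 0 <= C & {ae (lebesgue_rV 1), forall x, `|u x| <= C}.
Proof.
move=> uL gL ug.
pose K := (\int[lebesgue_rV 1]_x (u x ^+ 2)%:E + \int[lebesgue_rV 1]_x (g x ^+ 2)%:E)%E.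
have K0 : (0 <= K)%E by rewrite adde_ge0// integral_ge0// => x _; rewrite lee_fin sqr_ge0.
have Ky : (K < +oo)%E by rewrite lte_add_pinfty ?uL.2 ?gL.2.
have KE : ((fine K)%:E = K)%E by rewrite fineK// ge0_fin_numE.
have mu1 n : measurable_fun setT (moll n u) by exact: measurable_moll (L2_measurable uL).
have mg1 n : measurable_fun setT (moll n g) by exact: measurable_moll (L2_measurable gL).
(* t^2 <= K implies t <= K + 1, which spares the square root. *)
exists (fine K + 1); first by rewrite addr_ge0// fine_ge0.
apply: moll_bounded_ae => // n x.
suff : `|moll n u x| ^+ 2 <= fine K.
  have := normr_ge0 (moll n u x); move: `|_| (fine K) => t k t0 tk.
  by rewrite -ler_sqr ?nnegrE//; nra.
rewrite -powR_mulrn// -lee_fin KE.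
apply: le_trans (moll_powR_le_line_int n x (lexx 2) uL gL ug) _.
have ms : measurable_fun setT
    (fun y => (2 * (`|moll n u y| `^ (2 - 1) * `|moll n g y|))%:E).
  apply/measurable_EFinP; apply: measurable_funM => //; apply: measurable_funM.
    exact: measurable_abs_powR.
  exact: measurableT_comp.
have s0 y : (0 <= (2 * (`|moll n u y| `^ (2 - 1) * `|moll n g y|))%:E)%E.
  by rewrite lee_fin !mulr_ge0 ?powR_ge0.
rewrite line_int_dim1//.
apply: (@le_trans _ _ (\int[lebesgue_rV 1]_y ((moll n u y ^+ 2)%:E + (moll n g y ^+ 2)%:E))%E).
  apply: ge0_le_integral => //.
  - by apply: emeasurable_funD; exact/measurable_EFinP/measurable_funX.
  - move=> y _; rewrite -EFinD lee_fin (_ : 2 - 1 = 1 :> R); last by lra.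
    rewrite powRr1// -[moll n u y ^+ 2]real_normK ?num_real//.
    rewrite -[moll n g y ^+ 2]real_normK ?num_real//.
    by move: `|moll n u y| `|moll n g y| => a b; have := sqr_ge0 (a - b); lra.
rewrite ge0_integralD//; last 4 first.
- by move=> y _; rewrite lee_fin sqr_ge0.
- exact/measurable_EFinP/measurable_funX.
- by move=> y _; rewrite lee_fin sqr_ge0.
- exact/measurable_EFinP/measurable_funX.
apply: leeD; rewrite -2!integral_powR2; apply: integral_moll_le; rewrite ?ltr1n//.
  exact: L2_measurable uL.
exact: L2_measurable gL.
Qed.

Lemma integral_powR_between d (T : measurableType d) (mu : {measure set T -> \bar R})
    (q Q : R) (u : T -> R) : 2 <= q <= Q ->
  L2 mu u -> (\int[mu]_x (`|u x| `^ Q)%:E < +oo)%E ->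
  (\int[mu]_x (`|u x| `^ q)%:E < +oo)%E.
Proof.
move=> /andP[q2 qQ] [mu_ uy] Uy.
have mp (e : R) : measurable_fun setT (fun x => (`|u x| `^ e)%:E).
  apply/measurable_EFinP; apply: (measurableT_comp (measurable_powR e)).
  exact: measurableT_comp.
have m2 : measurable_fun setT (fun x => (u x ^+ 2)%:E).
  exact/measurable_EFinP/measurable_funX.
apply: (@le_lt_trans _ _ (\int[mu]_x ((u x ^+ 2)%:E + (`|u x| `^ Q)%:E))%E); last first.
  rewrite ge0_integralD//; first exact: lte_add_pinfty.
  by move=> y _; rewrite lee_fin sqr_ge0.
apply: ge0_le_integral => //.
- exact: emeasurable_funD.
move=> x _; rewrite -EFinD lee_fin.
have [u1|u1] := leP `|u x| 1.
  rewrite -real_normK ?num_real// -powR_mulrn//.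
  apply: (@le_trans _ _ (`|u x| `^ 2)); last by rewrite lerDl powR_ge0.
  have [->|u0] := eqVneq (u x) 0; first by rewrite normr0 !powR0// ?gt_eqF//; lra.
  by apply: ger_powR => //; rewrite normr_gt0 u0.
apply: (@le_trans _ _ (`|u x| `^ Q)); last by rewrite lerDr sqr_ge0.
by apply: ler_powR => //; exact: ltW.
Qed.

Lemma L2_bounded_powR d (T : measurableType d) (mu : {measure set T -> \bar R})
    (q C : R) (u : T -> R) : 2 <= q -> L2 mu u -> 0 <= C ->
  {ae mu, forall x, `|u x| <= C} -> (\int[mu]_x (`|u x| `^ q)%:E < +oo)%E.
Proof.
move=> q2 [mu_ uy] C0 uC.
have mp (e : R) : measurable_fun setT (fun x => (`|u x| `^ e)%:E).
  apply/measurable_EFinP; apply: (measurableT_comp (measurable_powR e)).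
  exact: measurableT_comp.
have m2 : measurable_fun setT (fun x => (u x ^+ 2)%:E).
  exact/measurable_EFinP/measurable_funX.
apply: (@le_lt_trans _ _ (\int[mu]_x ((C `^ (q - 2))%:E * (u x ^+ 2)%:E))%E); last first.
  rewrite ge0_integralZl_EFin ?powR_ge0//; last first.
    by move=> y _; rewrite lee_fin sqr_ge0.
  by rewrite lte_mul_pinfty ?lee_fin ?powR_ge0.
apply: ae_ge0_le_integral => //.
- by move=> y _; rewrite -EFinM lee_fin mulr_ge0 ?powR_ge0 ?sqr_ge0.
- exact: measurable_funeM.
apply: filterS uC => x uC _; rewrite -EFinM lee_fin abs_powR_split//.
apply: ler_wpM2r; first exact: sqr_ge0.
by apply: ge0_ler_powR; rewrite ?nnegrE ?subr_ge0.
Qed.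

End sobolev_embedding.

(** * Weak gradients of functions in H^1 *)

Section weak_gradient.
Context {R : realType} {N : nat}.
Local Notation leb := (@lebesgue_rV R N).
Implicit Types (u v w : 'rV[R]_N -> R) (x : 'rV[R]_N) (i j : 'I_N).
Implicit Types (g h : 'I_N -> 'rV[R]_N -> R).

Lemma L2_compact_support (f psi : 'rV[R]_N -> R) :
  continuous f -> compact (closure [set x | psi x != 0]) ->
  (forall x, f x != 0 -> closure [set x | psi x != 0] x) -> L2 leb f.
Proof.
move=> cf cK fK.
have [M [Mr KM]] := compact_bounded cK.
have : compact (f @` closure [set x | psi x != 0]).
  by apply: continuous_compact => //; apply: continuous_subspaceT.
move=> /compact_bounded[B [Br fB]].
apply: (@L2_bounded_box R N f (- (`|M| + 1)) (`|M| + 1) (`|B| + 1)).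
- exact: continuous_measurable_rV.
- move=> x; have [->|fx0] := eqVneq (f x) 0; first by rewrite normr0.
  apply: fB; last by exists x => //; exact: fK.
  by rewrite (le_lt_trans (ler_norm _))// ltrDl.
- move=> x i fx0.
  have : `|x| <= `|M| + 1 by apply: KM; [rewrite (le_lt_trans (ler_norm _))// ltrDl|exact: fK].
  move=> /(le_trans _) xM; rewrite -ler_norml; apply: xM.
  rewrite [leRHS]/Num.norm/= mx_normrE.
  by apply: (@le_bigmax _ _ _ _ (fun ij : 'I_1 * 'I_N => `|x ij.1 ij.2|) (ord0, i)).
Qed.

Lemma test_function_L2 psi : test_function psi -> L2 leb psi.
Proof.
move=> [sp cp]; apply: (@L2_compact_support _ psi) => //.
  by move=> x; apply: differentiable_continuous; exact: (sp [::] x).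
by move=> x px; apply: subset_closure.
Qed.

Lemma test_function_derive_L2 i psi : test_function psi -> L2 leb ('D_(basis_vec i) psi).
Proof.
move=> [sp cp]; apply: (@L2_compact_support _ psi) => //.
  by move=> x; apply: differentiable_continuous; exact: (sp [:: i] x).
move=> x; apply: contra_neqP => nx.
have opx : open (~` closure [set x | psi x != 0]) by apply: closed_openC; exact: closed_closure.
have : \forall y \near x, psi y = 0.
  near=> y; apply/eqP; apply: contrapT => py.
  have : (~` closure [set x | psi x != 0]) y by near: y; exact: open_nbhs_nbhs.
  by apply; apply: subset_closure => /=; apply/negP.
move=> px; rewrite (near_eq_derive (basis_vec i) (g := cst 0))//.
  by rewrite derive_cst.
Unshelve. all: by end_near. Qed.

(** The L^2 hypotheses make the products with the test function integrable; the real-valued integral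
    is not additive otherwise. *)
Lemma is_weak_partialD i u v a b : L2 leb u -> L2 leb v -> L2 leb a -> L2 leb b ->
  is_weak_partial i u a -> is_weak_partial i v b ->
  is_weak_partial i (fun x => u x + v x) (fun x => a x + b x).
Proof.
move=> uL vL aL bL ua vb psi tpsi.
have pL := test_function_L2 tpsi; have dL := test_function_derive_L2 i tpsi.
under eq_Rintegral do rewrite mulrDl.
under [in RHS]eq_Rintegral do rewrite mulrDl.
by rewrite !RintegralD// ?ua ?vb ?opprD//; exact: L2_integrableM.
Qed.

Lemma is_weak_partialZ i (c : R) u a : L2 leb u -> L2 leb a ->
  is_weak_partial i u a -> is_weak_partial i (fun x => c * u x) (fun x => c * a x).
Proof.
move=> uL aL ua psi tpsi.
have pL := test_function_L2 tpsi; have dL := test_function_derive_L2 i tpsi.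
under eq_Rintegral do rewrite -mulrA.
under [in RHS]eq_Rintegral do rewrite -mulrA.
by rewrite !RintegralZl// ?ua ?mulrN//; exact: L2_integrableM.
Qed.

Lemma is_weak_partial0 i : is_weak_partial i (fun _ : 'rV[R]_N => 0) (fun=> 0).
Proof.
move=> psi _; under eq_Rintegral do rewrite mul0r.
under [in RHS]eq_Rintegral do rewrite mul0r.
by rewrite /Rintegral integral0 /= oppr0.
Qed.

Lemma is_weak_partial_sum i (J : Type) (s : seq J) (c : J -> R)
    (f k : J -> 'rV[R]_N -> R) :
  (forall j : J, L2 leb (f j)) -> (forall j : J, L2 leb (k j)) ->
  (forall j : J, is_weak_partial i (f j) (k j)) ->
  is_weak_partial i (fun x => \sum_(j <- s) c j * f j x) (fun x => \sum_(j <- s) c j * k j x).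
Proof.
move=> fL kL fk; elim: s => [|j s IH].
  rewrite (_ : (fun x => _) = fun=> 0); last by apply/funext => x; rewrite big_nil.
  rewrite (_ : (fun x => \sum_(j <- [::]) c j * k j x) = fun=> 0)//; last first.
    by apply/funext => x; rewrite big_nil.
  exact: is_weak_partial0.
rewrite (_ : (fun x => _) = fun x => c j * f j x + \sum_(j <- s) c j * f j x); last first.
  by apply/funext => x; rewrite big_cons.
rewrite (_ : (fun x => \sum_(j <- j :: s) c j * k j x) =
    fun x => c j * k j x + \sum_(j <- s) c j * k j x); last first.
  by apply/funext => x; rewrite big_cons.
apply: is_weak_partialD => //.
- exact: L2Z.
- by apply: L2_sum => l; exact: L2Z.
- exact: L2Z.
- by apply: L2_sum => l; exact: L2Z.
- exact: is_weak_partialZ.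
Qed.

Lemma is_weak_partial_ae i u v a : L2 leb u -> L2 leb v ->
  {ae leb, forall x, u x = v x} -> is_weak_partial i u a -> is_weak_partial i v a.
Proof.
move=> uL vL uv ua psi tpsi; have dL := test_function_derive_L2 i tpsi.
rewrite -(ua psi tpsi) /Rintegral; congr fine; apply: ae_eq_integral => //.
- exact: measurable_int (L2_integrableM vL dL).
- exact: measurable_int (L2_integrableM uL dL).
by apply: filterS uv => x -> _.
Qed.

(** A relation, so that combinations have explicit gradients; [weak_partial] is a choice of
    representative, comparable with them only almost everywhere. *)
Definition weak_gradient u g := L2 leb u /\ forall i, L2 leb (g i) /\ is_weak_partial i u (g i).

Lemma sobolev1P u : sobolev 1 u <-> exists g, weak_gradient u g.
Proof.
split=> [[/Lfun_L2 uL ug]|[g [uL ug]]].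
  have /choice[g gP] : forall i, exists f : 'rV[R]_N -> R,
      L2 leb f /\ is_weak_partial i u f.
    by move=> i; have [f uf [/Lfun_L2 fL _]] := ug i; exists f.
  by exists g.
split; first exact/Lfun_L2.
by move=> i; have [gL gi] := ug i; exists (g i) => //; split => //; exact/Lfun_L2.
Qed.

Lemma weak_partialP u : sobolev 1 u -> weak_gradient u (fun i => weak_partial i u).
Proof.
move=> /sobolev1P[g [uL ug]]; split => // i; rewrite /weak_partial.
have [] := @xgetPex _ (cst 0) [set g | g \in Lfun leb 2%:E /\ is_weak_partial i u g].
  by have [gL gi] := ug i; exists (g i); split => //; exact/Lfun_L2.
by move=> /Lfun_L2.
Qed.

Lemma weak_gradientDZ (t : R) u v g h : weak_gradient u g -> weak_gradient v h ->
  weak_gradient (fun x => u x + t * v x) (fun i x => g i x + t * h i x).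
Proof.
move=> [uL ug] [vL vh]; split => [|i]; first by apply: L2D => //; exact: L2Z.
have [gL gi] := ug i; have [hL hi] := vh i; split; first by apply: L2D => //; exact: L2Z.
by apply: is_weak_partialD => //; [exact: L2Z|exact: L2Z|exact: is_weak_partialZ].
Qed.

Lemma weak_gradient_ae u g i : weak_gradient u g ->
  {ae leb, forall x, weak_partial i u x = g i x}.
Proof.
move=> ug; have [_ uw] : weak_gradient u (fun i => weak_partial i u).
  by apply: weak_partialP; apply/sobolev1P; exists g.
have [wL uw'] := uw i; have [gL ug'] := ug.2 i.
exact: weak_partial_unique wL gL uw' ug'.
Qed.

End weak_gradient.

(** * Sobolev exponents and integrability of the potential term *)

Section potential.
Context {R : realType}.

(** The source differs by dimension: an almost everywhere bound in 1, arbitrarily large even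
    exponents in 2, the critical exponent from 3 on. Lower exponents follow from |u|^q <= u^2 +
    |u|^Q for 2 <= q <= Q. *)
Lemma sobolev_embedding N' (u : 'rV[R]_N'.+1 -> R) g (q : R) : weak_gradient u g ->
  2 <= q -> ((2 <= N')%N -> q <= 2 * N'.+1%:R / (N'.+1%:R - 2)) ->
  (\int[lebesgue_rV N'.+1]_x (`|u x| `^ q)%:E < +oo)%E.
Proof.
move=> [uL ug] q2 qN.
have gL i := (ug i).1; have gi i := (ug i).2.
case: N' => [|[|N']] in u g uL ug gL gi qN *.
- have [C C0 uC] := sobolev_dim1 uL (gL ord0) (gi ord0).
  exact: L2_bounded_powR q2 uL C0 uC.
- have [m qm] : exists m : nat, q <= 2 * m.+1%:R.
    have q0 : 0 <= q by lra.
    have := truncnS_gt q; set m := Num.truncn q => qm; exists m.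
    by rewrite (le_trans (ltW qm))// ler_peMl// ler1n.
  by apply: (integral_powR_between _ uL (sobolev_dim2 uL gL gi m erefl)); rewrite q2 qm.
- by apply: (integral_powR_between _ uL (sobolev_critical uL gL gi isT)); rewrite q2 qN.
Qed.

(** For 1 < r < +oo, Young bounds |V| u^2 by |V|^r and |u|^(2s) with [s] conjugate to [r], and 2s <=
    2^* amounts to r >= N/2 when N >= 3. The value r = 1 is left only for N = 1, where [u] is
    bounded; for r = +oo, [V] is bounded. *)
Lemma potential_integrable_sqr N' (r : \bar R) (V u : 'rV[R]_N'.+1 -> R) g :
  (maxe 1 (N'.+1%:R / 2)%:E <= r)%E -> (N'.+1 = 2%N -> (1 < r)%E) ->
  V \in Lfun (lebesgue_rV N'.+1) r -> weak_gradient u g ->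
  (lebesgue_rV N'.+1).-integrable setT (fun x => (V x * u x ^+ 2)%:E).
Proof.
set leb := lebesgue_rV _ => rN r2 VL uH; have [uL ug] := uH.
have mu_ := L2_measurable uL.
have [mV Vy] : measurable_fun setT V /\ finite_norm leb r V.
  by move: VL; rewrite inE => /andP[/[!inE]].
have mVu : measurable_fun setT (fun x => V x * u x ^+ 2).
  by apply: measurable_funM => //; exact: measurable_funX.
have bounded (f h : 'rV[R]_N'.+1 -> R) (C : R) :
    measurable_fun setT h -> (\int[leb]_x (`|h x|)%:E < +oo)%E ->
    measurable_fun setT f -> {ae leb, forall x, `|f x| <= C} ->
    leb.-integrable setT (fun x => (f x * h x)%:E).
  move=> mh hy mf fC; apply/integrableP; split.
    by apply/measurable_EFinP; exact: measurable_funM.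
  apply: (@le_lt_trans _ _ (\int[leb]_x (`|C|%:E * `|h x|%:E))%E).
    apply: ae_ge0_le_integral => //.
    - by apply/measurable_EFinP; apply: measurableT_comp => //; exact: measurable_funM.
    - by apply: measurable_funeM; apply/measurable_EFinP; exact: measurableT_comp.
    apply: filterS fC => x fC _; rewrite -EFinM lee_fin normrM ler_wpM2r//.
    exact: le_trans fC (ler_norm _).
  rewrite ge0_integralZl_EFin//; first by rewrite lte_mul_pinfty.
  by apply/measurable_EFinP; exact: measurableT_comp.
have u2y : (\int[leb]_x (`|u x ^+ 2|)%:E < +oo)%E.
  by under eq_integral do rewrite ger0_norm ?sqr_ge0//; exact: uL.2.
case: r => [r||] in rN r2 Vy VL *; last by rewrite leeNy_eq in rN; move: rN; rewrite /maxe; case: ifP.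
- move: rN; rewrite ge_max !lee_fin => /andP[r1 rN].
  have r0 : 0 < r by lra.
  have Vr : (\int[leb]_x (`|V x| `^ r)%:E < +oo)%E.
    have := Vy; rewrite /finite_norm => /(poweR_lty r).
    by rewrite poweR_Lnorm ?gt_eqF.
  have [r1'|r1'] := eqVneq r 1.
    have N'0 : N' = 0%N.
      move: rN r2; rewrite r1' lte_fin ltxx; case: (N') => [|[|n]]//; first by move=> _ /(_ erefl).
      by rewrite ler_pdivrMr// mul1r ler_nat.
    subst N'; have [C C0 uC] := sobolev_dim1 uL (ug ord0).1 (ug ord0).2.
    have : leb.-integrable setT (fun x => (u x ^+ 2 * V x)%:E).
      apply: (bounded _ _ (C ^+ 2)) => //.
      + by move: Vr; rewrite r1'; under eq_integral do rewrite powRr1//.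
      + exact: measurable_funX.
      + by apply: filterS uC => x uC; rewrite normrX lerXn2r ?nnegrE.
    by under eq_fun do rewrite mulrC.
  have r1'' : 1 < r by rewrite lt_neqAle eq_sym r1'.
  pose s := r / (r - 1).
  have s2 : 2 <= 2 * s by rewrite ler_peMr// /s ler_pdivlMr; lra.
  have uy : (\int[leb]_x (`|u x| `^ (2 * s))%:E < +oo)%E.
    apply: (sobolev_embedding uH s2) => N2.
    have N3 : 3 <= N'.+1%:R :> R by rewrite ler_nat.
    rewrite /s; move: (N'.+1%:R : R) rN N3 => n rN n3.
    rewrite -mulrA ler_pM2l// ler_pdivrMr; last lra.
    by rewrite mulrAC ler_pdivlMr; nra.
  have iu : leb.-integrable setT (EFin \o (fun x => `|u x| `^ (2 * s))).
    apply/integrableP; split; first by apply/measurable_EFinP; exact: measurable_abs_powR.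
    by under eq_integral do rewrite /= ger0_norm ?powR_ge0//.
  have iV : leb.-integrable setT (EFin \o (fun x => `|V x| `^ r)).
    apply/integrableP; split; first by apply/measurable_EFinP; exact: measurable_abs_powR.
    by under eq_integral do rewrite /= ger0_norm ?powR_ge0//.
  apply: (@integrable_le _ _ _ (fun x => `|u x| `^ (2 * s) + `|V x| `^ r)) => //.
    by have := integrableD measurableT iu iV; apply: eq_integrable.
  (* The base |u|^(2/(r-1)) is chosen so that its power r - 1 is u^2 and its power r is |u|^(2s). *)
  move=> x; have := @young_powR R (`|u x| `^ (2 / (r - 1))) `|V x| r.
  rewrite powR_ge0 normr_ge0 => /(_ isT isT r1'').
  rewrite -!powRrM divfK ?gt_eqF ?subr_gt0// mulrAC -(mulrA 2 r) -/s.
  rewrite powR_mulrn// real_normK ?num_real// normrM (ger0_norm (sqr_ge0 _)).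
  have := powR_ge0 `|u x| (2 * s); have := powR_ge0 `|V x| r.
  move: (`|u x| `^ (2 * s)) (`|V x| `^ r) => a b b0 a0.
  rewrite [_ * `|V x|]mulrC => h; rewrite -(ler_pM2l r0); apply: le_trans h _.
  by nra.
- have [M VM] : exists M, {ae leb, forall x, `|V x| <= M}.
    move: Vy; rewrite /finite_norm unlock; case: ifPn => [_|leb0 _].
      exact: (@ess_supr_bounded _ _ _ leb (fun x => `|V x|)).
    (* The other branch of the norm at +oo: the whole space has measure 0, and any bound holds
       almost everywhere. *)
    exists 0, setT; split => //.
    by apply/eqP; rewrite eq_le measure_ge0 andbT leNgt.
  by apply: (bounded _ _ M) => //; exact: measurable_funX.
Qed.

End potential.

(** * The critical point *)
Section directional_derivative.
Context {R : realType} {N : nat}.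
Local Notation leb := (@lebesgue_rV R N).
Implicit Types (u v w : 'rV[R]_N -> R) (x : 'rV[R]_N) (i j : 'I_N).

Lemma potential_integrableM (V u v : 'rV[R]_N -> R) :
  measurable_fun setT V -> measurable_fun setT u -> measurable_fun setT v ->
  leb.-integrable setT (fun x => (V x * u x ^+ 2)%:E) ->
  leb.-integrable setT (fun x => (V x * v x ^+ 2)%:E) ->
  leb.-integrable setT (fun x => (V x * u x * v x)%:E).
Proof.
move=> mV mu_ mv iu iv.
apply: (@integrable_le _ _ _ (fun x => `|V x * u x ^+ 2| + `|V x * v x ^+ 2|)).
- by apply: measurable_funM => //; exact: measurable_funM.
- by have := integrableD measurableT (integrable_abse iu) (integrable_abse iv); apply: eq_integrable.
move=> x; rewrite !(normrM (V x)) -mulrDr normrM (normrM (V x)) -mulrA.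
apply: ler_wpM2l => //; rewrite !normrX.
have := normr_ge0 (u x); have := normr_ge0 (v x).
by move: `|u x| `|v x| => a b b0 a0; have := sqr_ge0 (a - b); nra.
Qed.

Lemma linear_term_eq0 (b c : R) : (forall t, 0 <= t * b + t ^+ 2 * c) -> b = 0.
Proof.
move=> h; apply/eqP; apply: contrapT => /negP b0.
have k0 : 0 < `|c| + 1 by rewrite ltr_wpDl.
(* With k = |c| + 1 the polynomial takes the value -(b/k)^2 (k - c) at t = -b/k, negative unless b =
   0. *)
have := h (- b / (`|c| + 1)).
rewrite (_ : _ + _ = - ((b / (`|c| + 1)) ^+ 2 * (`|c| + 1 - c))); last by field; rewrite gt_eqF.
rewrite oppr_ge0 leNgt mulr_gt0//.
  by rewrite exprn_even_gt0//=; apply: mulf_neq0; rewrite ?invr_eq0 ?(gt_eqF k0).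
by rewrite subr_gt0 (le_lt_trans (ler_norm c))// ltrDl.
Qed.

Lemma Rintegral_quadratic (a b c : 'rV[R]_N -> R) (t : R) :
  leb.-integrable setT (EFin \o a) -> leb.-integrable setT (EFin \o b) ->
  leb.-integrable setT (EFin \o c) ->
  \int[leb]_x (a x + t * b x + t ^+ 2 * c x) =
  \int[leb]_x a x + t * \int[leb]_x b x + t ^+ 2 * \int[leb]_x c x.
Proof.
move=> ia ib ic.
have itb : leb.-integrable setT (EFin \o (fun x => t * b x)).
  by have := integrableZl measurableT t ib; apply: eq_integrable.
have itc : leb.-integrable setT (EFin \o (fun x => t ^+ 2 * c x)).
  by have := integrableZl measurableT (t ^+ 2) ic; apply: eq_integrable.
have iab : leb.-integrable setT (EFin \o (fun x => a x + t * b x)).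
  by have := integrableD measurableT ia itb; apply: eq_integrable.
by rewrite RintegralD// RintegralD// !RintegralZl.
Qed.

Lemma orthogonal_of_min (a b : 'rV[R]_N -> R) : L2 leb a -> L2 leb b ->
  (forall t, \int[leb]_x (`|a x| `^ 2)%:E <= \int[leb]_x (`|a x + t * b x| `^ 2)%:E)%E ->
  \int[leb]_x (a x * b x) = 0.
Proof.
move=> aL bL h; have iab := L2_integrableM aL bL.
have ia := L2_integrable_sqr aL; have ib := L2_integrable_sqr bL.
have i2 : leb.-integrable setT (EFin \o (fun x => 2 * (a x * b x))).
  by have := integrableZl measurableT 2 iab; apply: eq_integrable.
have : 2 * \int[leb]_x (a x * b x) = 0.
  apply: (@linear_term_eq0 _ (\int[leb]_x (b x ^+ 2))) => t.
  have : \int[leb]_x (a x ^+ 2) <= \int[leb]_x ((a x + t * b x) ^+ 2).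
    have := h t; rewrite !integral_powR2; apply: fine_le.
      exact: (integrable_fin_num measurableT ia).
    apply: (integrable_fin_num measurableT); apply: L2_integrable_sqr.
    by apply: L2D => //; exact: L2Z.
  rewrite (_ : \int[leb]_x ((a x + t * b x) ^+ 2) =
      \int[leb]_x (a x ^+ 2 + t * (2 * (a x * b x)) + t ^+ 2 * b x ^+ 2)); last first.
    by apply: eq_Rintegral => x _; ring.
  by rewrite Rintegral_quadratic// RintegralZl// -addrA lerDl.
by move=> /eqP; rewrite mulf_eq0 pnatr_eq0 => /eqP.
Qed.

End directional_derivative.

Lemma integrable_sum_EFin d (T : measurableType d) (R : realType)
    (mu : {measure set T -> \bar R}) (I : Type) (s : seq I) (f : I -> T -> R) :
  (forall i, mu.-integrable setT (EFin \o f i)) ->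
  mu.-integrable setT (EFin \o (fun x => \sum_(i <- s) f i x)).
Proof.
move=> fi; elim: s => [|i s IH].
  rewrite (_ : EFin \o _ = cst 0%E); first exact: integrable0.
  by apply/funext => x /=; rewrite big_nil.
have := integrableD measurableT (fi i) IH; apply: eq_integrable => // x _.
by rewrite /= big_cons EFinD.
Qed.

Lemma Rintegral_sum_eq0 d (T : measurableType d) (R : realType)
    (mu : {measure set T -> \bar R}) (I : Type) (s : seq I) (f : I -> T -> R) :
  (forall i, mu.-integrable setT (EFin \o f i)) ->
  (forall i, \int[mu]_x f i x = 0) -> \int[mu]_x (\sum_(i <- s) f i x) = 0.
Proof.
move=> fi f0; elim: s => [|i s IH].
  by under eq_Rintegral do rewrite big_nil; rewrite /Rintegral integral0.
under eq_Rintegral do rewrite big_cons.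
by rewrite RintegralD// ?IH ?f0 ?addr0//; exact: integrable_sum_EFin.
Qed.

Section critical_point.
Context {R : realType}.

Lemma is_derive_at_min (f : R -> R) (d : R) : is_derive (0 : R) (1 : R) f d ->
  (forall t, f 0 <= f t) -> d = 0.
Proof.
move=> fd fmin; apply/eqP; apply: contrapT => /negP d0.
have [/cvg_ex[l fl] fE] := fd; have {fE} ld : l = d by rewrite -fE; apply/esym/(cvg_lim _ fl).
have d0' : 0 < `|d| by rewrite normr_gt0.
have := fl; rewrite ld => /cvgrPdist_lt/(_ _ d0') [e /= e0 he].
have e2 : 0 < e / 2 by rewrite divr_gt0.
have q (h : R) : h != 0 -> `|h| = e / 2 -> `|d - h^-1 * (f h - f 0)| < `|d|.
  move=> h0 he2; have := he h; rewrite /= sub0r normrN he2 => /(_ _ h0).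
  rewrite addr0 [h%:A]mulr1; apply; lra.
(* By minimality the quotients at e/2 and -e/2 have opposite weak signs, whereas both are closer to
   [d] than |d| and so share its strict sign. *)
have := q (e / 2); rewrite gt_eqF// (gtr0_norm e2) => /(_ isT erefl).
have := q (- (e / 2)); rewrite oppr_eq0 gt_eqF// normrN (gtr0_norm e2) => /(_ isT erefl).
have e2V : 0 < (e / 2)^-1 by rewrite invr_gt0.
rewrite invrN mulNr opprK.
have := mulr_ge0 (ltW e2V) (_ : 0 <= f (e / 2) - f 0).
have := mulr_ge0 (ltW e2V) (_ : 0 <= f (- (e / 2)) - f 0).
rewrite !subr_ge0 !fmin => /(_ isT) + /(_ isT).
move: (_ * _) (_ * _) => a b a0 b0.
case: (ltgtP d 0) d0 => // dd _; rewrite ?(gtr0_norm dd) ?(ltr0_norm dd) !ltr_norml => /andP[] *; lra.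
Qed.

Lemma eq_Rintegral_ae d (T : measurableType d) (mu : {measure set T -> \bar R})
    (f g : T -> R) : measurable_fun setT f -> measurable_fun setT g ->
  {ae mu, forall x, f x = g x} -> \int[mu]_x f x = \int[mu]_x g x.
Proof.
move=> mf mg fg; congr fine; apply: ae_eq_integral => //; try exact/measurable_EFinP.
by apply: filterS fg => x -> _.
Qed.

(** [sobolev 2] differentiates some weak partial derivative, possibly another representative than
    the chosen [weak_partial i u]. Uniqueness almost everywhere transfers the second derivatives. *)
Lemma weak_gradient_partial N (u : 'rV[R]_N -> R) : sobolev 2 u ->
  exists H : 'I_N -> 'I_N -> 'rV[R]_N -> R,
    forall i, weak_gradient (weak_partial i u) (H i).
Proof.
move=> [/Lfun_L2 uL u2]; suff /choice[H HP] : forall i,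
    exists h, weak_gradient (weak_partial i u) h by exists H.
move=> i.
have [g ug g1] := u2 i; have [h [gL gh]] := (sobolev1P _).1 g1.
have u1 : sobolev 1 u.
  by split; [exact/Lfun_L2|move=> j; have [f uf [fL _]] := u2 j; exists f].
have [_ /(_ i) [wL uw]] := weak_partialP u1.
exists h; split => // j; have [hL hj] := gh j; split => //.
apply: is_weak_partial_ae hj => //; exact: weak_partial_unique gL wL ug uw.
Qed.

Variables (N' : nat).
Local Notation N := N'.+1.
Local Notation leb := (@lebesgue_rV R N).
Variables (nu : 'rV[R]_N) (u : 'rV[R]_N -> R) (G : 'I_N -> 'rV[R]_N -> R)
  (H : 'I_N -> 'I_N -> 'rV[R]_N -> R).
Hypotheses (uG : weak_gradient u G) (GH : forall i, weak_gradient (G i) (H i)).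

Let phi x := \sum_i nu ord0 i * G i x.
Let K j x := \sum_i nu ord0 i * H i j x.

Lemma weak_gradient_dir : weak_gradient phi K.
Proof.
split => [|j]; first by apply: L2_sum => i; apply: L2Z; exact: (GH i).1.
split; first by apply: L2_sum => i; apply: L2Z; exact: ((GH i).2 j).1.
apply: is_weak_partial_sum => i; [exact: (GH i).1|exact: ((GH i).2 j).1|exact: ((GH i).2 j).2].
Qed.

Lemma dir_orthogonal : \int[leb]_x (u x * phi x) = 0.
Proof.
apply: (orthogonal_of_min uG.1 weak_gradient_dir.1) => t.
by apply: power_energy_min => //; [exact: uG.1|move=> i; exact: (uG.2 i).1|move=> i; exact: (uG.2 i).2].
Qed.

Lemma gradient_dir_orthogonal j : \int[leb]_x (G j x * K j x) = 0.
Proof.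
(* The inequality applied to [G j] yields derivatives of [G j] in the directions [i], whereas [K j]
   contains derivatives of [G i] in the direction [j]; [weak_partialC] identifies them almost
   everywhere. *)
pose K' x := \sum_i nu ord0 i * H j i x.
have K'L : L2 leb K' by apply: L2_sum => i; apply: L2Z; exact: ((GH j).2 i).1.
have GL := (uG.2 j).1.
rewrite -[RHS](_ : \int[leb]_x (G j x * K' x) = 0); last first.
  apply: (orthogonal_of_min GL K'L) => t.
  by apply: power_energy_min => //; [move=> i; exact: ((GH j).2 i).1|
    move=> i; exact: ((GH j).2 i).2].
apply: eq_Rintegral_ae.
- by apply: measurable_funM; [exact: L2_measurable GL|exact: L2_measurable ((weak_gradient_dir).2 j).1].
- by apply: measurable_funM; [exact: L2_measurable GL|exact: L2_measurable K'L].
have : {ae leb, forall x, forall i, H i j x = H j i x}.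
  apply: filter_forall => i.
  by apply: (weak_partialC uG.1 (uG.2 i).1 (uG.2 j).1 ((GH i).2 j).1 ((GH j).2 i).1
    (uG.2 i).2 (uG.2 j).2 ((GH i).2 j).2 ((GH j).2 i).2).
by apply: filterS => x HC; congr (_ * _); apply: eq_bigr => i _; rewrite HC.
Qed.

End critical_point.

Theorem proposition1p12 (R : realType) (N : nat) (rho p : R) (r : \bar R)
    (V u : 'rV[R]_N -> R) :
  (1 <= N)%N -> 0 < rho ->
  2 < p -> (p%:E < critical_exponent R N)%E ->
  (maxe 1 (N%:R / 2)%:E <= r)%E -> (N = 2%N -> (1 < r)%E) ->
  V \in Lfun (lebesgue_rV N) r ->
  mass_sphere rho u -> sobolev 2 u ->
  constrained_critical (energy V p) rho u ->
  forall nu : 'rV[R]_N, nu != 0 ->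
  (\int[lebesgue_rV N]_x (V x * u x * weak_dir_derive nu u x)%:E = 0)%E.
Proof.
move=> N1 rho0 p2 pN rN r2 VL [u1 _] uW [_ crit] nu nu0.
case: N => [//|N'] in V u nu nu0 N1 pN rN r2 VL u1 uW crit *.
have uG := weak_partialP u1; have [H GH] := weak_gradient_partial uW.
set G := fun i => weak_partial i u in uG.
have phiK := weak_gradient_dir nu GH.
set phi := (fun x => _) in phiK; set K := (fun j x => _) in phiK.
have [uL Gi] := uG; have [pL Ki] := phiK.
have GL i := (Gi i).1; have KL i := (Ki i).1.
have [mu_ mp] := (L2_measurable uL, L2_measurable pL).
have mV : measurable_fun setT V by move: VL; rewrite inE => /andP[/[!inE]].
have iVu := potential_integrable_sqr rN r2 VL uG.
have iVp := potential_integrable_sqr rN r2 VL phiK.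
have iVup := potential_integrableM mV mu_ mp iVu iVp.
have uphi : \int[lebesgue_rV N'.+1]_x (u x * phi x) = 0 := dir_orthogonal nu uG GH.
have GK j : \int[lebesgue_rV N'.+1]_x (G j x * K j x) = 0 := gradient_dir_orthogonal nu uG GH j.
(* The conclusion concerns the extended-real integral; integrability of V u phi rules out that the
   real-valued one is 0 merely by default. *)
suff b0 : \int[lebesgue_rV N'.+1]_x (V x * u x * phi x) = 0.
  by rewrite -[LHS]fineK ?(integrable_fin_num measurableT iVup)//; congr (_%:E).
have Ederiv := crit phi ((sobolev1P _).2 (ex_intro _ K phiK)) uphi.
pose leb := @lebesgue_rV R N'.+1.
(* [A], [B] and [C] are the coefficients of 1, t and t^2 in the quadratic part of the energy density
   of [u + t * phi]. *)
pose A x := \sum_i G i x ^+ 2 - V x * u x ^+ 2.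
pose B x := 2 * (\sum_i G i x * K i x - V x * u x * phi x).
pose C x := \sum_i K i x ^+ 2 - V x * phi x ^+ 2.
have isum (f : 'I_N'.+1 -> 'rV[R]_N'.+1 -> R) : (forall i, leb.-integrable setT (EFin \o f i)) ->
    leb.-integrable setT (EFin \o (fun x => \sum_i f i x)).
  exact: integrable_sum_EFin.
have iA : leb.-integrable setT (EFin \o A).
  have := integrableB measurableT (isum _ (fun i => L2_integrable_sqr (GL i))) iVu.
  exact: eq_integrable.
have iGK : leb.-integrable setT (EFin \o (fun x => \sum_i G i x * K i x)).
  by apply: isum => i; exact: L2_integrableM.
have iB' : leb.-integrable setT (EFin \o (fun x => \sum_i G i x * K i x - V x * u x * phi x)).
  by have := integrableB measurableT iGK iVup; exact: eq_integrable.
have iB : leb.-integrable setT (EFin \o B).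
  by have := integrableZl measurableT 2 iB'; exact: eq_integrable.
have iC : leb.-integrable setT (EFin \o C).
  have := integrableB measurableT (isum _ (fun i => L2_integrable_sqr (KL i))) iVp.
  exact: eq_integrable.
have BE : \int[leb]_x B x = - 2 * \int[leb]_x (V x * u x * phi x).
  rewrite RintegralZl// RintegralB// Rintegral_sum_eq0 ?sub0r ?mulrN ?mulNr//.
  by move=> i; exact: L2_integrableM.
pose J t := \int[leb]_x (`|u x + t * phi x| `^ p).
have EE t : energy V p (fun x => u x + t * phi x) =
    2^-1 * (\int[leb]_x A x + t * \int[leb]_x B x + t ^+ 2 * \int[leb]_x C x) - p^-1 * J t.
  rewrite /energy -/(J t); congr (_ * _ - _); rewrite -Rintegral_quadratic//.
  have utG := weak_gradientDZ t uG phiK.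
  apply: eq_Rintegral_ae.
  - apply: measurable_funB.
      apply: measurable_sum => i; apply: measurable_funX.
      have [_ wG] := weak_partialP ((sobolev1P _).2 (ex_intro _ _ utG)).
      exact: L2_measurable (wG i).1.
    apply: measurable_funM => //; apply: measurable_funX.
    exact: L2_measurable utG.1.
  - apply: measurable_funD; first apply: measurable_funD.
    + by apply/measurable_EFinP; exact: measurable_int iA.
    + by apply: measurable_funM => //; apply/measurable_EFinP; exact: measurable_int iB.
    + by apply: measurable_funM => //; apply/measurable_EFinP; exact: measurable_int iC.
  (* The energy is computed with the chosen representatives, which agree with [G i + t * K i] only
     almost everywhere; there are finitely many indices [i]. *)
  have : {ae leb, forall x, forall i,
      weak_partial i (fun x => u x + t * phi x) x = G i x + t * K i x}.
    apply: filter_forall => i; exact: weak_gradient_ae utG.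
  apply: filterS => x wE; rewrite /sq_norm_grad (eq_bigr (fun i => (G i x + t * K i x) ^+ 2)); last first.
    by move=> i _; rewrite wE.
  rewrite (eq_bigr (fun i => G i x ^+ 2 + t * (2 * (G i x * K i x)) + t ^+ 2 * K i x ^+ 2)); last first.
    by move=> i _; ring.
  rewrite !big_split/= -!mulr_sumr /A /B /C; ring.
(* The place where p < 2^* enters. With finite integrals the inequality between extended reals
   descends to [J], which [fine] would not respect at +oo. *)
have Jfin t : (\int[leb]_x (`|u x + t * phi x| `^ p)%:E)%E \is a fin_num.
  rewrite ge0_fin_numE; last by apply: integral_ge0 => x _; rewrite lee_fin powR_ge0.
  apply: (sobolev_embedding (weak_gradientDZ t uG phiK)); first exact: ltW.
  move=> N2; move: pN; rewrite /critical_exponent ifT; last by rewrite ltnS.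
  by rewrite lte_fin => /ltW.
have Jmin t : J 0 <= J t.
  apply: fine_le; [exact: Jfin|exact: Jfin|].
  under eq_integral do rewrite mul0r addr0.
  apply: power_energy_min => //; first exact: ltW.
  by move=> i; exact: (Gi i).2.
have p0 : 0 < p by lra.
have : 2^-1 * \int[leb]_x B x = 0.
  apply: (@is_derive_at_min _ (fun t => p^-1 * J t)); last first.
    by move=> t; rewrite ler_pM2l ?invr_gt0.
  have JE : (fun t => p^-1 * J t) = (fun t => 2^-1 * (\int[leb]_x A x + t * \int[leb]_x B x +
      t ^+ 2 * \int[leb]_x C x) - energy V p (fun x => u x + t * phi x)).
    by apply/funext => t; rewrite EE opprB addrC subrK.
  rewrite JE; move: (\int[leb]_x A x) (\int[leb]_x B x) (\int[leb]_x C x) => a b c.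
  have q : is_derive (0 : R) (1 : R) (fun t : R => 2^-1 * (a + t * b + t ^+ 2 * c)) (2^-1 * b).
    apply: is_derive_eq; rewrite /GRing.scale/= !expr0n/=; ring.
  by have := is_deriveB q Ederiv; rewrite subr0.
by rewrite BE => /eqP; rewrite !mulf_eq0 invr_eq0 oppr_eq0 pnatr_eq0 => /eqP.
Qed.
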